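(* Fix $\varepsilon>0$. There is a constant $d_0=d_0(\varepsilon)>0$ for which the following holds. For all even integers $L\ge4$ and all integers $d\ge d_0$, if $\mathbb{I}$ is a uniformly chosen independent set from $T_{L,d}$, then $$\mathbb{P}\Big(\big||\mathbb{I}\cap\mathcal{E}|-|\mathbb{I}\cap\mathcal{O}|\big|\le(.25-\varepsilon)L^d\Big)\ \le\ \exp\left\{-\frac{2L^{d-1}}{d^4\log^2L}\right\}.$$
   Context: For $L$ even, $T_{L,d}$ (the even discrete torus) is the graph on vertex set $\{0,\dots,L-1\}^d$ in which two vertices are adjacent if they differ on exactly one coordinate and differ by $1\pmod L$ on that coordinate. It is bipartite with classes $\mathcal{E}$ (vertices whose coordinate sum is even) and $\mathcal{O}$ (vertices whose coordinate sum is odd). An independent set is a set of vertices spanning no edges. $\log$ is the natural logarithm. *)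

(* Defs.v *)
From mathcomp Require Import all_boot all_order all_algebra.
From mathcomp Require Import all_classical all_reals all_analysis.

Set Implicit Arguments.
Unset Strict Implicit.
Unset Printing Implicit Defensive.

Import Order.TTheory GRing.Theory Num.Theory.
Local Open Scope ring_scope.

Definition torus (L d : nat) : finType := {ffun 'I_d -> 'I_L}.

Definition torus_adj (L d : nat) (u v : torus L d) : bool :=
  [exists i : 'I_d,
    [forall j : 'I_d, (u j != v j) == (j == i)] &&
    (((u i).+1 == v i %[mod L])%N || ((v i).+1 == u i %[mod L])%N)].

Definition torus_even (L d : nat) : {set torus L d} :=
  [set v : torus L d | ~~ odd (\sum_(i < d) v i)%N].

Definition torus_odd (L d : nat) : {set torus L d} :=
  [set v : torus L d | odd (\sum_(i < d) v i)%N].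

Definition independent (V : finType) (e : rel V) (I : {set V}) : bool :=
  [forall x in I, forall y in I, ~~ e x y].

Definition indep_sets (V : finType) (e : rel V) : {set {set V}} :=
  [set I : {set V} | independent e I].

(* The probability that a uniformly chosen element of the finite set Omega
   satisfies P; it is 0 by convention if Omega is empty, which never happens
   for [indep_sets e], since set0 is independent. *)
Definition unif_prob (R : realType) (T : finType) (Omega : {set T})
    (P : pred T) : R :=
  #|[set x in Omega | P x]|%:R / #|Omega|%:R.

(* Main.v *)
(* The torus of side L = 2m is tiled by m^d blocks of side 3 (overlapping in faces).  Call a block
   bad if in some direction one of its layers, or the union of two adjacent layers, meets the two
   classes almost equally.  A good block is strongly unbalanced towards one class, its phase, and
   adjacent good blocks have the same phase, as they share a layer.

   Bad blocks are rare.  Each pattern of block events is compared, through a Hoelder inequality for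
   traces of matrix products applied in each direction (reflection positivity), with the same event
   repeated periodically in the torus of side 4, which is the hypercube Q_2d.  There, graph
   containers and Talagrand's isoperimetric inequality show that almost balanced independent sets of
   a hypercube are far fewer than 2^(half of the number of vertices), while all independent sets
   are not many more than that.

   It remains to see that if bad blocks are rare, most blocks have the same phase.  If in every
   direction few lines of blocks contain a bad block, two typical blocks are joined by a path along
   good lines.  When m is too large for this to be likely, one first groups the blocks into cells. *)

Require Import Defs.
From mathcomp Require Import all_boot all_order all_algebra.
From mathcomp Require Import reals sequences exp.
From mathcomp Require Import ring lra zify.

Set Implicit Arguments.
Unset Strict Implicit.
Unset Printing Implicit Defensive.

(** * Containers for bipartite doubles *)

(** The constant 1/4 is what a typical independent set of a hypercube achieves: it leaves one class
    almost empty and takes about half of the other, a quarter of all vertices. Balance is tested on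
    single layers and on pairs of adjacent layers because in the torus of side 4 these are subcubes
    of codimension 2 and 1, to which the counts for hypercubes apply directly. Two obstacles shape
    the rest. Reflections of a cycle require an even number of blocks; for odd [m] the events are
    repeated along [m - 1] blocks, so tori with [m - 1] and [m] blocks per direction have to be
    compared. A crude comparison would cost an exponent of order [m ^ d], too much for large [m];
    log-convexity of traces of powers of a transfer matrix improves it by a factor of order [m ^ 2].
    Moreover the probability of a bad block depends on [d] only, whereas lines of [m] blocks can be
    arbitrarily long. Coarsening makes lines without bad cells typical again, and its cost is the
    factor [log^2 L] of the theorem. *)

Lemma card_le_cover (I T : finType) (P : pred I) (F : I -> {set T}) (A : {set T}) :
  (forall x, x \in A -> exists2 i, P i & x \in F i) ->
  #|A| <= \sum_(i | P i) #|F i|.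
Proof.
move=> cov; apply: leq_trans (_ : \sum_(x in A) \sum_(i | P i) (x \in F i) <= _).
  rewrite -sum1_card; apply: leq_sum => x /cov [i Pi xi].
  by rewrite (bigD1 i) //= xi.
rewrite exchange_big /=; apply: leq_sum => i _.
rewrite -sum1_card [X in _ <= X]big_mkcond /= [X in X <= _]big_mkcond /=.
by apply: leq_sum => x _; do 2![case: (_ \in _)].
Qed.

Lemma leq_card_bigcups (I T : finType) (P : pred I) (F : I -> {set T}) :
  #|\bigcup_(i | P i) F i| <= \sum_(i | P i) #|F i|.
Proof. by apply: card_le_cover => x /bigcupP. Qed.

Section Container.
Variables (X : finType) (rho : rel X) (k : nat).
Hypothesis rho_sym : symmetric rho.
Hypothesis rho_reg : forall x, #|[set y | rho x y]| = k.
Hypothesis k_gt0 : 0 < k.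
Implicit Types A B F G J K U : {set X}.

Definition nb x : {set X} := [set y | rho x y].
Definition nbs A : {set X} := [set y | [exists x in A, rho x y]].
(** [hull (nbs J)] is the closure of [J], the largest set with the same neighbourhood. The
    difference in size between [nbs J] and this closure, called [t] below, measures the
    expansion. *)
Definition hull G : {set X} := [set x | nb x \subset G].
Definition small j : {set {set X}} := [set S : {set X} | #|S| <= j].

Lemma mem_nbs A x y : x \in A -> rho x y -> y \in nbs A.
Proof. by move=> xA xy; rewrite inE; apply/existsP; exists x; apply/andP. Qed.

Lemma nbsP A y : reflect (exists2 x, x \in A & rho x y) (y \in nbs A).
Proof. by rewrite inE; apply: (iffP exists_inP). Qed.

Lemma nbsS A B : A \subset B -> nbs A \subset nbs B.
Proof.
move=> /subsetP s; apply/subsetP => y /nbsP [x /s xB xy]; exact: mem_nbs xB xy.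
Qed.

Lemma nbsU A B : nbs (A :|: B) = nbs A :|: nbs B.
Proof.
apply/setP => y; rewrite !inE; apply/existsP/orP.
  move=> [x /andP[]]; rewrite inE => /orP[] xA xy; [left|right];
    by apply/existsP; exists x; apply/andP.
by case=> /existsP[x /andP[xA xy]]; exists x; rewrite inE xA ?orbT.
Qed.

Lemma sub_hull J : J \subset hull (nbs J).
Proof.
apply/subsetP => x xJ; rewrite inE; apply/subsetP => y; rewrite inE.
exact: mem_nbs.
Qed.

Lemma nbs_hull G : nbs (hull G) \subset G.
Proof.
by apply/subsetP => y /nbsP[x]; rewrite inE => /subsetP s xy; apply: s; rewrite inE.
Qed.

Lemma nbs_hull_nbs J : nbs (hull (nbs J)) = nbs J.
Proof. by apply/eqP; rewrite eqEsubset nbs_hull nbsS ?sub_hull. Qed.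

Lemma card_nb x : #|nb x| = k. Proof. exact: rho_reg. Qed.

Lemma double_count A B :
  \sum_(x in A) #|nb x :&: B| = \sum_(y in B) #|nb y :&: A|.
Proof.
transitivity (\sum_(x in A) \sum_(y in B) (rho x y : nat)).
  apply: eq_bigr => x _; rewrite -sum1_card big_mkcond [RHS]big_mkcond /=.
  by apply: eq_bigr => y _; rewrite !inE; case: (rho x y); case: (y \in B).
rewrite exchange_big /=; apply: eq_bigr => y _.
rewrite -sum1_card big_mkcond [RHS]big_mkcond /=.
by apply: eq_bigr => x _; rewrite !inE rho_sym; case: (rho y x); case: (x \in A).
Qed.

Lemma card_nbD x A : #|nb x :\: A| + #|nb x :&: A| = k.
Proof. by rewrite addnC cardsID card_nb. Qed.

(** All [k] edges at a vertex of the hull end in [G], so the hull absorbs [k * #|hull G|] of the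
    [k * #|G|] edge ends at [G]. The remainder counts the edges from [G] to vertices outside the
    hull. *)
Lemma hull_edges G : \sum_(u in G) #|nb u :\: hull G| + k * #|hull G| = k * #|G|.
Proof.
have -> : k * #|hull G| = \sum_(u in G) #|nb u :&: hull G|.
  rewrite -double_count mulnC -sum_nat_const; apply: eq_bigr => x.
  by rewrite inE => /setIidPl ->; rewrite card_nb.
rewrite -big_split /= mulnC -sum_nat_const; apply: eq_bigr => u _.
exact: card_nbD.
Qed.

Lemma card_hull_le G : #|hull G| <= #|G|.
Proof. by rewrite -(leq_pmul2l k_gt0) -(hull_edges G) leq_addl. Qed.

(** Averaging: there are at least [#|U| * h] adjacent pairs between [A] and [U], so some vertex of
    [A] sees at least its average share of [U]. *)
Lemma greedy_step A U h : 0 < h -> (forall u, u \in U -> h <= #|nb u :&: A|) ->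
  U != set0 -> exists2 v, v \in A & #|U| * h <= #|A| * #|nb v :&: U|.
Proof.
move=> h0 hU U0; apply/exists_inP; apply: contraT.
rewrite negb_exists_in => /forall_inP nall.
have lt v : v \in A -> #|A| * #|nb v :&: U| < #|U| * h.
  by move=> vA; rewrite ltnNge; apply: nall.
have le1 : #|U| * h <= \sum_(v in A) #|nb v :&: U|.
  by rewrite double_count -sum_nat_const; apply: leq_sum.
have [u uU] := set0Pn _ U0.
have : 0 < #|nb u :&: A| by apply: leq_trans h0 (hU u uU).
rewrite card_gt0 => /set0Pn [a]; rewrite inE => /andP[_ aA].
have A0 : 0 < #|A| by rewrite card_gt0; apply/set0Pn; exists a.
have : \sum_(v in A) #|A| * #|nb v :&: U| < \sum_(v in A) (#|U| * h).
  rewrite (bigD1 a) //= [X in _ < X](bigD1 a) //= -addSn.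
  by apply: leq_add; [exact: lt|apply: leq_sum => v /andP[vA _]; exact/ltnW/lt].
rewrite -big_distrr sum_nat_const /= ltn_pmul2l // => lt2.
by have := leq_ltn_trans le1 lt2; rewrite ltnn.
Qed.

(** While more than half of [U] is uncovered, a greedy step covers at least [h * #|U| / (2 * #|A|)]
    further vertices; the second alternative records [s] such gains, cleared of denominators. *)
Lemma greedy_steps A U h s : 0 < h -> (forall u, u \in U -> h <= #|nb u :&: A|) ->
  exists2 Y : {set X}, (Y \subset A) && (#|Y| <= s) &
    2 * #|U :\: nbs Y| <= #|U| \/
    2 * #|A| * #|U :\: nbs Y| + s * h * #|U| <= 2 * #|A| * #|U|.
Proof.
move=> h0 hU; elim: s => [|s [Y /andP[YA Ys] [le|le]]].
- exists set0; first by rewrite sub0set cards0.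
  by right; rewrite !mul0n addn0 leq_mul // subset_leq_card // subsetDl.
- by exists Y; [rewrite YA ltnW|left].
set W := U :\: nbs Y in le.
case: (leqP (2 * #|W|) #|U|) => [le2|gt2].
  by exists Y; [rewrite YA ltnW|left].
have W0 : W != set0 by rewrite -card_gt0; case: #|W| gt2.
have hW u : u \in W -> h <= #|nb u :&: A| by rewrite inE => /andP[_]; exact: hU.
have [v vA lev] := greedy_step h0 hW W0.
exists (v |: Y).
  rewrite subUset sub1set vA YA /= cardsU1.
  by rewrite -add1n leq_add // leq_b1.
right.
have eqW : U :\: nbs (v |: Y) = W :\: nb v.
  rewrite nbsU setUC -setDDl; congr (_ :\: _).
  apply/setP => y; rewrite [RHS]inE; apply/nbsP/idP => [[x]|vy].
    by rewrite inE => /eqP ->.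
  by exists v; rewrite ?inE.
have cW : #|W :\: nb v| + #|nb v :&: W| = #|W|.
  by rewrite addnC setIC cardsID.
rewrite eqW; nia.
Qed.

Lemma greedy_half A U h s : 0 < h -> (forall u, u \in U -> h <= #|nb u :&: A|) ->
  #|A| <= s * h ->
  exists2 Y : {set X}, (Y \subset A) && (#|Y| <= s) & 2 * #|U :\: nbs Y| <= #|U|.
Proof.
move=> h0 hU sh; have [Y YA [le|le]] := greedy_steps s h0 hU; exists Y => //.
case: (set_0Vmem U) => [->|[u uU]]; first by rewrite set0D cards0.
have A0 : 0 < #|A|.
  apply: leq_trans (subset_leq_card (subsetIr (nb u) A)).
  exact: leq_trans h0 (hU _ uU).
nia.
Qed.

Lemma greedy_iter A U h s r : 0 < h -> (forall u, u \in U -> h <= #|nb u :&: A|) ->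
  #|A| <= s * h ->
  exists2 Y : {set X}, (Y \subset A) && (#|Y| <= r * s) & 2 ^ r * #|U :\: nbs Y| <= #|U|.
Proof.
move=> h0 hU sh; elim: r => [|r [Y /andP[YA Ys] le]].
  exists set0; first by rewrite sub0set cards0.
  by rewrite mul1n subset_leq_card // subsetDl.
have hW u : u \in U :\: nbs Y -> h <= #|nb u :&: A|.
  by rewrite inE => /andP[_]; exact: hU.
have [Y' /andP[Y'A Y's] le'] := greedy_half h0 hW sh.
exists (Y :|: Y').
  rewrite subUset YA Y'A /= mulSn addnC.
  by apply: leq_trans (leq_card_setU _ _) _; rewrite leq_add.
rewrite nbsU -setDDl expnS; apply: leq_trans le.
by rewrite mulnAC mulnC leq_mul2l le' orbT.
Qed.

(** Vertices of [A] with more than [phi] uncovered neighbours are added as long as there are any.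
    Each covers at least [phi.+1] new vertices of [G], which bounds their number; the proof takes a
    largest [Y] within this budget. *)
Lemma greedy_cover A F G phi : nbs A \subset G -> F \subset G ->
  exists2 Y : {set X}, (Y \subset A) && (#|Y| * phi.+1 <= #|G :\: F|) &
    forall v, v \in A -> #|nb v :\: (F :|: nbs Y)| <= phi.
Proof.
move=> AG FG.
pose P (Y : {set X}) := (Y \subset A) && (#|Y| * phi.+1 + #|G :\: (F :|: nbs Y)| <= #|G :\: F|).
have P0 : P set0.
  rewrite /P sub0set cards0 mul0n add0n subset_leq_card // setDS // subsetUl.
  by [].
case: (arg_maxnP (fun Y : {set X} => #|Y|) P0) => Y /andP[YA Yle] Ymax.
exists Y; first by rewrite YA (leq_trans _ Yle) // leq_addr.
move=> v vA; rewrite leqNgt; apply/negP => gt.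
have vG : nb v \subset G.
  by apply: subset_trans AG; apply/subsetP => y; rewrite inE; exact: mem_nbs.
have vY : v \notin Y.
  apply/negP => vY; move: gt; rewrite (_ : _ :\: _ = set0) ?cards0 //.
  apply/eqP; rewrite setD_eq0 subsetU //; apply/orP; right.
  by apply/subsetP => y; rewrite inE; exact: mem_nbs.
have := Ymax (v |: Y); rewrite cardsU1 vY /= add1n ltnn => imp.
have : false; last by [].
apply: imp; rewrite /P subUset sub1set vA YA /= cardsU1 vY /= add1n mulSn.
set Q := F :|: nbs Y in gt Yle.
have -> : F :|: nbs (v |: Y) = Q :|: nb v.
  rewrite nbsU /Q -setUA; congr (_ :|: _); rewrite setUC; congr (_ :|: _).
  apply/setP => y; rewrite [RHS]inE; apply/nbsP/idP => [[x]|vy].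
    by rewrite inE => /eqP ->.
  by exists v; rewrite ?inE.
have eqQ : (G :\: Q) :&: nb v = nb v :\: Q.
  by rewrite setIDAC (setIidPr vG).
have := cardsID (nb v) (G :\: Q); rewrite eqQ setDDl => cQ.
by lia.
Qed.

(** There are [k * t] edges from [G] to the complement of the hull, and a vertex counted here sends
    at least half of its [k] edges there. *)
Lemma hull_light t G h : #|G| = #|hull G| + t -> k <= 2 * h ->
  #|[set u in G | #|nb u :&: hull G| <= k - h]| <= 2 * t.
Proof.
move=> Gt kh; rewrite -(leq_pmul2l k_gt0).
have := hull_edges G; rewrite Gt mulnDr addnC => /addnI eq.
set U := [set u in G | _].
have UG : U \subset G by apply/subsetP => u; rewrite inE => /andP[].
have le : #|U| * k <= 2 * (k * t).
  rewrite -eq -sum_nat_const big_distrr [X in _ <= X](big_setID U) /= (setIidPr UG).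
  apply: leq_trans (leq_addr _ _); apply: leq_sum => u.
  rewrite inE => /andP[_ le]; have := card_nbD u (hull G); lia.
lia.
Qed.

(* Pairs [(J, K)] with [K] disjoint from [nbs J] encode the independent sets of
   the bipartite double cover of [rho]. *)
Definition hc_pairs : {set {set X} * {set X}} := [set p : {set X} * {set X} | [disjoint p.2 & nbs p.1]].

Definition hc_type g t : {set {set X} * {set X}} :=
  [set p in hc_pairs | (#|nbs p.1| == g) && (#|hull (nbs p.1)| + t == g)].

Lemma card_hc_below (S : {set X}) g :
  #|[set p in hc_pairs | (p.1 \subset S) && (#|nbs p.1| == g)]| <= 2 ^ (#|S| + (#|X| - g)).
Proof.
apply: leq_trans (_ : \sum_(J : {set X} | (J \subset S) && (#|nbs J| == g))
    #|setX [set J] (powerset (~: nbs J))| <= _).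
  apply: card_le_cover => -[J K]; rewrite !inE /= => /andP[dis /andP[JS /eqP Jg]].
  exists J; first by rewrite JS Jg eqxx.
  rewrite !inE eqxx /=; rewrite disjoints_subset in dis; exact: dis.
rewrite (eq_bigr (fun=> 2 ^ (#|X| - g))); last first.
  by move=> J /andP[_ /eqP <-]; rewrite cardsX cards1 mul1n card_powerset cardsCs setCK.
rewrite sum_nat_const expnD leq_mul2r; apply/orP; right.
rewrite -card_powerset; apply: subset_leq_card; apply/subsetP => J.
by rewrite !inE => /andP[].
Qed.

(** Sapozhenko's graph containers. The neighbourhood [G] of [J] is approximated from inside by [F],
    the neighbourhood of a few vertices of the hull. If at most [k3] vertices of [G] are missing,
    adding them determines [G]; then [J] lies in a hull of size [g - t] and [K] avoids [G], which
    leaves [2 ^ (#|X| - t)] choices. Otherwise [F] is so small that the set [S] of vertices with at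
    most [phi] neighbours outside [F], which contains [J], is smaller than [g] by more than
    [k3 - e]; this leaves [2 ^ (#|X| + e - k3.+1)] choices without knowing [G]. *)
Lemma container g t h s r phi k1 k2 k3 e :
  0 < t -> 0 < h -> k <= 2 * h -> 2 * h <= k.+2 -> g <= t + s * (k - h).+1 -> g <= 2 ^ r * t ->
  r * s <= k1 -> 3 * t <= k2 * phi.+1 -> 2 * phi <= k -> 2 * phi * g <= e * k ->
  #|hc_type g t| <= #|small k1| * #|small k2| *
    (#|small k3| * 2 ^ (#|X| - t) + 2 ^ (#|X| + e - k3.+1)).
Proof.
move=> t0 h0 kh hk gs gr rs3 k2phi phik ephi.
pose F (c : {set X} * {set X}) := nbs c.1 :|: nbs c.2.
pose S (c : {set X} * {set X}) := [set v | #|nb v :\: F c| <= phi].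
pose T1 c := \bigcup_(D in small k3) [set p in hc_type g t | nbs p.1 == F c :|: D].
pose T2 c := [set p in hc_type g t | (p.1 \subset S c) && (#|F c| + k3 < g)].
apply: leq_trans (_ : \sum_(c in setX (small k1) (small k2)) #|T1 c :|: T2 c| <= _).
  apply: card_le_cover => -[J K] JKT.
  move: (JKT); rewrite !inE /= => /andP[dis /andP[/eqP Jg /eqP At]].
  set G := nbs J in Jg At *; set A := hull G in At *.
  have Gt : #|G| = #|A| + t by rewrite Jg At.
  pose U := [set u in G | #|nb u :&: A| <= k - h].
  have lU : #|U| <= 2 * t by apply: hull_light.
  have hU u : u \in G :\: U -> (k - h).+1 <= #|nb u :&: A|.
    by rewrite !inE => /andP[nU uG]; move: nU; rewrite uG /= -ltnNge.
  have As : #|A| <= s * (k - h).+1 by lia.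
  (* [Y1] covers all but [t] of the vertices of [G] with many neighbours in the hull; with the at
     most [2 * t] other vertices this leaves [3 * t] uncovered. *)
  have [Y1 /andP[Y1A Y1s] Y1c] := greedy_iter r (ltn0Sn _) hU As.
  have nA : nbs A = G by apply: nbs_hull_nbs.
  have Y1G : nbs Y1 \subset G by rewrite -nA nbsS.
  have cGY : #|G :\: nbs Y1| <= 3 * t.
    have : #|G :\: nbs Y1| <= #|U| + #|(G :\: U) :\: nbs Y1|.
      apply: leq_trans (leq_card_setU _ _); apply: subset_leq_card.
      by apply/subsetP => x; rewrite !inE => /andP[-> ->]; rewrite /= andbT orbN.
    have : #|G :\: U| <= g by rewrite -Jg subset_leq_card // subsetDl.
    have r0 : 0 < 2 ^ r by rewrite expn_gt0.
    have : #|(G :\: U) :\: nbs Y1| <= t.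
      rewrite -(leq_pmul2l r0); apply: leq_trans Y1c _.
      by apply: leq_trans gr; rewrite -Jg subset_leq_card // subsetDl.
    lia.
  have AG : nbs A \subset G by rewrite nA.
  have [Y2 /andP[Y2A Y2s] Y2c] := greedy_cover phi AG Y1G.
  have Y2G : nbs Y2 \subset G by rewrite -nA nbsS.
  have FG : F (Y1, Y2) \subset G by rewrite subUset Y1G.
  exists (Y1, Y2).
    rewrite !inE /=; apply/andP; split; first by lia.
    by rewrite -(leq_pmul2r (ltn0Sn phi)); lia.
  rewrite inE; apply/orP; case: (leqP #|G :\: F (Y1, Y2)| k3) => [le|gt]; [left|right].
    apply/bigcupP; exists (G :\: F (Y1, Y2)); first by rewrite inE.
    rewrite inE JKT /=; apply/eqP.
    by rewrite -[LHS](setID _ (F (Y1, Y2))) (setIidPr FG).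
  rewrite inE JKT /=; apply/andP; split.
    apply/subsetP => v vJ; rewrite inE; apply: Y2c.
    exact: (subsetP (sub_hull J)).
  by have := cardsID (F (Y1, Y2)) G; rewrite (setIidPr FG) Jg; lia.
rewrite -cardsX -sum_nat_const; apply: leq_sum => c _.
apply: leq_trans (leq_card_setU _ _) _; apply: leq_add.
  apply: leq_trans (leq_card_bigcups _ _) _ => //.
  rewrite -sum_nat_const; apply: leq_sum => D _.
  set G := F c :|: D.
  case: (eqVneq (#|G|, #|hull G| + t) (g, g)) => [[Gg At]|ne]; last first.
    rewrite (_ : [set p in _ | _] = set0) ?cards0 //.
    apply/setP => -[J K]; rewrite !inE /=; apply/negP => /andP[/andP[_ /andP[/eqP a /eqP b]] /eqP e'].
    by move: ne; rewrite -e' a b eqxx.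
  apply: leq_trans (subset_leq_card (_ : _ \subset
    [set p in hc_pairs | (p.1 \subset hull G) && (#|nbs p.1| == g)])) _.
    apply/subsetP => -[J K]; rewrite !inE /=.
    case/andP => /andP[-> /andP[-> _]] /eqP <- /=; rewrite andbT.
    exact: sub_hull.
  apply: leq_trans (card_hc_below _ _) _; rewrite leq_exp2l //.
  have : g <= #|X| by rewrite -Gg max_card.
  lia.
case: (leqP g (#|F c| + k3)) => [le|gt].
  rewrite (_ : T2 c = set0) ?cards0 //.
  by apply/setP => p; rewrite !inE ltnNge le !andbF.
case: (set_0Vmem (T2 c)) => [->|[p0 p0T]]; first by rewrite cards0.
have gX : g <= #|X|.
  by move: p0T; rewrite !inE => /andP[/andP[_ /andP[/eqP <- _]] _]; rewrite max_card.
apply: leq_trans (subset_leq_card (_ : _ \subset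
    [set p in hc_pairs | (p.1 \subset S c) && (#|nbs p.1| == g)])) _.
  apply/subsetP => p; rewrite !inE.
  by move=> /andP[/andP[-> /andP[-> _]] /andP[-> _]].
apply: leq_trans (card_hc_below _ _) _; rewrite leq_exp2l //.
(* The edges between [S c] and [F c] are counted twice; combined with [#|S c| <= 2 * g] this gives
   [#|S c| <= #|F c| + e]. *)
have dS : (k - phi) * #|S c| <= k * #|F c|.
  apply: leq_trans (_ : \sum_(v in S c) #|nb v :&: F c| <= _).
    rewrite mulnC -sum_nat_const; apply: leq_sum => v; rewrite inE => le.
    by have := card_nbD v (F c); lia.
  rewrite double_count mulnC -sum_nat_const; apply: leq_sum => v _.
  by rewrite -(card_nb v) subset_leq_card // subsetIl.
have S2 : #|S c| <= 2 * g by nia.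
have : k * #|S c| <= k * (#|F c| + e).
  by nia.
rewrite leq_pmul2l //; lia.
Qed.
End Container.

Import Order.TTheory GRing.Theory Num.Theory.
Local Open Scope ring_scope.

(** * Talagrand-type isoperimetry in the hypercube *)

(** Nested pairs instead of functions on ['I_d]: an induction on the dimension splits off a
    coordinate by computation. *)
Fixpoint box (C : finType) (d : nat) : finType :=
  if d is d'.+1 then (C * box C d')%type else unit.

Fixpoint box_adj (C : finType) (e : rel C) d : rel (box C d) :=
  match d with
  | 0 => fun _ _ => false
  | d'.+1 => fun x y => (e x.1 y.1 && (x.2 == y.2)) ||
                        ((x.1 == y.1) && @box_adj C e d' x.2 y.2)
  end.

Definition cube_adj n : rel (box bool n) := @box_adj bool (fun b c => b != c) n.

Lemma card_box (C : finType) d : #|{: box C d}| = (#|C| ^ d)%N.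
Proof.
elim: d => [|d IH] /=; first by rewrite card_unit.
by rewrite card_prod IH expnS.
Qed.

(** The boundary function of Talagrand's inequality: the number of coordinate flips that take [x] to
    a point outside [A]. *)
Fixpoint out n : pred (box bool n) -> box bool n -> nat :=
  match n with
  | 0 => fun _ _ => 0%N
  | n'.+1 => fun A x =>
      (~~ A (~~ x.1, x.2) + @out n' (fun y => A (x.1, y)) x.2)%N
  end.

Lemma out_le n (A : pred (box bool n)) x : (out A x <= n)%N.
Proof.
elim: n A x => [|n IH] A x //=.
by rewrite -add1n; apply: leq_add => //; case: (A _).
Qed.

Lemma out_gt0 n (A : pred (box bool n)) x :
  (0 < out A x)%N -> exists2 y, cube_adj x y & ~~ A y.
Proof.
elim: n A x => [|n IH] A // [b x] /=; rewrite addn_gt0 => /orP[].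
  rewrite lt0b => nA; exists (~~ b, x) => //=.
  by rewrite /cube_adj /= eqxx andbT; case: (b).
case/IH => y xy nAy; exists (b, y) => //=.
by move: xy; rewrite /cube_adj /= !eqxx.
Qed.

Section Iso.
Variable R : rcfType.

Lemma sum_box_cons (C : finType) d (A : pred (box C d.+1)) (F : box C d.+1 -> R) :
  \sum_(x | A x) F x = \sum_(c : C) \sum_(y : box C d | A (c, y)) F (c, y).
Proof. by rewrite pair_big_dep /=; apply: eq_big => [[c x]|[c x]] //. Qed.

(** For [v = 1], the difference of the squares of both sides is a square plus a nonnegative term, by
    the identity [key]. In the induction below, [D] is the relative difference in size of the two
    halves of the set. *)
Lemma sqrt_nat_add (D : R) (k : nat) (v : bool) : 0 <= D <= 1 ->
  (1 - D ^+ 2) * Num.sqrt k%:R + D * v%:R <= Num.sqrt (v + k)%:R.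
Proof.
move=> /andP[D0 D1].
have s0 : 0 <= Num.sqrt (k%:R : R) by apply: sqrtr_ge0.
have s2 : Num.sqrt (k%:R : R) ^+ 2 = k%:R by rewrite sqr_sqrtr ?ler0n.
have D21 : D ^+ 2 <= 1 by rewrite expr_le1.
have L0 : 0 <= (1 - D ^+ 2) * Num.sqrt k%:R + D * v%:R.
  by rewrite addr_ge0 // mulr_ge0 ?ler0n // subr_ge0.
rewrite -(ler_pXn2r (n := 2)) ?nnegrE ?sqrtr_ge0 // sqr_sqrtr ?ler0n // natrD.
rewrite -[X in _ <= _ + X]s2 {s2 L0}; set s := Num.sqrt _ in s0 *.
case: v => /=; last first.
  rewrite mulr0 addr0 add0r exprMn ler_piMl ?sqr_ge0 //.
  rewrite expr_le1 //; first by rewrite gerBl sqr_ge0.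
  by rewrite subr_ge0.
rewrite mulr1.
have key : 1 + s ^+ 2 - ((1 - D ^+ 2) * s + D) ^+ 2 =
  (1 - D ^+ 2 - D * s) ^+ 2 + D ^+ 2 * (1 - D ^+ 2) * (1 + s ^+ 2) by ring.
have r0 : 0 <= D ^+ 2 * (1 - D ^+ 2) * (1 + s ^+ 2).
  by rewrite !mulr_ge0 ?sqr_ge0 ?subr_ge0 // addr_ge0 ?sqr_ge0.
have r1 := sqr_ge0 (1 - D ^+ 2 - D * s).
rewrite -subr_ge0 key; lra.
Qed.

(** Induction on the dimension. In the larger half at least [a - a'] points have their partner
    outside [A], and [sqrt_nat_add] turns this into a gain of [(a - a') ^ 2 / (2 * 2 ^ n)], exactly
    what the identity [fin] asks for. In the smaller half the new direction is ignored. *)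
Lemma talagrand_boundary n (A : pred (box bool n)) :
  #|A|%:R * (2 ^+ n - #|A|%:R) / 2 ^+ n
    <= \sum_(x | A x) Num.sqrt (out A x)%:R :> R.
Proof.
elim: n A => [|n IH] A.
  have h : (#|A| <= 1)%N by rewrite -[1%N]card_unit max_card.
  rewrite expr0 divr1 [X in _ <= X]big1 => [|x _]; last by rewrite sqrtr0.
  by case: #|A| h => [|[|]] //; rewrite ?mul0r // subrr mulr0.
rewrite sum_box_cons big_bool /=.
pose B b : pred (box bool n) := fun y => A (b, y).
have cA : #|A| = (#|B true| + #|B false|)%N.
  rewrite -!sum1_card /=.
  rewrite (eq_bigl (fun x : box bool n.+1 => B x.1 x.2)); last by case.
  by rewrite -(pair_big_dep xpredT B (fun _ _ => 1%N)) /= big_bool.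
have half (b : bool) : (#|B (~~ b)| <= #|B b|)%N ->
  #|B b|%:R * (2 ^+ n - #|B b|%:R) / 2 ^+ n +
     (#|B b|%:R - #|B (~~ b)|%:R) ^+ 2 / 2 ^+ n / 2 <=
  \sum_(x | B b x) Num.sqrt (~~ B (~~ b) x + out (B b) x)%:R :> R.
  move=> le.
  set a := #|B b|%:R : R; set a' := #|B (~~ b)|%:R : R.
  set N := 2 ^+ n : R.
  have N0 : 0 < N by rewrite exprn_gt0 // ltr0n.
  have aN : a <= N.
    by rewrite /a /N -natrX ler_nat (leq_trans (max_card _)) // card_box card_bool.
  have a'a : a' <= a by rewrite ler_nat.
  have a'0 : 0 <= a' by rewrite ler0n.
  pose D := (a - a') / N.
  have DN : D * N = a - a' by rewrite /D mulfVK // gt_eqF.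
  have D0 : 0 <= D by rewrite divr_ge0 ?subr_ge0 // ltW.
  have D1 : D <= 1 by rewrite ler_pdivrMr // mul1r; lra.
  have D01 : 0 <= D <= 1 by rewrite D0.
  have D2 : D ^+ 2 <= 1 by rewrite expr_le1.
  apply: le_trans (ler_sum _ (fun x _ => sqrt_nat_add (out (B b) x) (~~ B (~~ b) x) D01)).
  rewrite big_split /= -!mulr_sumr.
  have cnt : a - a' <= \sum_(x | B b x) ((~~ B (~~ b) x)%:R : R).
    rewrite lerBlDr -natr_sum -natrD ler_nat.
    rewrite -big_mkcondr /= sum1_card.
    have := cardID (B (~~ b)) (B b) => <-.
    rewrite addnC leq_add //.
      by apply/eq_leq/eq_card => x; rewrite !inE /= /in_mem /= andbC.
    by apply: subset_leq_card; apply/subsetP => x; rewrite !inE => /andP[].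
  have IHb := IH (B b); rewrite -/a -/N in IHb.
  set S := \sum_(x | _) _ in IHb *; set T := \sum_(x | _) _ in cnt *.
  have J4 : a * (N - a) / N <= N / 2.
    rewrite ler_pdivrMr // -subr_ge0.
    have -> : N / 2 * N - a * (N - a) = (N ^+ 2) / 4 + (a - N / 2) ^+ 2 by field.
    by rewrite addr_ge0 ?sqr_ge0 // divr_ge0 ?sqr_ge0.
  apply: le_trans (_ : (1 - D ^+ 2) * (a * (N - a) / N) + D * (a - a') <= _).
    set J := a * (N - a) / N in J4 *.
    have -> : (a - a') ^+ 2 / N / 2 = D ^+ 2 * N / 2.
      by rewrite -DN; field; rewrite gt_eqF.
    rewrite -DN -subr_ge0.
    have -> : (1 - D ^+ 2) * J + D * (D * N) - (J + D ^+ 2 * N / 2) = D ^+ 2 * (N / 2 - J)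
      by field.
    by rewrite mulr_ge0 ?sqr_ge0 // subr_ge0.
  apply: lerD; first by rewrite ler_wpM2l // subr_ge0.
  by rewrite ler_wpM2l.
have rest (b : bool) :
  #|B b|%:R * (2 ^+ n - #|B b|%:R) / 2 ^+ n <=
  \sum_(x | B b x) Num.sqrt (~~ B (~~ b) x + out (B b) x)%:R :> R.
  apply: le_trans (IH _) _; apply: ler_sum => x _.
  by rewrite ler_wsqrtr // ler_nat leq_addl.
have fin (a a' : R) : (a + a') * (2 ^+ n.+1 - (a + a')) / 2 ^+ n.+1 =
  a * (2 ^+ n - a) / 2 ^+ n + (a - a') ^+ 2 / 2 ^+ n / 2 + a' * (2 ^+ n - a') / 2 ^+ n.
  by rewrite exprS; field; rewrite expf_neq0 // pnatr_eq0.
rewrite cA natrD.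
case/orP: (leq_total #|B false| #|B true|) => le.
  rewrite fin; apply: lerD; last exact: (rest false).
  exact: (half true).
rewrite [#|B true|%:R + _]addrC fin [X in _ <= X]addrC.
apply: lerD; last exact: (rest true).
exact: (half false).
Qed.

(* [talagrand_boundary] for the complement of [A], whose inner boundary is the outer
   boundary of [A]. *)
Lemma outer_boundary n (A : {set box bool n}) : (0 < n)%N ->
  #|A|%:R * (2 ^+ n - #|A|%:R) / 2 ^+ n <=
  Num.sqrt n%:R * #|[set y | [exists x in A, cube_adj y x] & y \notin A]|%:R :> R.
Proof.
move=> n0.
have := talagrand_boundary [pred x | x \notin A].
have -> : #|[pred x | x \notin A]|%:R = 2 ^+ n - #|A|%:R :> R.
  have := cardC (mem A); rewrite card_box card_bool => cc.
  apply: (addrI #|A|%:R); by rewrite [RHS]addrC subrK -natrX -cc natrD.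
rewrite subKr [(_ - _) * _]mulrC => /le_trans; apply.
set P := [set y | _].
rewrite -sum1_card natr_sum mulr_sumr.
rewrite [X in _ <= X](_ : _ = \sum_(x | x \notin A)
    (if x \in P then Num.sqrt n%:R else 0 : R)); last first.
  rewrite -big_mkcondr /=; apply: eq_big => [x|x _]; last by rewrite mulr1.
  by rewrite inE; case: (x \in A); rewrite ?andbF ?andbT.
apply: ler_sum => x; rewrite /= => xA.
case: ifPn => [_|]; first by rewrite ler_wsqrtr // ler_nat out_le.
rewrite inE xA andbT => nP.
case: (posnP (out [pred x | x \notin A] x)) => [->|/out_gt0 [y xy]].
  by rewrite sqrtr0.
rewrite /= negbK => yA; case/negP: nP; apply/existsP; exists y; exact/andP.
Qed.

End Iso.

Lemma poly_le_exp2 a b : exists n0, forall n, (n0 <= n)%N -> (a * n ^ b <= 2 ^ n)%N.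
Proof.
elim: b a => [|b IH] a.
  exists a => n an; rewrite expn0 muln1; apply: leq_trans an _.
  exact/ltnW/ltn_expl.
have [n0 H] := IH (a * 3 ^ b.+1)%N; exists (n0.*2 + 2)%N => n nn.
pose m := n./2.
have m0 : (n0 <= m)%N by rewrite /m; lia.
have n3 : (n <= 3 * m)%N by rewrite /m; lia.
have n2 : (m + m <= n)%N by rewrite /m; lia.
apply: leq_trans (_ : 2 ^ (m + m) <= _)%N; last by rewrite leq_exp2l.
apply: leq_trans (_ : a * (3 * m) ^ b.+1 <= _)%N.
  by rewrite leq_mul2l leq_exp2r // n3 orbT.
rewrite expnMn mulnA (expnSr m) mulnA expnD; apply: leq_mul; first exact: H.
exact/ltnW/ltn_expl.
Qed.

Lemma container_scale (D C : nat) : (0 < D)%N ->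
  exists n0, forall n, (n0 <= n)%N -> exists q,
  [/\ (0 < q)%N, (n ^ 12 <= 2 ^ q)%N, ((D * q ^ 3) ^ 2 * C <= n)%N &
      (64 * q * (q ^ 2 + q + 2) * n ^ 8 <= 2 ^ n)%N].
Proof.
move=> D0.
have [l0 Hl] := poly_le_exp2 ((D * 24 ^ 3) ^ 2 * C.+1)%N 6.
have [n1 Hn] := poly_le_exp2 256 9.
exists (2 ^ l0.+1 + n1 + 2)%N => n nn.
pose l := trunc_log 2 n; pose q := (12 * l.+1)%N; exists q.
have n0 : (0 < n)%N by lia.
have ll : (l0 < l)%N.
  by rewrite /l -(trunc_expnK l0.+1 (isT : 1 < 2)%N) leq_trunc_log //; lia.
have ln : (2 ^ l <= n)%N by apply: trunc_logP.
have nl : (n < 2 ^ l.+1)%N by apply: trunc_log_ltn.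
have q0 : (0 < q)%N by [].
have q24 : (q <= 24 * l)%N by rewrite /q; lia.
have q3 : (q ^ 3 <= 24 ^ 3 * l ^ 3)%N by rewrite -expnMn leq_exp2r.
have h3 : ((D * q ^ 3) ^ 2 * (C.+1) <= (D * 24 ^ 3) ^ 2 * C.+1 * l ^ 6)%N.
  rewrite mulnAC leq_mul2r; apply/orP; right.
  by rewrite (expnM l 3 2) -expnMn leq_exp2r // -mulnA leq_mul2l q3 orbT.
have h4 : ((D * q ^ 3) ^ 2 * C.+1 <= n)%N.
  by apply: leq_trans h3 _; apply: leq_trans ln; apply: Hl; exact: ltnW.
have qn : (q ^ 3 <= n)%N.
  apply: leq_trans h4; apply: leq_trans (leq_pmulr _ _) => //.
  rewrite -mulnn; apply: leq_trans (leq_pmull _ D0) _.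
  by rewrite leq_pmulr // muln_gt0 D0 expn_gt0 q0.
split => //.
- apply: leq_trans (_ : (2 ^ l.+1) ^ 12 <= _)%N; last by rewrite -expnM mulnC.
  by rewrite leq_exp2r // ltnW.
- by apply: leq_trans h4; rewrite leq_mul2l leqnSn orbT.
- apply: leq_trans (Hn n _); last by move: (2 ^ l0.+1)%N nn => a; clear; lia.
  rewrite (expnS n 8) mulnA leq_mul2r; apply/orP; right.
  apply: leq_trans (_ : 256 * q ^ 3 <= _)%N; last by rewrite leq_mul2l qn orbT.
  by move: q0; clear; nia.
Qed.

(** With closed neighbourhoods, the bipartite double of the cube [Q_n] is [Q_(n+1)]; hence
    [hc_pairs] for this relation encodes the independent sets of [Q_(n+1)]. *)
Definition cube_cl n : rel (box bool n) := fun x y => (x == y) || cube_adj x y.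

Lemma box_adj_sym (C : finType) (e : rel C) d : symmetric e -> symmetric (@box_adj C e d).
Proof.
move=> es; elim: d => [|d IH] // x y /=; rewrite es (eq_sym x.2) (eq_sym x.1).
by congr (_ || _ && _); apply: IH.
Qed.

Lemma cube_adj_sym n : symmetric (@cube_adj n).
Proof. by apply: box_adj_sym => b c; rewrite eq_sym. Qed.

Lemma cube_cl_sym n : symmetric (@cube_cl n).
Proof. by move=> x y; rewrite /cube_cl eq_sym cube_adj_sym. Qed.

Lemma cube_adj_irr n (x : box bool n) : cube_adj x x = false.
Proof.
rewrite /cube_adj; elim: n x => [|n IH] // x; rewrite /= !eqxx /=.
exact: IH.
Qed.

Lemma card_cube_adj n (x : box bool n) : #|[set y | cube_adj x y]| = n.
Proof.
elim: n x => [|n IH] [] // => [|b x].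
  by apply/eqP; rewrite cards_eq0; apply/eqP/setP => y; rewrite !inE.
have -> : [set y | @cube_adj n.+1 (b, x) y] =
    (~~ b, x) |: [set ((b, y) : box bool n.+1) | y in [set y | cube_adj x y]].
  apply/setP => -[c y]; rewrite !inE /cube_adj /= xpair_eqE; congr (_ || _).
    by rewrite [x == y]eq_sym; case: b c => [] [].
  apply/andP/imsetP => [[/eqP <- xy]|[z]]; first by exists y; rewrite ?inE.
  by rewrite inE => xz [-> ->].
rewrite cardsU1 card_imset; last by move=> y z [].
rewrite IH; case: imsetP => [[z _ []]|_]; last by rewrite add1n.
by case: (b).
Qed.

Lemma card_cube_cl n (x : box bool n) : #|[set y | cube_cl x y]| = n.+1.
Proof.
have -> : [set y | cube_cl x y] = x |: [set y | cube_adj x y].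
  by apply/setP => y; rewrite !inE eq_sym.
by rewrite cardsU1 inE cube_adj_irr card_cube_adj.
Qed.

Lemma sub_nbs_cube n (A : {set box bool n}) : A \subset nbs (@cube_cl n) A.
Proof.
by apply/subsetP => x xA; apply: mem_nbs xA _; rewrite /cube_cl eqxx.
Qed.

(** Here [t] is the size of the vertex boundary of [A]; [outer_boundary] is squared so that the
    statement lives in [nat]. *)
Lemma cube_isoperimetry (R : rcfType) n (A : {set box bool n}) t :
  #|nbs (@cube_cl n) A| = (#|A| + t)%N ->
  ((#|A| * (2 ^ n - #|A|)) ^ 2 <= n * t ^ 2 * (2 ^ n) ^ 2)%N.
Proof.
have AM : (#|A| <= 2 ^ n)%N by rewrite -card_bool -card_box max_card.
case: n A AM => [|n] A AM At.
  by move: AM; case: #|A| => [|[|]].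
have bd : #|[set y | [exists x in A, cube_adj y x] & y \notin A]| = t.
  apply: (@addnI #|A|); rewrite -At.
  rewrite -(cardsID A (nbs _ A)) (setIidPr (sub_nbs_cube A)); congr (_ + _)%N.
  apply: eq_card => y; rewrite !inE andbC; case yA: (y \in A) => //=.
  apply: eq_existsb => x; rewrite /cube_cl cube_adj_sym.
  by case: eqVneq => // ->; rewrite yA.
have := @outer_boundary R _ A (ltn0Sn n); rewrite bd.
rewrite ler_pdivrMr ?exprn_gt0 // -natrX -natrB // -natrM => le.
rewrite -(ler_nat R) natrX.
apply: le_trans (_ : (Num.sqrt n.+1%:R * t%:R * (2 ^ n.+1)%:R) ^+ 2 <= _).
  by rewrite lerXn2r // nnegrE ?ler0n // !mulr_ge0 ?sqrtr_ge0 ?ler0n.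
by rewrite !exprMn sqr_sqrtr ?ler0n // !natrM !natrX.
Qed.

(** * Counting independent sets of the hypercube *)

Section Counting.
Variable R : realType.
Local Notation ln2 := (ln 2%:R : R).

Lemma ln2_gt0 : 0 < ln2.
Proof. by rewrite ln_gt0 // ltr1n. Qed.

Lemma ln2_ge : 1 / 2 <= ln2.
Proof.
rewrite -[X in X <= _](expRK) ler_ln ?posrE ?expR_gt0 ?ltr0n //.
have e1 : expR (- (1 / 2)) >= 1 / 2 :> R.
  by apply: le_trans (expR_ge1Dx _); lra.
have e2 : expR (1 / 2) * expR (- (1 / 2)) = 1 :> R.
  by rewrite -expRD subrr expR0.
have := expR_gt0 (1 / 2 : R); nra.
Qed.

Lemma exp2E n : (2 ^ n)%:R = expR (ln2 * n%:R) :> R.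
Proof. by rewrite natrX mulrC expRM_natl lnK // posrE ltr0n. Qed.

Lemma sum_sets_expr (X : finType) (y : R) :
  \sum_(S : {set X}) y ^+ #|S| = (1 + y) ^+ #|X|.
Proof.
rewrite -prodr_const.
have := bigA_distr 1 +%R (fun _ : X => y) (fun _ => 1).
rewrite (eq_bigr (fun=> 1 + y)) => [->|i _]; last by rewrite addrC.
apply: eq_bigr => S _; rewrite -prodr_const big_mkcond /=.
by apply: eq_bigr => i _.
Qed.

(** Each set is weighted by the power of [1 / 2 ^ q] given by its size and compared with the full
    generating function [(1 + 1 / 2 ^ q) ^ #|X|]: an element costs [q] bits, up to the additive
    [#|X| / 2 ^ q]. *)
Lemma card_small (X : finType) q j :
  #|small X j|%:R <= expR (ln2 * (q * j)%:R + #|X|%:R / 2 ^+ q) :> R.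
Proof.
rewrite expRD -exp2E.
apply: (@le_trans _ _ ((2 ^ (q * j))%:R * (1 + (2 ^+ q)^-1) ^+ #|X|)); last first.
  rewrite ler_wpM2l ?ler0n // expRM_natl lerXn2r ?nnegrE ?expR_ge0 ?addr_ge0 ?invr_ge0 ?exprn_ge0 //.
  exact: expR_ge1Dx.
rewrite -sum_sets_expr mulr_sumr.
apply: (@le_trans _ _ (\sum_(S in small X j) 1)).
  by rewrite sumr_const.
rewrite big_mkcond /=; apply: ler_sum => S _.
have y0 : 0 < (2 ^+ q)^-1 :> R by rewrite invr_gt0 exprn_gt0.
case: ifP => [|_]; last by rewrite mulr_ge0 ?ler0n // exprn_ge0 // ltW.
rewrite inE => Sj; rewrite natrX exprM exprVn.
rewrite ler_pdivlMr ?mul1r; last by rewrite !exprn_gt0.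
by apply: ler_weXn2l => //; rewrite exprn_ege1 // ler1n.
Qed.


(** * Choice of the container parameters *)

Section TypeBound.
Variables (X : finType) (rho : rel X) (k : nat).
Hypothesis rho_sym : symmetric rho.
Hypothesis rho_reg : forall x, #|[set y | rho x y]| = k.
Local Notation M := #|X|.

(** Costs in bits are measured in units of [tau = t / q]. Isoperimetry, in the form
    [D * q ^ 3 * g <= n * t], makes the cost of [Y1] and the slack [e] small; a large [phi] makes
    the cost of [Y2] small. Finally [k3], about [t / (8 * q)], costs at most [t / 8] bits in the
    first alternative, where [t] bits are gained, and still gains [tau / 8] in the second. *)
Lemma hc_type_bound (C D n q g t : nat) : (128 * 1024 <= D)%N ->
  k = n.+1 -> (0 < t)%N -> (0 < C)%N -> (0 < q)%N -> (n ^ 12 <= 2 ^ q)%N ->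
  ((D * q ^ 3) ^ 2 * C <= n)%N ->
  (64 * q * (q ^ 2 + q + 2) * n ^ 8 <= M)%N ->
  (g ^ 2 <= C * n * t ^ 2)%N -> (M <= n ^ 7 * g)%N ->
  #|hc_type rho g t|%:R <= expR (ln2 * (M%:R - t%:R / (16 * q%:R))) :> R.
Proof.
move=> HD kn t0 C0 q0 nq qC qM gt Mg.
have D0 : (0 < D)%N by move: HD; clear; lia.
have n0 : (0 < n)%N.
  by apply: (leq_trans _ qC); rewrite muln_gt0 C0 andbT expn_gt0 muln_gt0 D0 expn_gt0 q0.
have gD : (D * q ^ 3 * g <= n * t)%N.
  move: qC; set w := (D * q ^ 3)%N => qC.
  rewrite -leq_sqr (expnMn w) (expnMn n).
  have h : (w ^ 2 * g ^ 2 <= w ^ 2 * C * (n * t ^ 2))%N.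
    by rewrite -[X in (_ <= X)%N]mulnA leq_mul2l mulnA gt orbT.
  by apply: leq_trans h _; rewrite mulnA (expnS n) expn1 leq_mul2r leq_mul2r qC !orbT.
(* With [h] about [k / 2], about [2 * g / k] greedy steps halve the uncovered part, and [q] halvings
   suffice since [g <= n * t] and [n <= 2 ^ q]. *)
pose s := ((2 * g) %/ k).+1; pose phi := (1024 * q ^ 2)%N.
pose k2 := ((3 * t) %/ phi.+1).+1; pose e := ((2 * phi * g) %/ k).+1.
pose k3 := (t %/ (8 * q))%N.
have k0 : (0 < k)%N by rewrite kn.
have Dq3 : (0 < D * q ^ 3)%N by rewrite muln_gt0 D0 expn_gt0 q0.
have nD3 : (D * q ^ 3 <= n)%N.
  apply: leq_trans qC; apply: leq_trans (leq_pmulr _ C0).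
  by rewrite -mulnn leq_pmulr.
have nD2 : (D * q ^ 2 <= n)%N.
  by apply: leq_trans nD3; rewrite leq_mul2l leq_pexp2l ?orbT.
have nD : (D * q <= n)%N.
  by apply: leq_trans nD3; rewrite leq_mul2l -{1}[q]expn1 leq_pexp2l ?orbT.
have gn : (g <= n * t)%N by apply: leq_trans gD; rewrite leq_pmull.
have sk : (s.-1 * k <= 2 * g)%N by rewrite leq_divM.
have sk' : (2 * g < s * k)%N by rewrite ltn_ceil.
have k2p : (k2.-1 * phi.+1 <= 3 * t)%N by rewrite leq_divM.
have k2p' : (3 * t < k2 * phi.+1)%N by rewrite ltn_ceil.
have ek : (e.-1 * k <= 2 * phi * g)%N by rewrite leq_divM.
have ek' : (2 * phi * g < e * k)%N by rewrite ltn_ceil.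
have k3q : (k3 * (8 * q) <= t)%N by rewrite leq_divM.
have k3q' : (t < k3.+1 * (8 * q))%N by rewrite ltn_ceil // muln_gt0 q0.
have n2q : (n <= 2 ^ q)%N.
  by apply: leq_trans nq; rewrite -{1}[n]expn1 leq_pexp2l.
case: (set_0Vmem (hc_type rho g t)) => [->|[p pT]].
  by rewrite cards0 expR_ge0.
have tM : (t <= M)%N.
  move: pT; rewrite inE => /and3P[_ /eqP gp /eqP gh].
  by apply: leq_trans (max_card (nbs rho p.1)); rewrite gp -gh leq_addl.
have C1 : (#|hc_type rho g t| <= #|small X (q * s)| * #|small X k2| *
    (#|small X k3| * 2 ^ (M - t) + 2 ^ (M + e - k3.+1)))%N.
  apply: (@container X rho k rho_sym rho_reg k0 g t (uphalf k) s q phi (q * s) k2 k3 e) => //.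
  - by rewrite uphalf_gt0.
  - by clear; lia.
  - by clear; lia.
  - have : (k <= 2 * (k - uphalf k).+1)%N by clear; lia.
    by move: sk'; clear; nia.
  - by apply: leq_trans gn _; rewrite leq_mul2r n2q orbT.
  - exact: ltnW.
  - rewrite kn /phi mulnA; apply: leq_trans (leqnSn _).
    apply: leq_trans nD2; rewrite leq_mul2r; apply/orP; right; move: HD; clear; lia.
  - exact: ltnW.
have k3M : (k3.+1 <= M + e)%N.
  have : (k3 <= t)%N by apply: leq_trans k3q; rewrite leq_pmulr // muln_gt0.
  have : (0 < e)%N by [].
  by move: tM; clearbody k3 e; clear; lia.
have rq0 : 0 < q%:R :> R by rewrite ltr0n.
have rD0 : 0 < D%:R :> R by rewrite ltr0n.
have rn0 : 0 < n%:R :> R by rewrite ltr0n.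
pose tau := t%:R / q%:R : R.
have tauE : t%:R = tau * q%:R by rewrite /tau mulfVK // gt_eqF.
have tau0 : 0 < tau by rewrite divr_gt0 // ltr0n.
have HDr : 128 * 1024 <= D%:R :> R by rewrite -natrM ler_nat.
have cancel_q (x y : R) : x * q%:R <= y * q%:R -> x <= y by rewrite ler_pM2r.
have a1 : (q * (q * s.-1))%:R <= tau / (64 * 1024).
  have h : (D * q ^ 3 * s.-1 <= 2 * t)%N.
    rewrite -(leq_pmul2r n0); apply: (@leq_trans (D * q ^ 3 * (2 * g))).
      by rewrite -mulnA leq_mul2l; apply/orP; right; move: sk; rewrite kn; clear; nia.
    by move: gD; clear; nia.
  have : (q * (q * s.-1))%:R * D%:R <= 2 * tau.
    apply: cancel_q; rewrite -[2 * tau * _]mulrA -tauE -!natrM ler_nat.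
    by apply: leq_trans h; rewrite leq_eqVlt; apply/orP; left; apply/eqP; ring.
  by have := ler0n R (q * (q * s.-1)); move: HDr tau0; clear -R X rho k rho_sym rho_reg; nra.
have a2 : (q * k2.-1)%:R <= tau * 3 / 1024.
  have : (q * k2.-1)%:R * 1024 <= 3 * tau.
    apply: cancel_q; rewrite -[3 * tau * _]mulrA -tauE -!natrM ler_nat.
    by apply: leq_trans k2p; rewrite /phi; clear; nia.
  by clear -R X rho k rho_sym rho_reg; lra.
have a3 : e.-1%:R <= tau / 64.
  have h : (D * q * e.-1 <= 2048 * t)%N.
    rewrite -(leq_pmul2r n0); apply: (@leq_trans (2048 * (D * q ^ 3 * g))).
      have : (e.-1 * n <= 2048 * (q ^ 2 * g))%N.
        by apply: (@leq_trans (e.-1 * k)); [rewrite kn; clear; nia|move: ek; rewrite /phi; clear; lia].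
      move=> h; apply: (@leq_trans (D * q * (2048 * (q ^ 2 * g)))).
        by rewrite -mulnA leq_mul2l h orbT.
      by rewrite leq_eqVlt; apply/orP; left; apply/eqP; ring.
    by move: gD; clear; nia.
  have : e.-1%:R * D%:R <= 2048 * tau.
    apply: cancel_q; rewrite -[2048 * tau * _]mulrA -tauE -!natrM ler_nat.
    by apply: leq_trans h; rewrite leq_eqVlt; apply/orP; left; apply/eqP; ring.
  by have := ler0n R e.-1; move: HDr tau0; clear -R X rho k rho_sym rho_reg; nra.
have a4 : (q * k3)%:R <= t%:R / 8 :> R.
  have : (q * k3)%:R * 8 <= t%:R :> R.
    by rewrite -natrM ler_nat; apply: leq_trans k3q; clear; lia.
  by clear -R X rho k rho_sym rho_reg; lra.
have a5 : tau / 8 <= k3.+1%:R.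
  have : tau <= k3.+1%:R * 8.
    apply: cancel_q; rewrite -tauE -!natrM ler_nat.
    by apply: ltnW; apply: leq_trans k3q' _; clear; lia.
  by clear -R X rho k rho_sym rho_reg; lra.
have Mt : (M <= n ^ 8 * t)%N.
  by apply: leq_trans Mg _; rewrite (expnSr n 7) -mulnA leq_mul2l gn orbT.
have a6 : M%:R / 2 ^+ q <= tau / 384.
  have h : (384 * q * M <= t * 2 ^ q)%N.
    apply: (@leq_trans (n * (n ^ 8 * t))).
      by apply: leq_mul => //; apply: leq_trans nD; rewrite leq_mul2r; apply/orP; right; move: HD; clear; lia.
    rewrite mulnA -expnS mulnC leq_mul2l; apply/orP; right.
    by apply: leq_trans nq; rewrite leq_pexp2l.
  rewrite ler_pdivrMr ?exprn_gt0 //.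
  apply: cancel_q; rewrite [leRHS]mulrAC [_ / 384 * _]mulrAC -tauE.
  rewrite mulrAC ler_pdivlMr ?ltr0n // -natrX -!natrM ler_nat.
  by apply: leq_trans h; rewrite leq_eqVlt; apply/orP; left; apply/eqP; ring.
have a7 : q%:R ^+ 2 + q%:R + 2 <= tau / 64.
  have : (q%:R ^+ 2 + q%:R + 2) * 64 <= tau.
    apply: cancel_q; rewrite -tauE -natrX -!natrD -!natrM ler_nat.
    have n8 : (0 < n ^ 8)%N by rewrite expn_gt0 n0.
    rewrite -(leq_pmul2l n8); apply: leq_trans Mt; apply: leq_trans qM.
    by rewrite leq_eqVlt; apply/orP; left; apply/eqP; ring.
  by clear -R X rho k rho_sym rho_reg; lra.
pose y := M%:R / 2 ^+ q / ln2.
have l0 := ln2_gt0; have l1 := ln2_ge.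
have yE : M%:R / 2 ^+ q = ln2 * y by rewrite /y mulrCA mulfV ?mulr1 // gt_eqF.
have y1 : y <= tau / 192.
  rewrite ler_pdivrMr //; apply: le_trans a6 _.
  by move: l1 tau0; clear -R X rho k rho_sym rho_reg; nra.
have B1 := card_small X q (q * s); have B2 := card_small X q k2.
have B3 := card_small X q k3.
rewrite yE -mulrDr in B1; rewrite yE -mulrDr in B2; rewrite yE -mulrDr in B3.
have -> : t%:R / (16 * q%:R) = tau / 16 by rewrite /tau invfM mulrA mulrAC.
set E := _ * (M%:R - tau / 16).
(* One half of the bound for each alternative of [container]. *)
have -> : expR E = expR (E - ln2) + expR (E - ln2).
  by rewrite expRD expRN lnK ?posrE ?ltr0n // -splitr.
move: C1; rewrite -(ler_nat R) => /le_trans; apply.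
rewrite natrM natrD mulrDr !natrM.
have BB : #|small X (q * s)|%:R * #|small X k2|%:R <=
    expR (ln2 * (tau / 128 + (q ^ 2 + q)%:R + 2 * y)) :> R.
  apply: le_trans (ler_pM _ _ B1 B2) _; rewrite ?ler0n // -expRD ler_expR. rewrite -mulrDr ler_pM2l //.
  have -> : (q * (q * s) = q * (q * s.-1) + q ^ 2)%N by rewrite /s /=; clear; lia.
  have -> : (q * k2 = q * k2.-1 + q)%N by rewrite /k2 /= mulnSr.
  rewrite !natrD; move: a1 a2 tau0; clear -R X rho k rho_sym rho_reg; lra.
have x0 : 0 <= #|small X (q * s)|%:R * #|small X k2|%:R :> R by rewrite mulr_ge0 ?ler0n.
apply: lerD.
- apply: le_trans (ler_pM x0 _ BB (ler_pM _ _ B3 (lexx _))) _; rewrite ?mulr_ge0 ?ler0n //.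
  rewrite exp2E -!expRD ler_expR -!mulrDr /E -[X in _ - X]mulr1 -mulrBr ler_pM2l //.
  rewrite natrB // natrD natrX.
  have q1 : tau <= t%:R by rewrite ler_pdivrMr // ler_peMr ?ler0n // ler1n.
  by move: a4 a7 y1 q1 tau0; clear -R X rho k rho_sym rho_reg; lra.
- apply: le_trans (ler_pM x0 _ BB (lexx _)) _; rewrite ?ler0n //.
  rewrite exp2E -!expRD ler_expR -!mulrDr /E -[X in _ - X]mulr1 -mulrBr ler_pM2l //.
  rewrite natrB // !natrD natrX.
  have eE : e%:R = e.-1%:R + 1 :> R by rewrite -natr1.
  by rewrite eE; move: a3 a5 a7 y1 tau0; clear -R X rho k rho_sym rho_reg; lra.
Qed.
End TypeBound.
End Counting.

(** * Chernoff bounds and the two counts for the cube *)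

Section CubeCount.
Variable R : realType.
Local Notation ln2 := (ln 2%:R : R).

Lemma card_sets_le (X : finType) (x s : R) : 0 <= s ->
  #|[set S : {set X} | #|S|%:R <= x]|%:R <= expR (s * x) * (1 + expR (- s)) ^+ #|X|.
Proof.
move=> s0; rewrite -sum_sets_expr mulr_sumr.
apply: (@le_trans _ _ (\sum_(S in [set S : {set X} | #|S|%:R <= x]) 1)).
  by rewrite sumr_const.
rewrite big_mkcond /=; apply: ler_sum => S _.
case: ifP => [|_]; last by rewrite mulr_ge0 ?expR_ge0 // exprn_ge0 ?expR_ge0.
rewrite inE => Sx; rewrite -expRM_natl -expRD -[leLHS]expR0 ler_expR.
have : 0 <= s * (x - #|S|%:R) by rewrite mulr_ge0 // subr_ge0.
lra.
Qed.

(** Chernoff's bound with exponential parameter [e]; the estimate [cosh (e / 2) <= exp (e ^ 2 / 2)]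
    that it rests on is derived from [1 + x <= exp x] alone. *)
Lemma card_sets_below_half (X : finType) (x e : R) : 0 <= e <= 1 ->
  x <= (1 / 2 - e) * #|X|%:R ->
  #|[set S : {set X} | #|S|%:R <= x]|%:R
    <= expR (ln2 * #|X|%:R - e ^+ 2 / 2 * #|X|%:R).
Proof.
move=> /andP[e0 e1] xe.
apply: le_trans (card_sets_le X x e0) _.
set M := #|X|.
have M0 : 0 <= M%:R :> R by rewrite ler0n.
apply: le_trans (_ : expR (e * ((1 / 2 - e) * M%:R)) * (1 + expR (- e)) ^+ M <= _).
  rewrite ler_wpM2r ?exprn_ge0 ?addr_ge0 ?expR_ge0 // ler_expR.
  by rewrite ler_wpM2l.
have -> : expR (e * ((1 / 2 - e) * M%:R)) = expR (- e ^+ 2 * M%:R) * expR (e / 2) ^+ M.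
  by rewrite -expRM_natl -expRD; congr expR; field.
rewrite -mulrA -exprMn.
have h : expR (e / 2) * (1 + expR (- e)) <= 2 * expR (e ^+ 2 / 2).
  have -> : expR (e / 2) * (1 + expR (- e)) = expR (e / 2) + expR (- (e / 2)).
    by rewrite mulrDr mulr1 -expRD; congr (_ + expR _); field.
  set u := e / 2.
  have u0 : 0 <= u <= 1 / 2 by apply/andP; split; rewrite /u; lra.
  have p1 := expR_ge1Dx (- u); have p2 := expR_ge1Dx u.
  have p3 : expR u * expR (- u) = 1 by rewrite -expRD subrr expR0.
  have p4 := expR_gt0 u; have p5 := expR_gt0 (- u).
  have p6 := expR_ge1Dx (e ^+ 2 / 2).
  have eu : e = 2 * u by rewrite /u; field.
  have q1 : expR u <= 1 + u + 2 * u ^+ 2.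
    have : expR u * (1 - u) <= 1 by rewrite -[leRHS]p3 ler_wpM2l // ltW.
    case/andP: u0 => ua ub ?; nra.
  have q2 : expR (- u) <= 1 - u + u ^+ 2.
    have : expR (- u) * (1 + u) <= 1 by rewrite -[leRHS]p3 mulrC ler_wpM2r // ltW.
    case/andP: u0 => ua ub ?; nra.
  apply: le_trans (_ : 2 * (1 + e ^+ 2 / 2) <= _); last by rewrite ler_wpM2l.
  rewrite eu; have := sqr_ge0 u; nra.
apply: le_trans (_ : expR (- e ^+ 2 * M%:R) * (2 * expR (e ^+ 2 / 2)) ^+ M <= _).
  rewrite ler_wpM2l ?expR_ge0 // lerXn2r ?nnegrE ?mulr_ge0 ?addr_ge0 ?expR_ge0 //.
rewrite exprMn -natrX exp2E -expRM_natl -!expRD ler_expR.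
by rewrite le_eqVlt; apply/orP; left; apply/eqP; field.
Qed.


Local Notation rho n := (@cube_cl n).
Local Notation gof n p := #|nbs (@cube_cl n) p.1|.
Local Notation tof n p := (#|nbs (@cube_cl n) p.1| - #|hull (@cube_cl n) (nbs (@cube_cl n) p.1)|)%N.

Lemma card_cube n : #|box bool n| = (2 ^ n)%N.
Proof. by rewrite card_box card_bool. Qed.

Lemma hull_le_cube n (G : {set box bool n}) : (#|hull (rho n) G| <= #|G|)%N.
Proof. by apply: (card_hull_le (k := n.+1)); [exact: cube_cl_sym|exact: card_cube_cl|]. Qed.

Lemma card_types_le n (T : {set {set box bool n} * {set box bool n}}) (b : R) : 0 <= b ->
  (forall p, p \in T -> p \in hc_pairs (rho n) /\
     #|hc_type (rho n) (gof n p) (tof n p)|%:R <= b) ->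
  #|T|%:R <= ((2 ^ n).+1 ^ 2)%:R * b.
Proof.
move=> b0 HT; pose I := ('I_(2 ^ n).+1 * 'I_(2 ^ n).+1)%type.
pose F (i : I) : {set _ * _} :=
  if #|hc_type (rho n) i.1 i.2|%:R <= b then hc_type (rho n) i.1 i.2 else set0.
have le : (#|T| <= \sum_(i : I) #|F i|)%N.
  apply: card_le_cover => p /HT [ph hb].
  have lg : (gof n p < (2 ^ n).+1)%N by rewrite ltnS -card_cube max_card.
  have lt : (tof n p < (2 ^ n).+1)%N by apply: leq_ltn_trans lg; rewrite leq_subr.
  exists (Ordinal lg, Ordinal lt) => //.
  rewrite /F /= hb inE ph eqxx /= subnKC ?eqxx //.
  exact: hull_le_cube.
apply: le_trans (_ : (\sum_(i : I) #|F i|)%:R <= _); first by rewrite ler_nat.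
rewrite natr_sum; apply: le_trans (_ : \sum_(i : I) b <= _).
  by apply: ler_sum => i _; rewrite /F; case: ifP => // _; rewrite cards0.
by rewrite sumr_const card_prod card_ord -mulnn mulr_natl.
Qed.

Lemma hc_pairs_swap n J K :
  ((J, K) \in hc_pairs (rho n)) = ((K, J) \in hc_pairs (rho n)).
Proof.
suff imp J' K' : (J', K') \in hc_pairs (rho n) -> (K', J') \in hc_pairs (rho n).
  by apply/idP/idP; apply: imp.
rewrite !inE /= => /pred0P dis; apply/pred0P => x /=; apply/negbTE/negP.
case/andP => xJ /nbsP [y yK yx].
have /negbT/negP := dis y; apply; rewrite /= yK /=.
by apply: mem_nbs xJ _; rewrite cube_cl_sym.
Qed.

Lemma hull_sub_nbs n (J : {set box bool n}) :
  hull (rho n) (nbs (rho n) J) \subset nbs (rho n) J.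
Proof. by have := sub_nbs_cube (hull (rho n) (nbs (rho n) J)); rewrite nbs_hull_nbs. Qed.

Lemma hull_disjoint n J K : (J, K) \in hc_pairs (rho n) ->
  [disjoint K & hull (rho n) (nbs (rho n) J)].
Proof.
rewrite inE /= => dis; rewrite disjoint_sym; apply: disjointWl (hull_sub_nbs J) _.
by rewrite disjoint_sym.
Qed.

(** Consequently one of the two closures has at most half of the vertices, the range where
    isoperimetry is effective. *)
Lemma hulls_disjoint n J K : (J, K) \in hc_pairs (rho n) ->
  [disjoint hull (rho n) (nbs (rho n) J) & hull (rho n) (nbs (rho n) K)].
Proof.
move=> JK; apply: disjointWl (hull_sub_nbs J) _.
apply/pred0P => x /=; apply/negbTE/negP => /andP[/nbsP [y yJ yx]].
rewrite inE => /subsetP sx.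
have : y \in nbs (rho n) K by apply: sx; rewrite inE cube_cl_sym.
case/nbsP => z zK zy; move: JK; rewrite inE => /pred0P /(_ z) /=.
by rewrite zK /= (mem_nbs yJ) // cube_cl_sym.
Qed.

Lemma expR_double (x y : R) : x + ln2 <= y -> expR x + expR x <= expR y.
Proof.
move=> xy; apply: le_trans (_ : expR (x + ln2) <= _); last by rewrite ler_expR.
by rewrite expRD lnK ?posrE ?ltr0n // -[X in X + X]mulr1 -mulrDr.
Qed.

Lemma cube_squares_le n (x y : R) : x + ln2 * (2 * n + 2)%:R <= y ->
  ((2 ^ n).+1 ^ 2)%:R * expR x <= expR y.
Proof.
move=> xy; apply: le_trans (_ : expR (ln2 * (2 * n + 2)%:R) * expR x <= _).
  rewrite ler_wpM2r ?expR_ge0 // -exp2E ler_nat.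
  rewrite (_ : 2 * n + 2 = n.+1 * 2)%N; last by lia.
  rewrite expnM leq_exp2r // expnS mul2n -addnn -addn1 leq_add2l.
  by rewrite expn_gt0.
by rewrite -expRD ler_expR addrC.
Qed.

(** The first bound says that expanding types cost nothing extra. In the second, the assumption
    makes [t] at least a large multiple of [q ^ 3 * 2 ^ n / n], and the powers of [q] absorb the
    denominator [16 * q] of [hc_type_bound]. *)
Lemma cube_type_bound (C : nat) : (0 < C)%N -> exists n0, forall n, (n0 <= n)%N ->
  forall g t, (0 < t)%N -> (g ^ 2 <= C * n * t ^ 2)%N -> (2 ^ n <= n ^ 7 * g)%N ->
  #|hc_type (rho n) g t|%:R <= expR (ln2 * (2 ^ n)%:R) /\
  (((2 ^ n) ^ 2 <= C * n * t ^ 2)%N ->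
     #|hc_type (rho n) g t|%:R <= expR (ln2 * ((2 ^ n)%:R * (1 - 2 / n%:R)))).
Proof.
move=> C0; have D0 : (0 < 128 * 1024)%N by [].
have [n0 H] := container_scale C D0.
exists n0 => n nn g t t0 gt Mg.
have [q [q0 nq qC qM]] := H n nn.
have := @hc_type_bound R _ (rho n) n.+1 (@cube_cl_sym n) (@card_cube_cl n) C _ n q g t
  (leqnn _) erefl t0 C0 q0 nq qC.
rewrite card_cube => /(_ qM gt Mg) bd.
split; first by apply: le_trans bd _; rewrite ler_expR ler_pM2l ?ln2_gt0 // gerBl divr_ge0 ?mulr_ge0 ?ler0n.
move=> Mleg; apply: le_trans bd _; rewrite ler_expR ler_pM2l ?ln2_gt0 //.
have n0' : (0 < n)%N by apply: leq_trans qC; rewrite muln_gt0 C0 andbT expn_gt0 muln_gt0 D0 expn_gt0 q0.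
rewrite mulrBr mulr1 lerD2l lerN2 mulrA ler_pdivrMr ?ltr0n // mulrAC.
rewrite ler_pdivlMr; last by rewrite mulr_gt0 ?ltr0n.
rewrite -!natrM ler_nat.
have gD : (128 * 1024 * q ^ 3 * 2 ^ n <= n * t)%N.
  move: qC; set w := (128 * 1024 * q ^ 3)%N => qC.
  rewrite -leq_sqr (expnMn w) (expnMn n).
  have h : (w ^ 2 * (2 ^ n) ^ 2 <= w ^ 2 * C * (n * t ^ 2))%N.
    by rewrite -[X in (_ <= X)%N]mulnA leq_mul2l mulnA Mleg orbT.
  by apply: leq_trans h _; rewrite mulnA (expnS n) expn1 leq_mul2r leq_mul2r qC !orbT.
rewrite [X in (_ <= X)%N]mulnC; apply: leq_trans gD.
rewrite -mulnA [X in (X <= _)%N](_ : _ = 32 * q * 2 ^ n)%N; last by ring.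
rewrite leq_mul2r; apply/orP; right; apply: leq_mul; first by [].
by rewrite -{1}[q]expn1 leq_pexp2l.
Qed.

(** By symmetry the closure of [J] has at most half of the vertices. If [nbs J] has at most
    [2 ^ n / n ^ 7] vertices, [J] is named directly and [K] is arbitrary, which causes the error
    term. For larger neighbourhoods isoperimetry makes [cube_type_bound] applicable. *)
Lemma hc_pairs_cube_bound : exists n0, forall n, (n0 <= n)%N ->
  #|hc_pairs (rho n)|%:R <= expR (ln2 * ((2 ^ n)%:R * (1 + (n%:R ^+ 5)^-1))).
Proof.
(* [10] comes from [g ^ 2 <= 2 * #|A| ^ 2 + 2 * t ^ 2] and [#|A| ^ 2 <= 4 * n * t ^ 2], valid for a
   closure [A] of at most half of the vertices. *)
have [n0 H] := @cube_type_bound 10 isT.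
have [n1 H1] := poly_le_exp2 100 7.
have [n2 H2] := @container_scale 1 1 isT.
exists (n0 + n1 + n2 + 20)%N => n nn.
have {H}H := H n (ltac:(lia)); have {}H1 := H1 n (ltac:(lia)).
have [q [q0 nq qC _]] := H2 n (ltac:(lia)).
have n20 : (20 <= n)%N by lia.
set M := (2 ^ n)%N in H H1 *.
pose TA := [set p in hc_pairs (rho n) | (2 * #|hull (rho n) (nbs (rho n) p.1)| <= M)%N].
have le2 : (#|hc_pairs (rho n)| <= #|TA| + #|TA|)%N.
  pose sw (p : {set box bool n} * {set box bool n}) := (p.2, p.1).
  have swK : cancel sw sw by case.
  rewrite -[X in (_ <= _ + X)%N](card_imset _ (can_inj swK)).
  apply: leq_trans (leq_card_setU _ _); apply: subset_leq_card; apply/subsetP => -[J K] JK.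
  rewrite inE [X in X || _]inE JK /=.
  case: leqP => //= gt; apply/imsetP; exists (K, J) => //.
  rewrite inE -hc_pairs_swap JK /=.
  have := cardsUI (hull (rho n) (nbs (rho n) J)) (hull (rho n) (nbs (rho n) K)).
  have := hulls_disjoint JK; rewrite -setI_eq0 => /eqP ->; rewrite cards0 addn0 => cU.
  have := max_card (hull (rho n) (nbs (rho n) J) :|: hull (rho n) (nbs (rho n) K)).
  by rewrite cU card_cube -/M; move: gt; clear; lia.
have n0' : (0 < n)%N by apply: leq_trans n20.
have n7 : (0 < n ^ 7)%N by rewrite expn_gt0 n0'.
have M0 : (0 < M)%N by rewrite /M expn_gt0.
pose T1 := [set p in hc_pairs (rho n) | (gof n p <= M %/ n ^ 7)%N].
have le1 : #|T1|%:R <= expR (ln2 * (q * (M %/ n ^ 7))%:R + M%:R / 2 ^+ q + ln2 * M%:R) :> R.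
  rewrite expRD; have := card_small R (box bool n) q (M %/ n ^ 7); rewrite card_cube -/M => h.
  apply: le_trans (ler_wpM2r _ h); last exact: expR_ge0.
  rewrite -exp2E -natrM ler_nat (_ : 2 ^ M = 2 ^ #|box bool n|)%N; last by rewrite card_cube.
  rewrite -cardsT -card_powerset -cardsX; apply: subset_leq_card; apply/subsetP => -[J K].
  rewrite !inE /= subsetT andbT => /andP[_]; apply: leq_trans.
  by rewrite subset_leq_card // sub_nbs_cube.
have le3 : #|TA :\: T1|%:R <= ((2 ^ n).+1 ^ 2)%:R * expR (ln2 * M%:R) :> R.
  apply: card_types_le => [|p]; first exact: expR_ge0.
  rewrite !inE => /andP[nT /andP[ph hle]]; split; first by rewrite ?inE.
  move: nT; rewrite ph /= -ltnNge => gl.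
  set g := gof n p in gl *; set A := hull _ _ in hle *.
  have At : #|nbs (rho n) A| = (#|A| + (g - #|A|))%N.
    by rewrite nbs_hull_nbs subnKC // hull_le_cube.
  have Ag : (#|A| <= g)%N by apply: hull_le_cube.
  have := cube_isoperimetry R At; set t := (g - #|A|)%N in At * => iso.
  have Mg : (M <= n ^ 7 * g)%N.
    by move: gl; rewrite ltn_divLR // mulnC => /ltnW.
  have A4 : (#|A| ^ 2 <= 4 * n * t ^ 2)%N.
    have MM : (0 < M ^ 2)%N by rewrite expn_gt0 M0.
    rewrite -(leq_pmul2r MM) -/M.
    have : ((#|A| * M) ^ 2 <= 4 * (#|A| * (M - #|A|)) ^ 2)%N.
      by rewrite -[4%N]/(2 ^ 2)%N -expnMn leq_exp2r // (mulnCA 2) leq_mul2l; apply/orP; right; move: hle; clear; lia.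
    by rewrite expnMn -/M => /leq_trans; apply; move: iso; rewrite -/M; clear; lia.
  have gE : g = (#|A| + t)%N by rewrite /t subnKC.
  have t0 : (0 < t)%N.
    case: (posnP t) => // t0; move: A4 Mg; rewrite gE t0 muln0 addn0 leqn0 expn_eq0 andbT.
    by move=> /eqP ->; rewrite muln0 leqNgt M0.
  apply: (H g t t0 _ Mg).1.
  have s2 : ((#|A| + t) ^ 2 <= 2 * #|A| ^ 2 + 2 * t ^ 2)%N.
    by rewrite sqrnD; have := (nat_Cauchy #|A| t).1; clear; lia.
  have s3 : (t ^ 2 <= n * t ^ 2)%N by rewrite leq_pmull.
  rewrite gE; move: A4 s2 s3; rewrite -!mulnA.
  by move: (#|A| ^ 2)%N (n * t ^ 2)%N (t ^ 2)%N ((#|A| + t) ^ 2)%N; clear; lia.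
have TA12 : (#|TA| <= #|T1| + #|TA :\: T1|)%N.
  by rewrite -(cardsID T1 TA) leq_add2r subset_leq_card // subsetIr.
have l0 := ln2_gt0 R; have l1 := ln2_ge R.
have nr : 20 <= n%:R :> R by rewrite ler_nat.
pose u := M%:R / n%:R ^+ 6 : R.
have n6 : 0 < n%:R ^+ 6 :> R by rewrite exprn_gt0 // ltr0n.
have uM : M%:R = u * n%:R ^+ 6 by rewrite /u mulfVK // gt_eqF.
have u1 : 100 * n%:R <= u.
  by rewrite ler_pdivlMr // -mulrA -exprS -natrX -natrM ler_nat.
have yE : M%:R * (1 + (n%:R ^+ 5)^-1) = M%:R + n%:R * u.
  by rewrite mulrDr mulr1 uM; congr (_ + _); field; rewrite pnatr_eq0 -lt0n.
rewrite yE; set y := ln2 * _.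
have q1 : (q * (M %/ n ^ 7))%:R <= u.
  rewrite ler_pdivlMr // -natrX -natrM ler_nat.
  have qn : (q <= n)%N.
    apply: leq_trans qC; rewrite muln1 mul1n -expnM -{1}[q]expn1 leq_pexp2l //.
  apply: (@leq_trans (n * (M %/ n ^ 7) * n ^ 6)); first by rewrite !leq_mul2r qn !orbT.
  by rewrite mulnAC -expnS mulnC leq_divM.
have q2 : M%:R / 2 ^+ q <= u.
  rewrite ler_pM2l ?ltr0n // lef_pV2 ?posrE ?exprn_gt0 ?ltr0n //.
  by rewrite -!natrX ler_nat; apply: leq_trans nq; rewrite leq_pexp2l.
have u0 : 0 < u by apply: lt_le_trans u1; rewrite mulr_gt0 // ltr0n.
have nu : 20 * u <= n%:R * u by rewrite ler_wpM2r // ltW.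
have b1 : #|T1|%:R <= expR (y - ln2 - ln2).
  apply: le_trans le1 _; rewrite ler_expR.
  apply: le_trans (_ : ln2 * (q * (M %/ n ^ 7))%:R + ln2 * (2 * u) + ln2 * M%:R <= _).
    by rewrite lerD2r lerD2l; move: l1 u0 q2; clear; nra.
  rewrite /y -!mulrDr -[X in _ - X - X]mulr1 -!mulrBr ler_pM2l //.
  by move: nu u0 nr q1 u1; clear; lra.
have b2 : #|TA :\: T1|%:R <= expR (y - ln2 - ln2).
  apply: le_trans le3 _; apply: cube_squares_le.
  rewrite /y -!mulrDr -[X in _ - X - X]mulr1 -!mulrBr ler_pM2l //.
  by rewrite natrD natrM; move: nu u0 nr u1; clear; lra.
apply: le_trans (_ : (#|TA| + #|TA|)%:R <= _); first by rewrite ler_nat.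
have bT : #|TA|%:R <= expR (y - ln2).
  apply: le_trans (_ : #|T1|%:R + #|TA :\: T1|%:R <= _); first by rewrite -natrD ler_nat.
  by apply: le_trans (lerD b1 b2) _; apply: expR_double; rewrite subrK.
by rewrite natrD; apply: le_trans (lerD bT bT) _; apply: expR_double; rewrite subrK.
Qed.

Lemma ln2_le1 : ln2 <= 1.
Proof.
rewrite -[leRHS](expRK) ler_ln ?posrE ?expR_gt0 ?ltr0n //.
by apply: le_trans (expR_ge1Dx _); rewrite -natr1 lexx.
Qed.

(** If [J] is tiny, balance keeps [K] below [(1 / 2 - e / 2) * 2 ^ n], which is rare by Chernoff's
    bound; likewise with the roles exchanged. Otherwise the closure of [J] and its complement both
    contain a fixed fraction of the vertices, so [t] is at least of order [2 ^ n / sqrt n] and the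
    second bound of [cube_type_bound] applies. *)
Lemma hc_balanced_cube_bound (e : R) : 0 < e -> e <= 1 / 2 ->
  exists n0, forall n, (n0 <= n)%N ->
  #|[set p in hc_pairs (rho n) |
     `|#|p.1|%:R - #|p.2|%:R| <= (1 / 2 - e) * (2 ^ n)%:R :> R]|%:R
   <= expR (ln2 * ((2 ^ n)%:R * (1 - 1 / n%:R))).
Proof.
move=> e0 e1; have e20 : 0 < e ^+ 2 by rewrite exprn_gt0.
pose s := - ln (e ^+ 2 / 32).
have es : expR (- s) = e ^+ 2 / 32.
  by rewrite /s opprK lnK // posrE divr_gt0 // ltr0n.
have s0 : 0 <= s.
  rewrite /s oppr_ge0 -ln1 ler_ln ?posrE //; first by nra.
  by rewrite divr_gt0 // ltr0n.
(* Chosen so that the sets with at most [al * M] vertices number at most [expR (e ^+ 2 / 16 * M)],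
   half of the exponent that Chernoff's bound gains for the other set. *)
pose al := e ^+ 2 / 32 / (s + 1).
have s1 : 0 < s + 1 by lra.
have al0 : 0 < al by rewrite !divr_gt0 // ltr0n.
have al1 : al <= e ^+ 2 / 32 by rewrite ler_pdivrMr //; nra.
have sal : s * al <= e ^+ 2 / 32.
  have -> : e ^+ 2 / 32 = al * (s + 1) by rewrite /al mulfVK // gt_eqF.
  by rewrite mulrDr mulr1 mulrC lerDl ltW.
have al2 : al <= e / 2 by nra.
pose C := (Num.bound (al ^- 4)).+1.
have CP : 1 <= C%:R * al ^+ 4.
  rewrite -ler_pdivrMr ?exprn_gt0 // mul1r /C -natr1.
  have := archi_boundP (ltW (_ : 0 < al ^- 4)); rewrite invr_gt0 exprn_gt0 // => /(_ isT).
  by lra.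
have [n0 H] := @cube_type_bound C isT.
have [n1 H1] := poly_le_exp2 10 2.
pose b1 := Num.bound (al ^-1); pose b2 := Num.bound (32 / e ^+ 2).
exists (n0 + n1 + b1 + b2 + 1)%N => n nn.
have [nn0 nn1 nb1 nb2 n1'] : [/\ n0 <= n, n1 <= n, b1 <= n, b2 <= n & 0 < n]%N.
  by move: nn; clearbody b1 b2; clear; split; lia.
have {}H := H n nn0; have {}H1 := H1 n nn1.
have nal : 1 <= n%:R * al.
  rewrite -ler_pdivrMr // mul1r.
  have /archi_boundP/ltW/le_trans : 0 <= al^-1 by rewrite invr_ge0 ltW.
  by apply; rewrite ler_nat.
have ne : 32 <= n%:R * e ^+ 2.
  rewrite -ler_pdivrMr //.
  have /archi_boundP/ltW/le_trans : 0 <= 32 / e ^+ 2 by rewrite divr_ge0 // ltW.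
  by apply; rewrite ler_nat.
set T := [set p in _ | _].
set M := (2 ^ n)%N in H H1 T *.
have MR : 0 < M%:R :> R by rewrite ltr0n expn_gt0.
pose Sm := [set S : {set box bool n} | #|S|%:R <= al * M%:R].
pose Lo := [set S : {set box bool n} | #|S|%:R <= (1 / 2 - e / 2) * M%:R].
have bSm : #|Sm|%:R <= expR (e ^+ 2 / 16 * M%:R).
  apply: le_trans (card_sets_le _ _ s0) _.
  apply: le_trans (_ : expR (e ^+ 2 / 32 * M%:R) * expR (e ^+ 2 / 32) ^+ M <= _).
    apply: ler_pM; rewrite ?expR_ge0 ?exprn_ge0 ?addr_ge0 ?expR_ge0 //.
      by rewrite ler_expR mulrA ler_wpM2r // ltW.
    rewrite card_cube lerXn2r ?nnegrE ?addr_ge0 ?expR_ge0 // es.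
    exact: expR_ge1Dx.
  rewrite -expRM_natl -expRD ler_expR; lra.
have bLo : #|Lo|%:R <= expR (ln2 * M%:R - e ^+ 2 / 8 * M%:R).
  have e01 : 0 <= e / 2 <= 1 by apply/andP; split; lra.
  apply: le_trans (card_sets_below_half e01 _) _; first by rewrite card_cube lexx.
  rewrite card_cube ler_expR; lra.
have bX : #|Sm|%:R * #|Lo|%:R <= expR (ln2 * M%:R - e ^+ 2 / 16 * M%:R).
  apply: le_trans (ler_pM _ _ bSm bLo) _; rewrite ?ler0n // -expRD ler_expR; lra.
pose T3 := T :\: (setX Sm Lo :|: setX Lo Sm).
have bT3 : #|T3|%:R <= ((2 ^ n).+1 ^ 2)%:R * expR (ln2 * (M%:R * (1 - 2 / n%:R))) :> R.
  apply: card_types_le => [|[J K]]; first exact: expR_ge0.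
  rewrite !inE /= => /andP[nSL /andP[ph bal]]; split; first by rewrite ?inE.
  have JK : (J, K) \in hc_pairs (rho n) by rewrite inE.
  move: nSL; rewrite negb_or !negb_and => /andP[h1 h2].
  have /ler_normlP[bal1 bal2] := bal.
  have Jal : al * M%:R < #|J|%:R.
    rewrite ltNge; apply/negP => Jle; move: h1; rewrite Jle /= => /negP; apply.
    by move: bal1 bal2 Jle al2 MR; clear; nra.
  have Kal : al * M%:R < #|K|%:R.
    rewrite ltNge; apply/negP => Kle; move: h2; rewrite Kle /= orbF => /negP; apply.
    by move: bal1 bal2 Kle al2 MR; clear; nra.
  set A := hull (rho n) (nbs (rho n) J); set g := #|nbs (rho n) J|.
  have Ag : (#|A| <= g)%N by apply: hull_le_cube.
  have gM : (g <= M)%N by rewrite /M -card_cube max_card.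
  have At : #|nbs (rho n) A| = (#|A| + (g - #|A|))%N by rewrite nbs_hull_nbs subnKC.
  have JA : (#|J| <= #|A|)%N by rewrite subset_leq_card // sub_hull.
  have AK : (#|A| + #|K| <= M)%N.
    have := hull_disjoint JK; rewrite disjoint_sym -setI_eq0 => /eqP AK0.
    by have := cardsUI A K; rewrite AK0 cards0 addn0 => <-; rewrite /M -card_cube max_card.
  have iso := cube_isoperimetry R At; set t := (g - #|A|)%N in At iso *.
  rewrite -/M in iso.
  have Aal : al * M%:R < #|A|%:R by apply: lt_le_trans Jal _; rewrite ler_nat.
  have AMal : al * M%:R < (M - #|A|)%:R.
    by apply: lt_le_trans Kal _; rewrite ler_nat; move: AK; clear; lia.
  have Cnt : (M ^ 2 <= C * n * t ^ 2)%N.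
    have M2 : 0 < M%:R ^+ 2 :> R by rewrite exprn_gt0.
    rewrite -(ler_nat R) -(ler_pM2r M2).
    apply: le_trans (_ : C%:R * (al * M%:R * (al * M%:R)) ^+ 2 <= _).
      rewrite natrX (_ : C%:R * _ = (C%:R * al ^+ 4) * (M%:R ^+ 2 * M%:R ^+ 2)); last by ring.
      by rewrite ler_peMl // mulr_ge0 // ltW.
    have aM0 : 0 <= al * M%:R by rewrite mulr_ge0 // ltW.
    apply: le_trans (_ : C%:R * ((#|A| * (M - #|A|)) ^ 2)%:R <= _).
      have hh : al * M%:R * (al * M%:R) <= (#|A| * (M - #|A|))%:R :> R.
        by rewrite natrM; apply: ler_pM => //; apply: ltW.
      rewrite ler_wpM2l ?ler0n // natrX; apply: lerXn2r => //; rewrite nnegrE.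
        exact: mulr_ge0.
      by rewrite ler0n.
    rewrite -natrX -!natrM ler_nat.
    have -> : (C * n * t ^ 2 * M ^ 2 = C * (n * t ^ 2 * M ^ 2))%N by ring.
    by rewrite leq_mul2l iso orbT.
  have t0 : (0 < t)%N.
    case: (posnP t) => // t0; move: Cnt; rewrite t0 muln0 leqn0 expn_eq0 andbT => /eqP M0.
    by move: MR; rewrite M0 ltxx.
  have Mg : (M <= n ^ 7 * g)%N.
    apply: (@leq_trans (n * g)); last by rewrite leq_mul2r -{1}[n]expn1 leq_pexp2l ?orbT.
    rewrite -(ler_nat R) natrM; apply: le_trans (_ : n%:R * #|A|%:R <= _).
      apply: le_trans (_ : n%:R * (al * M%:R) <= _).
        by rewrite mulrA ler_peMl // ltW.
      by rewrite ler_wpM2l ?ler0n // ltW.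
    by rewrite ler_wpM2l ?ler0n // ler_nat.
  have g2 : (g ^ 2 <= C * n * t ^ 2)%N by apply: leq_trans Cnt; rewrite leq_exp2r.
  exact: (H g t t0 g2 Mg).2.
have l0 := ln2_gt0 R; have l1 := ln2_le1.
have nR : 0 < n%:R :> R by rewrite ltr0n.
pose w := M%:R / n%:R : R.
have Mw : M%:R = w * n%:R by rewrite /w mulfVK // gt_eqF.
have w0 : 0 < w by rewrite divr_gt0.
have wn : 10 * n%:R <= w.
  by rewrite ler_pdivlMr // -mulrA -expr2 -natrX -natrM ler_nat.
have n1r : 1 <= n%:R :> R by rewrite ler1n.
have -> : M%:R * (1 - 1 / n%:R) = M%:R - w by rewrite mulrBr mulr1 mul1r.
set y := ln2 * _.
have bX' : expR (ln2 * M%:R - e ^+ 2 / 16 * M%:R) <= expR (y - ln2 - ln2).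
  rewrite ler_expR /y.
  have h : 2 * w <= e ^+ 2 / 16 * M%:R by rewrite Mw; move: ne w0; clear; nra.
  by move: h w0 l0 l1 wn n1r; clear; nra.
have b3' : #|T3|%:R <= expR (y - ln2 - ln2).
  apply: le_trans bT3 _; apply: cube_squares_le.
  have -> : M%:R * (1 - 2 / n%:R) = M%:R - 2 * w by rewrite mulrBr mulr1 mulrCA.
  rewrite /y -!mulrDr -[X in _ - X - X]mulr1 -!mulrBr ler_pM2l //.
  by rewrite natrD natrM; move: n1r wn; clear; lra.
have TT : (#|T| <= (#|setX Sm Lo| + #|setX Lo Sm|) + #|T3|)%N.
  rewrite -(cardsID (setX Sm Lo :|: setX Lo Sm) T) leq_add2r.
  by apply: leq_trans (leq_card_setU _ _); rewrite subset_leq_card // subsetIr.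
apply: le_trans (_ : ((#|setX Sm Lo| + #|setX Lo Sm|) + #|T3|)%:R <= _); first by rewrite ler_nat.
rewrite !natrD !cardsX !natrM [#|Lo|%:R * _]mulrC.
have := le_trans bX bX'; set z := expR _ in b3' *.
have zz : z + z + (z + z) <= expR y.
  have z2 : z + z <= expR (y - ln2) by apply: expR_double; rewrite subrK.
  by apply: le_trans (lerD z2 z2) _; apply: expR_double; rewrite subrK.
have z0 : 0 <= z := expR_ge0 _.
by move: b3' zz z0; clear; lra.
Qed.

End CubeCount.

(** * A Hölder inequality for cyclic products of matrices *)

Section Hoelder.
Variables (R : realFieldType) (n : nat).
Implicit Types (A B C S : 'M[R]_n) (s : nat).

Lemma cauchy_schwarz (I : finType) (a b : I -> R) :
  (\sum_i a i * b i) ^+ 2 <= (\sum_i a i ^+ 2) * (\sum_i b i ^+ 2).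
Proof.
rewrite expr2 !big_distrlr /= -subr_ge0.
have -> : \sum_i \sum_j a i ^+ 2 * b j ^+ 2 - \sum_i \sum_j a i * b i * (a j * b j)
  = (\sum_i \sum_j (a i * b j - a j * b i) ^+ 2) / 2.
  rewrite -(mulfK (_ : 2 != 0) (_ - _)) ?pnatr_eq0 //; congr (_ / _).
  rewrite mulr_natr mulr2n [X in X + _ = _]addrC -addrA.
  rewrite [X in _ + (_ + X)](_ : _ = \sum_i \sum_j a j ^+ 2 * b i ^+ 2 - \sum_i \sum_j a i * b i * (a j * b j)); last first.
    by rewrite exchange_big.
  rewrite -!sumrN -!big_split /=; apply: eq_bigr => i _.
  by rewrite -!sumrN -!big_split /=; apply: eq_bigr => j _; ring.
by rewrite divr_ge0 // sumr_ge0 // => i _; rewrite sumr_ge0 // => j _; rewrite sqr_ge0.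
Qed.

Lemma tr_mul_tr2 A B : \tr (A * B^T) = \sum_i \sum_j A i j * B i j.
Proof.
by apply: eq_bigr => i _; rewrite mxE; apply: eq_bigr => j _; rewrite mxE.
Qed.

Lemma tr_mul_tr A B : \tr (A * B^T) = \sum_(ij : 'I_n * 'I_n) A ij.1 ij.2 * B ij.1 ij.2.
Proof. by rewrite tr_mul_tr2 (pair_bigA _ (fun i j => A i j * B i j)). Qed.

Lemma tr_gram_ge0 A : 0 <= \tr (A * A^T).
Proof. by rewrite tr_mul_tr sumr_ge0 // => i _; rewrite -expr2 sqr_ge0. Qed.

Lemma tr_mul_sqr A B : \tr (A * B) ^+ 2 <= \tr (A * A^T) * \tr (B * B^T).
Proof.
have -> : \tr (B * B^T) = \tr (B^T * B^T^T).
  by rewrite trmxK; apply: mxtrace_mulC.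
rewrite -[in X in X <= _](trmxK B) !tr_mul_tr; apply: le_trans (cauchy_schwarz _ _) _.
by rewrite le_eqVlt; apply/orP; left; apply/eqP; congr (_ * _); apply: eq_bigr => i _; rewrite expr2.
Qed.

Lemma tr_gram_mul C D : \tr ((C * C^T) * (D * D^T)) <= \tr (C * C^T) * \tr (D * D^T).
Proof.
have -> : \tr ((C * C^T) * (D * D^T)) = \tr ((C^T * D) * (C^T * D)^T).
  by rewrite -!mulmxE trmx_mul trmxK -!mulmxA [LHS]mxtrace_mulC -!mulmxA.
have -> : \tr (C * C^T) = \tr (C^T * C^T^T) by rewrite trmxK; apply: mxtrace_mulC.
have -> : \tr (D * D^T) = \tr (D^T * D^T^T) by rewrite trmxK; apply: mxtrace_mulC.
rewrite !tr_mul_tr2 big_distrlr /=; apply: ler_sum => i _; apply: ler_sum => j _.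
rewrite -expr2 mxE.
rewrite -[X in _ <= _ * X](eq_bigr _ (fun l _ => expr2 (D^T j l))).
rewrite -[X in _ <= X * _](eq_bigr _ (fun l _ => expr2 (C^T i l))).
rewrite [X in _ <= _ * X](eq_bigr (fun l => D l j ^+ 2)) => [|l _]; last by rewrite mxE.
exact: cauchy_schwarz.
Qed.

Lemma tr_exp_mulC A B k : \tr ((A * B) ^+ k) = \tr ((B * A) ^+ k).
Proof.
case: k => [|k]; first by rewrite !expr0.
have comm j : (A * B) ^+ j * A = A * (B * A) ^+ j.
  elim: j => [|j IH]; first by rewrite !expr0 mul1r mulr1.
  by rewrite exprS -mulrA IH exprS !mulrA.
rewrite exprSr mulrA comm -mulrA exprSr [in RHS]mulrA.
exact: mxtrace_mulC.
Qed.

(* [schatten j A] is the [2j]-th power of the Schatten [2j]-norm. *)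
Definition schatten j A := \tr ((A * A^T) ^+ j).

Lemma trmx_exp A k : (A ^+ k)^T = (A^T) ^+ k.
Proof.
elim: k => [|k IH]; first by rewrite !expr0 trmx1.
by rewrite exprS exprSr [LHS]trmx_mul IH.
Qed.

Lemma gram_sym A : (A * A^T)^T = A * A^T.
Proof. by rewrite trmx_mul trmxK. Qed.

Lemma gram_expE A j : exists C, (A * A^T) ^+ j = C * C^T.
Proof.
rewrite -(odd_double_half j); set i := j./2; case: (odd j).
  exists ((A * A^T) ^+ i * A).
  rewrite [(_ * A)^T]trmx_mul trmx_exp gram_sym -mulmxE -!mulmxA (mulmxA A) !mulmxE.
  by rewrite -exprS -exprD; congr (_ ^+ _); lia.
by exists ((A * A^T) ^+ i); rewrite trmx_exp gram_sym -exprD add0n addnn.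
Qed.

Lemma schatten_ge0 j A : 0 <= schatten j A.
Proof. by rewrite /schatten; have [C ->] := gram_expE A j; apply: tr_gram_ge0. Qed.

Lemma schattenD_le i j A : schatten (i + j) A <= schatten i A * schatten j A.
Proof.
rewrite /schatten exprD; have [C ->] := gram_expE A i; have [D ->] := gram_expE A j.
exact: tr_gram_mul.
Qed.

Lemma schatten_le_hs j A : (0 < j)%N -> schatten j A <= schatten 1 A ^+ j.
Proof.
case: j => // j _; elim: j => [|j IH]; first by rewrite expr1.
rewrite -add1n exprD; apply: le_trans (schattenD_le _ _ _) _.
by rewrite ler_wpM2l // schatten_ge0.
Qed.

Lemma schatten_trmx j A : schatten j A^T = schatten j A.
Proof. by rewrite /schatten trmxK tr_exp_mulC. Qed.

Lemma schatten_gram j A : schatten j (A * A^T) = schatten (2 * j) A.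
Proof. by rewrite /schatten gram_sym -expr2 -exprM. Qed.

Lemma prod_pairs (K : pzSemiRingType) (A : nat -> K) m :
  \prod_(i < 2 * m) A i = \prod_(j < m) (A (2 * j)%N * A (2 * j).+1).
Proof.
elim: m => [|m IH]; first by rewrite muln0 !big_ord0.
by rewrite mulnS !big_ord_recr /= IH mulrA.
Qed.

Section Words.
Variables (j : nat) (A : nat -> 'M[R]_n) (c : nat -> R).
Hypothesis j_gt0 : (0 < j)%N.
Hypothesis c_gt0 : forall i, 0 < c i.
Hypothesis c_ge : forall i, (i < 2 * j)%N -> schatten j (A i) <= c i.

(* The letter [(i, b)] stands for [A i], transposed if [b]. *)
Let letter := ('I_(2 * j) * bool)%type.
Implicit Types (a b : letter) (W U V : seq letter).

Let letter_mx a : 'M[R]_n := if a.2 then (A a.1)^T else A a.1.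
Let word_mx W := \prod_(a <- W) letter_mx a.
Let flip_letter a : letter := (a.1, ~~ a.2).
Let word_tr W := rev (map flip_letter W).
Let word_weight W := \prod_(a <- W) c a.1.
Let score W := \tr (word_mx W) ^+ (2 * j) / word_weight W.

Let word_weight_gt0 W : 0 < word_weight W.
Proof. by rewrite /word_weight; apply: prodr_gt0 => a _; apply: c_gt0. Qed.

Let word_mx_cat U W : word_mx (U ++ W) = word_mx U * word_mx W.
Proof. exact: big_cat. Qed.

Let word_weight_cat U W : word_weight (U ++ W) = word_weight U * word_weight W.
Proof. exact: big_cat. Qed.

Let word_tr_cat U W : word_tr (U ++ W) = word_tr W ++ word_tr U.
Proof. by rewrite /word_tr map_cat rev_cat. Qed.

Let word_mx_tr W : word_mx (word_tr W) = (word_mx W)^T.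
Proof.
elim: W => [|a W IH]; first by rewrite /word_mx !big_nil trmx1.
rewrite -cat1s word_tr_cat !word_mx_cat [RHS]trmx_mul IH; congr (_ * _).
by rewrite /word_mx !big_seq1 /letter_mx /=; case: (a.2); rewrite ?trmxK.
Qed.

Let word_weight_tr W : word_weight (word_tr W) = word_weight W.
Proof.
elim: W => [|a W IH] //; rewrite -cat1s word_tr_cat !word_weight_cat IH mulrC.
by congr (_ * _); rewrite /word_weight !big_seq1.
Qed.

Let score_catC U V : score (U ++ V) = score (V ++ U).
Proof.
rewrite /score !word_weight_cat !word_mx_cat; congr (_ ^+ _ / _).
  exact: mxtrace_mulC.
exact: mulrC.
Qed.

Let score_ge0 W : 0 <= score W.
Proof.
by rewrite divr_ge0 ?(ltW (word_weight_gt0 _)) // exprM exprn_ge0 // sqr_ge0.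
Qed.

Let score_cat U W : score (U ++ W) ^+ 2 <= score (word_tr U ++ U) * score (word_tr W ++ W).
Proof.
rewrite /score !word_weight_cat !word_weight_tr expr_div_n mulf_div.
rewrite !word_mx_cat !word_mx_tr.
set u := word_mx U; set v := word_mx W.
have -> : (word_weight U * word_weight W) ^+ 2 =
  word_weight U * word_weight U * (word_weight W * word_weight W) by ring.
rewrite ler_pM2r ?invr_gt0 ?mulr_gt0 ?word_weight_gt0 //.
rewrite -exprM mulnC exprM -exprMn lerXn2r ?nnegrE ?sqr_ge0 //.
  rewrite mulr_ge0 //; [have := tr_gram_ge0 u^T | have := tr_gram_ge0 v^T]; by rewrite trmxK.
apply: le_trans (tr_mul_sqr _ _) _.
by rewrite [\tr (u * _)]mxtrace_mulC [\tr (v * _)]mxtrace_mulC.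
Qed.

Let size_word_tr W : size (word_tr W) = size W.
Proof. by rewrite size_rev size_map. Qed.

Let run a l : seq letter := mkseq (fun i => if odd i then flip_letter a else a) l.

Let flip_letterK a : flip_letter (flip_letter a) = a.
Proof. by case: a => i b; rewrite /flip_letter /= negbK. Qed.

Let run_rcons a l : run a l.+1 = run a l ++ [:: if odd l then flip_letter a else a].
Proof. by rewrite /run mkseqS -cats1. Qed.

Let run_cons a l : run a l.+1 = a :: run (flip_letter a) l.
Proof.
elim: l => // l IH; rewrite run_rcons IH /= run_rcons /=; congr (_ :: _ ++ [:: _]).
by case: (odd l) => //=; rewrite flip_letterK.
Qed.

Let run_tr a l : word_tr (run a l) ++ run a l = run (if odd l then flip_letter a else a) (l + l).
Proof.
elim: l => [|l IH] //.
rewrite {1 2}run_rcons word_tr_cat -!catA (catA _ (run a l)) IH.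
rewrite addSn addnS run_cons run_rcons /= addnn odd_double /=.
by congr (_ :: run _ _ ++ [:: _]); case: (odd l) => //=; rewrite !flip_letterK.
Qed.

Let size_run a l : size (run a l) = l. Proof. exact: size_mkseq. Qed.

Let score_run a : score (run a (2 * j)) <= 1.
Proof.
have cj : schatten j (letter_mx a) <= c a.1.
  by rewrite /letter_mx; case: (a.2); rewrite ?schatten_trmx c_ge.
have wE k : word_mx (run a (2 * k)) = (letter_mx a * (letter_mx a)^T) ^+ k.
  elim: k => [|k IH]; first by rewrite muln0 /word_mx big_nil expr0.
  rewrite mulnS addnC addn2 !run_rcons !word_mx_cat IH -mulrA exprSr; congr (_ * _).
  rewrite /word_mx !big_seq1 mul2n /= odd_double /=; congr (_ * _).
  by rewrite /letter_mx /=; case: (a.2); rewrite ?trmxK.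
rewrite /score wE.
have -> : forall l, word_weight (run a l) = c a.1 ^+ l.
  elim=> [|k IH]; first by rewrite /word_weight big_nil.
  rewrite run_rcons word_weight_cat IH exprSr; congr (_ * _).
  by rewrite /word_weight big_seq1; case: (odd k).
rewrite ler_pdivrMr ?exprn_gt0 // mul1r lerXn2r ?nnegrE ?schatten_ge0 //.
exact: ltW.
Qed.

(* Split a word of maximal score as [U ++ W] with [U], [W] of equal length: by Cauchy-Schwarz
   [word_tr U ++ U] has maximal score too.  If [U] starts with an alternating run, the new word
   contains one twice as long, so some alternating word has maximal score. *)
Let score_le1 W : size W = (2 * j)%N -> score W <= 1.
Proof.
move=> sW; pose w0 : (2 * j).-tuple letter := tcast sW (in_tuple W).
have w0E : tval w0 = W by rewrite val_tcast.
pose w := [arg max_(w > w0 | true) score (tval w)]%O.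
have wmax (V : seq letter) : size V = (2 * j)%N -> score V <= score w.
  move=> sV; rewrite /w; case: arg_maxP => // u _ /(_ (tcast sV (in_tuple V)) isT).
  by rewrite val_tcast.
apply: le_trans (wmax W sW) _.
case: (leP (score w) 0) => [le0|s0]; first by apply: le_trans le0 _.
pose P l := exists b V, size (run b l ++ V) = (2 * j)%N /\ score w <= score (run b l ++ V).
have weak l l' : (l' <= l)%N -> P l -> P l'.
  move=> /subnKC <-; elim: (l - l')%N => [|k IH]; first by rewrite addn0.
  rewrite addnS => -[b [V [sV le]]]; apply: IH.
  by exists b; exists ([:: if odd (l' + k) then flip_letter b else b] ++ V); rewrite catA -run_rcons.
have double l : (l <= j)%N -> P l -> P (l + l)%N.
  move=> lj [b [V [sV le]]].
  have sj : (j - l <= size V)%N by move: sV; rewrite size_cat size_run; lia.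
  pose U := take (j - l) V; pose V' := drop (j - l) V.
  have sU : size U = (j - l)%N by apply: size_takel.
  have sV' : size V' = j by rewrite size_drop; move: sV; rewrite size_cat size_run; lia.
  have := score_cat (run b l ++ U) V'; rewrite -catA cat_take_drop => cs.
  exists (if odd l then flip_letter b else b), (U ++ word_tr U); split.
    by rewrite !size_cat size_run size_word_tr sU; move: lj; clear; lia.
  rewrite catA score_catC -run_tr -!catA [word_tr U ++ _]catA -word_tr_cat.
  rewrite -(ler_pM2r s0); apply: le_trans (_ : score (run b l ++ V) ^+ 2 <= _).
    by rewrite expr2 ler_pM // ltW.
  apply: le_trans cs _; rewrite ler_wpM2l ?score_ge0 // wmax //.
  by rewrite size_cat size_word_tr sV' mul2n addnn.
have P1 : P 1%N.
  have : size w = (2 * j)%N by rewrite size_tuple.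
  case e : (tval w) => [|a V] sw; first by move: sw j_gt0; rewrite /=; clear; lia.
  by exists a, V; rewrite e (_ : run a 1 ++ V = a :: V).
have Pk k : P (minn (2 ^ k) j).
  elim: k => [|k IH]; first by apply: weak P1; rewrite geq_minl.
  apply: weak (double _ (geq_minr _ _) IH); rewrite expnS.
  by move: (2 ^ k)%N; clear; lia.
have Pj : P j by have := Pk j; rewrite (minn_idPr (ltnW (ltn_expl _ _))).
have [b [V [sV le]]] := double j (leqnn j) Pj.
apply: le_trans le _.
have -> : V = [::] by apply: size0nil; move: sV; rewrite size_cat size_run; clear; lia.
by rewrite cats0 addnn -mul2n score_run.
Qed.

(** Positive majorants [c] in place of the Schatten norms keep the score meaningful when a norm
    vanishes. *)
Lemma tr_prod_le_weights : \tr (\prod_(i < 2 * j) A i) ^+ (2 * j) <= \prod_(i < 2 * j) c i.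
Proof.
have := @score_le1 [seq (i, false) | i : 'I_(2 * j)].
rewrite size_image card_ord => /(_ erefl).
rewrite /score /word_mx /word_weight !big_image /=.
rewrite ler_pdivrMr; last by apply: prodr_gt0 => i _; apply: c_gt0.
rewrite mul1r.
have -> : \prod_(a <- [seq ((i, false) : letter) | i : 'I_(2 * j)]) letter_mx a = \prod_(i < 2 * j) A i.
  have e : enum 'I_(2 * j) = index_enum 'I_(2 * j) by rewrite enumT; unlock index_enum.
  by rewrite /image_mem /= big_map e.
by [].
Qed.

End Words.

Lemma hoelder_even j (A : nat -> 'M[R]_n) : (0 < j)%N ->
  \tr (\prod_(i < 2 * j) A i) ^+ (2 * j) <= \prod_(i < 2 * j) schatten j (A i).
Proof.
move=> j0; case: (altP (@forallP _ (fun i : 'I_(2 * j) => 0 < schatten j (A i)))) => [pos|].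
  pose c i := if (i < 2 * j)%N then schatten j (A i) else 1.
  have := @tr_prod_le_weights j A c j0 _ _.
  rewrite [in X in _ -> _ -> _ <= X](eq_bigr (fun i : 'I_(2 * j) => schatten j (A i))) => [|i _].
    apply=> i; rewrite /c; last by move=> ->.
    by case: ifP => // ij; apply: (pos (Ordinal ij)).
  by rewrite /c ltn_ord.
rewrite negb_forall => /existsP [i0]; rewrite -leNgt => le0.
rewrite [X in _ <= X](bigD1 i0) //= (_ : schatten j (A i0) = 0) ?mul0r; last first.
  by apply/eqP; rewrite eq_le le0 schatten_ge0.
rewrite leNgt; apply/negP => t0; set t := _ ^+ _ in t0.
pose C := \prod_(i < 2 * j | i != i0) (schatten j (A i) + 1).
have C0 : 0 < C by apply: prodr_gt0 => i _; rewrite ltr_wpDl // schatten_ge0.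
(* A vanishing norm admits any positive majorant; this one makes the product of all majorants equal
   to [t / 2], which contradicts [0 < t]. *)
pose c i := if i == i0 :> nat then t / (2 * C) else schatten j (A i) + 1.
have tC : 0 < t / (2 * C) by rewrite divr_gt0 // mulr_gt0.
have : t <= \prod_(i < 2 * j) c i.
  apply: tr_prod_le_weights => // i; rewrite /c.
    by case: eqP => // _; rewrite ltr_wpDl // schatten_ge0.
  by move=> _; case: eqP => [->|_]; [exact: le_trans le0 (ltW tC)|rewrite lerDl].
rewrite (bigD1 i0) //= {1}/c eqxx (eq_bigr (fun i : 'I_(2 * j) => schatten j (A i) + 1)) => [|i ii].
  rewrite -/C invfM !mulrA mulfVK ?gt_eqF //; move: t0; clear; lra.
by rewrite /c; case: eqP => // /val_inj e; rewrite e eqxx in ii.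
Qed.

(** By cyclicity, [schatten j (A * B)] is the trace of an alternating product of the Gram matrices
    of [A^T] and [B], to which the even case of Hölder's inequality applies. *)
Lemma schatten_mul_sqr j A B : (0 < j)%N ->
  schatten j (A * B) ^+ 2 <= schatten (2 * j) A * schatten (2 * j) B.
Proof.
move=> j0.
pose P := A^T * A; pose Q := B * B^T.
have e1 : schatten j (A * B) = \tr ((Q * P) ^+ j).
  rewrite /schatten trmx_mul -mulrA [B * _]mulrA -/Q tr_exp_mulC.
  by rewrite -mulrA.
have := @hoelder_even j (fun i => if odd i then P else Q) j0.
rewrite (prod_pairs (fun i => if odd i then P else Q)).
rewrite (prod_pairs (fun i => schatten j (if odd i then P else Q))).
under eq_bigr => l _ do rewrite oddM /= oddM /=.
under [X in _ <= X]eq_bigr => l _ do rewrite oddM /= oddM /=.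
rewrite !prodr_const card_ord -e1 exprM => le.
have -> : schatten (2 * j) A = schatten j P.
  by rewrite -[A in LHS]trmxK schatten_trmx -schatten_gram trmxK.
rewrite -schatten_gram [X in _ <= X]mulrC.
rewrite -(ler_pXn2r j0) // nnegrE ?exprn_ge0 ?mulr_ge0 ?schatten_ge0 //.
Qed.

Lemma schattenM j A B : (0 < j)%N -> schatten j (A * B) <= schatten j A * schatten j B.
Proof.
move=> j0.
rewrite -(ler_pXn2r (n := 2)) ?nnegrE ?mulr_ge0 ?schatten_ge0 //.
apply: le_trans (schatten_mul_sqr _ _ j0) _.
by rewrite exprMn ler_pM ?schatten_ge0 // mul2n -addnn expr2 schattenD_le.
Qed.

(** Factors in excess of [2 * j] are merged with their neighbours by submultiplicativity; this is
    what admits an odd number of factors. *)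
Lemma hoelder j m (A : nat -> 'M[R]_n) : (0 < j)%N -> (2 * j <= m)%N ->
  \tr (\prod_(i < m) A i) ^+ (2 * j) <= \prod_(i < m) schatten j (A i).
Proof.
move=> j0 sm; rewrite -(subnKC sm); elim: (m - _)%N A => [|k IH] A.
  by rewrite addn0; apply: hoelder_even.
set p := (2 * j + k)%N in IH *; rewrite addnS -/p.
have p0 : (0 < p)%N by rewrite addn_gt0 muln_gt0 j0.
case: p IH p0 => // p IH _.
have := IH (fun i => if i == p then A p * A p.+1 else A i).
rewrite !big_ord_recr /= eqxx.
rewrite (eq_bigr (fun i : 'I_p => A i)) => [|i _]; last by rewrite ltn_eqF.
rewrite [X in _ <= X * _](eq_bigr (fun i : 'I_p => schatten j (A i))) => [|i _]; last first.
  by rewrite ltn_eqF.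
rewrite -!mulrA => /le_trans; apply.
rewrite ler_wpM2l ?schattenM // prodr_ge0 // => i _; exact: schatten_ge0.
Qed.

End Hoelder.

(** * Sums over configurations on a cycle as traces *)

Section Cycles.
Variables (R : realFieldType) (X : finType).
Implicit Types (f g : X -> X -> R) (G : X -> X -> X -> R).

Definition kmx f : 'M[R]_#|X| := \matrix_(i, j) f (enum_val i) (enum_val j).

Lemma eq_kmx f g : (forall x y, f x y = g x y) -> kmx f = kmx g.
Proof. by move=> fg; apply/matrixP => i j; rewrite !mxE. Qed.

Lemma sum_enum_val (F : X -> R) : \sum_(j < #|X|) F (enum_val j) = \sum_x F x.
Proof.
by rewrite [RHS](reindex (fun j : 'I_#|X| => enum_val j)) //; apply: onW_bij; apply: enum_val_bij.
Qed.

Lemma kmx_mul f g : kmx f * kmx g = kmx (fun x z => \sum_y f x y * g y z).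
Proof.
apply/matrixP => i j; rewrite !mxE -sum_enum_val.
by apply: eq_bigr => l _; rewrite !mxE.
Qed.

Lemma tr_kmx f : \tr (kmx f) = \sum_x f x x.
Proof. by rewrite -sum_enum_val; apply: eq_bigr => i _; rewrite mxE. Qed.

Lemma kmx_tr f : (kmx f)^T = kmx (fun x y => f y x).
Proof. by apply/matrixP => i j; rewrite !mxE. Qed.

Lemma sum_tuple_cons (T : finType) m (F : seq T -> R) :
  \sum_(y : m.+1.-tuple T) F y = \sum_a \sum_(y : m.-tuple T) F (a :: y).
Proof.
rewrite pair_bigA /=.
rewrite (reindex (fun p : T * m.-tuple T => [tuple of p.1 :: p.2])) //=.
exists (fun y : m.+1.-tuple T => (thead y, [tuple of behead y])) => [[a y] _|y _].
  by congr (_, _); apply/val_inj.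
by apply/val_inj; rewrite /= [in RHS](tuple_eta y).
Qed.

(** [y] lists the interior points of a path from [t] to [u]; the endpoint is supplied by the default
    value of [nth], since index [m] is out of range in [y]. *)
Lemma kmx_path m (f : nat -> X -> X -> R) :
  \prod_(i < m.+1) kmx (f i) = kmx (fun t u =>
    \sum_(y : m.-tuple X) \prod_(i < m.+1) f i (nth u (t :: y) i) (nth u y i)).
Proof.
elim: m f => [|m IH] f.
  rewrite big_ord_recl big_ord0 mulr1; apply: eq_kmx => t u.
  rewrite (big_pred1 [tuple]) => [|y]; last by rewrite [y]tuple0; apply/esym/eqP/val_inj.
  by rewrite big_ord_recl big_ord0 mulr1.
rewrite big_ord_recl (IH (fun i => f i.+1)) kmx_mul; apply: eq_kmx => t u.
rewrite (sum_tuple_cons m (fun y => \prod_(i < m.+2) f i (nth u (t :: y) i) (nth u y i))).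
apply: eq_bigr => a _; rewrite mulr_sumr; apply: eq_bigr => y _.
by rewrite [in RHS]big_ord_recl.
Qed.

Lemma tr_kmx_cycle m (f : nat -> X -> X -> R) :
  \tr (\prod_(i < m.+1) kmx (f i)) =
  \sum_(x : {ffun 'I_m.+1 -> X}) \prod_(i < m.+1) f i (x i) (x (ordS i)).
Proof.
rewrite kmx_path tr_kmx pair_bigA /=.
pose h (p : X * m.-tuple X) : {ffun 'I_m.+1 -> X} := [ffun i : 'I_m.+1 => nth p.1 (p.1 :: p.2) i].
pose h' (x : {ffun 'I_m.+1 -> X}) := (x ord0, [tuple x (lift ord0 i) | i < m]).
rewrite [RHS](reindex h) /=.
  apply: eq_bigr => -[t y] _; apply: eq_bigr => i _; rewrite !ffunE /=.
  congr (f i _ _).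
  case: (ltngtP i m) (ltn_ord i) => [im _|mi|im _].
  - by rewrite modn_small ?ltnS.
  - by rewrite ltnS leqNgt mi.
  - by rewrite im modnn nth_default ?size_tuple.
exists h' => [[t y] _|x _]; rewrite /h /h' /=.
  congr (_, _); first by rewrite ffunE.
  apply: eq_from_tnth => i; rewrite tnth_mktuple ffunE /= (tnth_nth t) //=.
apply/ffunP => i; rewrite ffunE.
case: (unliftP ord0 i) => [j ->|->] //.
rewrite lift0 /= -[[seq _ | _ <- _]]/(tval [tuple x (lift ord0 i) | i < m]).
by rewrite -(tnth_nth _ _ j) tnth_mktuple.
Qed.

(* [(k, b)] is the site [2 k + b] of the cycle of length [2 m]. *)
Definition csite m := ('I_m * bool)%type.

Definition cyc_sum m (G : nat -> X -> X -> X -> R) :=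
  \sum_(x : {ffun csite m -> X})
    \prod_(k < m) G k (x (k, false)) (x (k, true)) (x (ordS k, false)).

Definition mid G x z := \sum_y G x y z.

(** The middle site of a block belongs to no other block and can be summed out, which leaves a
    cyclic matrix product over the shared sites. *)
Lemma cyc_sumE m (G : nat -> X -> X -> X -> R) :
  cyc_sum m.+1 G = \tr (\prod_(k < m.+1) kmx (mid (G k))).
Proof.
rewrite (tr_kmx_cycle m (fun k => mid (G k))) /cyc_sum.
under [RHS]eq_bigr => x _ do rewrite bigA_distr_bigA.
rewrite pair_bigA /=.
pose h (p : {ffun 'I_m.+1 -> X} * {ffun 'I_m.+1 -> X}) : {ffun csite m.+1 -> X} :=
  [ffun c => if c.2 then p.2 c.1 else p.1 c.1].
rewrite (reindex h) /=.
  by apply: eq_bigr => -[x y] _; apply: eq_bigr => k _; rewrite !ffunE.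
exists (fun x : {ffun csite m.+1 -> X} => ([ffun k => x (k, false)], [ffun k => x (k, true)]))
    => [[x y] _|x _].
  by congr (_, _); apply/ffunP => k; rewrite !ffunE.
by apply/ffunP => -[k []]; rewrite !ffunE.
Qed.

Definition flip G : X -> X -> X -> R := fun x y z => G z y x.

Definition alt_sum p G := cyc_sum p (fun k => if odd k then flip G else G).

(** Reading a block backwards transposes its matrix, so the alternating sum is the trace of a power
    of a Gram matrix: this is reflection positivity. *)
Lemma alt_sumE j G : (0 < j)%N -> alt_sum (2 * j) G = schatten j (kmx (mid G)).
Proof.
move=> j0; rewrite /alt_sum; have [m e] : exists m, (2 * j = m.+1)%N.
  by exists (2 * j).-1; rewrite prednK // muln_gt0.
rewrite e cyc_sumE -e /schatten; congr (\tr _).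
rewrite (prod_pairs (fun k => kmx (mid (if odd k then flip G else G)))).
under eq_bigr => l _ do rewrite oddM /= oddM /=.
by rewrite prodr_const card_ord kmx_tr.
Qed.

Lemma alt_sum_ge0 j G : (0 < j)%N -> 0 <= alt_sum (2 * j) G.
Proof. by move=> j0; rewrite alt_sumE ?schatten_ge0. Qed.

Lemma cyc_sum_le j m (G : nat -> X -> X -> X -> R) : (0 < j)%N -> (2 * j <= m)%N ->
  cyc_sum m G ^+ (2 * j) <= \prod_(k < m) alt_sum (2 * j) (G k).
Proof.
move=> j0; case: m => [|m] sm; first by move: sm j0; clear; lia.
rewrite cyc_sumE; apply: le_trans (hoelder (fun k => kmx (mid (G k))) j0 sm) _.
by apply: ler_prod => k _; rewrite schatten_ge0 alt_sumE ?lexx.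
Qed.

Lemma alt_sum_le j G : (0 < j)%N -> alt_sum (2 * j) G <= alt_sum 2 G ^+ j.
Proof. by move=> j0; rewrite alt_sumE // -[2%N in X in _ <= X]muln1 alt_sumE // schatten_le_hs. Qed.

End Cycles.

(** * The chessboard estimate *)

Definition o0 : 'I_3 := @Ordinal 3 0 isT.
Definition o1 : 'I_3 := @Ordinal 3 1 isT.
Definition o2 : 'I_3 := @Ordinal 3 2 isT.

Definition tri (T : Type) (x y z : T) (a : 'I_3) : T :=
  if a == o0 then x else if a == o1 then y else z.

(* Block [k] of the cycle consists of the sites [2 k], [2 k + 1] and [2 k + 2]. *)
Definition cyc m (k : 'I_m) (a : 'I_3) : csite m :=
  tri (k, false) (k, true) (ordS k, false) a.

(* Reading the odd blocks backwards makes neighbouring blocks mirror images of each other. *)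
Definition alt m (k : 'I_m) (a : 'I_3) : csite m :=
  if odd k then cyc k (rev_ord a) else cyc k a.

Fixpoint bsite (K C : finType) (st : K -> 'I_3 -> C) d :
    box K d -> box 'I_3 d -> box C d :=
  match d with
  | 0 => fun _ _ => tt
  | d'.+1 => fun t y => (st t.1 y.1, bsite st t.2 y.2)
  end.

Section System.
Variable R : realFieldType.

Definition sys (K C : finType) (st : K -> 'I_3 -> C) d (T : finType)
    (f : box K d -> {ffun box 'I_3 d -> T} -> R) : R :=
  \sum_(x : {ffun box C d -> T}) \prod_(t : box K d) f t [ffun y => x (bsite st t y)].

(** The first direction is moved into the alphabet: each remaining site carries a function on [C0].
    Directions can thus be treated one at a time, the others keeping the form of a [sys]. *)
Definition absorb (K0 C0 : finType) (st0 : K0 -> 'I_3 -> C0) (I : Type) d (T : finType)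
    (f : K0 -> I -> {ffun box 'I_3 d.+1 -> T} -> R) (t : I)
    (u : {ffun box 'I_3 d -> {ffun C0 -> T}}) : R :=
  \prod_(k : K0) f k t [ffun y => u y.2 (st0 k y.1)].

Lemma sys_absorb (K C : finType) (st : K -> 'I_3 -> C) d (T : finType) f :
  @sys K C st d.+1 T f = sys st (absorb st (fun k t => f (k, t))).
Proof.
rewrite /sys.
pose h (x : {ffun box C d -> {ffun C -> T}}) : {ffun box C d.+1 -> T} :=
  [ffun v => x v.2 v.1].
rewrite (reindex h) /=; last first.
  exists (fun x : {ffun box C d.+1 -> T} => [ffun v => [ffun c => x (c, v)]]) => x _.
    by apply/ffunP => v; rewrite !ffunE; apply/ffunP => c; rewrite !ffunE.
  by apply/ffunP => -[c v]; rewrite !ffunE.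
apply: eq_bigr => x _; rewrite /absorb exchange_big /= pair_bigA /=.
apply: eq_bigr => -[k t] _ /=; congr (f (k, t)).
by apply/ffunP => -[a y]; rewrite !ffunE.
Qed.

Lemma sys_ge0 (K C : finType) (st : K -> 'I_3 -> C) d (T : finType) f :
  (forall t u, 0 <= f t u) -> 0 <= @sys K C st d T f.
Proof. by move=> f0; rewrite sumr_ge0 // => x _; rewrite prodr_ge0. Qed.

Definition slab (K C : finType) (st : K -> 'I_3 -> C) d (T : finType)
    (f : box K d -> {ffun box 'I_3 d.+1 -> T} -> R) (x y z : {ffun box C d -> T}) : R :=
  \prod_(t : box K d) f t [ffun v => tri x y z v.1 (bsite st t v.2)].

Lemma sys_cyc (K C : finType) (st : K -> 'I_3 -> C) d (T : finType) m
    (f : 'I_m -> box K d -> {ffun box 'I_3 d.+1 -> T} -> R)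
    (G : nat -> {ffun box C d -> T} -> {ffun box C d -> T} -> {ffun box C d -> T} -> R) :
  (forall (k : 'I_m) x y z, G k x y z = slab st (f k) x y z) ->
  sys st (absorb (@cyc m) f) = cyc_sum m G.
Proof.
move=> GE; rewrite /sys /cyc_sum.
pose h (x : {ffun csite m -> {ffun box C d -> T}}) : {ffun box C d -> {ffun csite m -> T}} :=
  [ffun v => [ffun c => x c v]].
rewrite (reindex h) /=; last first.
  exists (fun x : {ffun box C d -> {ffun csite m -> T}} => [ffun c => [ffun v => x v c]]) => x _;
  by apply/ffunP => v; rewrite !ffunE; apply/ffunP => c; rewrite !ffunE.
apply: eq_bigr => x _; rewrite /absorb exchange_big /=.
apply: eq_bigr => k _; rewrite GE; apply: eq_bigr => t _; congr (f k t).
apply/ffunP => -[a y]; rewrite !ffunE /= /cyc /tri.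
by case: (a == o0); case: (a == o1).
Qed.

Lemma sys_alt (K C : finType) (st : K -> 'I_3 -> C) d (T : finType) p
    (f : box K d -> {ffun box 'I_3 d.+1 -> T} -> R) :
  sys st (absorb (@alt p) (fun _ => f)) = alt_sum p (slab st f).
Proof.
pose g (k : 'I_p) t (u : {ffun box 'I_3 d.+1 -> T}) :=
  if odd k then f t [ffun y => u (rev_ord y.1, y.2)] else f t u.
rewrite /alt_sum -(@sys_cyc _ _ st _ _ _ g) => [|k x y z]; last first.
  rewrite /flip /slab /g; case: (odd k) => //; apply: eq_bigr => t _; congr (f t).
  apply/ffunP => -[a v]; rewrite !ffunE /=; congr ((_ : {ffun _ -> _}) _).
  by case: a => -[|[|[|]]].
apply: eq_bigr => x _; apply: eq_bigr => t _; apply: eq_bigr => k _.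
rewrite /g /alt; case: (odd k) => //; congr (f t).
by apply/ffunP => -[a v]; rewrite !ffunE.
Qed.

Lemma sys_step (K C : finType) (st : K -> 'I_3 -> C) d (T : finType) j m
    (f : 'I_m -> box K d -> {ffun box 'I_3 d.+1 -> T} -> R) : (0 < j)%N -> (2 * j <= m)%N ->
  sys st (absorb (@cyc m) f) ^+ (2 * j) <=
  \prod_(k < m) sys st (absorb (@alt (2 * j)) (fun _ => f k)).
Proof.
move=> j0 sm.
pose G (k : nat) : {ffun box C d -> T} -> {ffun box C d -> T} -> {ffun box C d -> T} -> R :=
  if insub k is Some i then slab st (f i) else fun _ _ _ => 0.
have GE (k : 'I_m) : G k = slab st (f k) by rewrite /G valK.
rewrite (sys_cyc (G := G)) => [|k x y z]; last by rewrite GE.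
apply: le_trans (cyc_sum_le _ j0 sm) _; apply: ler_prod => k _.
by rewrite GE sys_alt alt_sum_ge0 ?lexx.
Qed.

(** Hölder's inequality in the first direction separates the blocks [k], each of them repeated with
    alternating reflections; the other directions follow by induction, applied to the alphabet that
    has absorbed the first one. Only the exponent [2 * j] is even, [m] may be odd. *)
Lemma chessboard j m d (T : finType) (f : box 'I_m d -> {ffun box 'I_3 d -> T} -> R) :
  (0 < j)%N -> (2 * j <= m)%N -> (forall t u, 0 <= f t u) ->
  sys (@cyc m) f ^+ ((2 * j) ^ d) <=
  \prod_t sys (@alt (2 * j)) (fun _ => f t).
Proof.
move=> j0 sm; set p := (2 * j)%N; elim: d T f => [|d IH] T f f0.
  rewrite expn0 expr1 (big_pred1 tt) => [|[]] //.
  rewrite le_eqVlt; apply/orP; left; apply/eqP; apply: eq_bigr => x _.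
  by apply: eq_bigr => -[] _.
rewrite sys_absorb expnS exprM.
set g := absorb _ _.
apply: le_trans (_ : (\prod_(k < m) sys (@cyc m)
    (absorb (@alt p) (fun _ t => f (k, t)))) ^+ (p ^ d) <= _).
  rewrite lerXn2r ?nnegrE //.
  - by rewrite /p exprM exprn_ge0 // sqr_ge0.
  - by rewrite prodr_ge0 // => k _; rewrite sys_ge0 // => t u; rewrite prodr_ge0.
  - exact: sys_step.
rewrite -prodrXl.
have -> : \prod_(t : box 'I_m d.+1) sys (@alt p) (fun _ => f t) =
  \prod_(k < m) \prod_(t : box 'I_m d) sys (@alt p) (fun _ => absorb (@alt p) (fun _ t => f (k, t)) t).
  rewrite pair_bigA /=; apply: eq_bigr => -[k t] _ /=.
  by rewrite sys_absorb.
apply: ler_prod => k _; apply/andP; split.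
  by rewrite exprn_ge0 // sys_ge0 // => t u; rewrite prodr_ge0.
by apply: IH => t u; rewrite prodr_ge0.
Qed.

(** [alt_sum_le] in every direction reduces [2 * j] alternating blocks to two, that is, to the torus
    of side 4. *)
Lemma sys_alt_le j d (T : finType) (f : {ffun box 'I_3 d -> T} -> R) : (0 < j)%N ->
  (forall u, 0 <= f u) ->
  sys (@alt (2 * j)) (fun _ : box _ d => f) <=
  sys (@alt 2) (fun _ : box _ d => f) ^+ (j ^ d).
Proof.
move=> j0; elim: d T f => [|d IH] T f f0.
  rewrite expn0 expr1 le_eqVlt; apply/orP; left; apply/eqP; apply: eq_bigr => x _.
  by apply: eq_bigr => -[] _.
rewrite sys_absorb [X in _ <= X ^+ _]sys_absorb.
apply: le_trans (_ : sys (@alt (2 * j)) (absorb (@alt 2) (fun _ (_ : box _ d) => f)) ^+ j <= _).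
  rewrite 2!(sys_alt _ _ (fun _ : box 'I_(2 * j) d => f)).
  exact: alt_sum_le.
rewrite (expnSr j d) exprM lerXn2r ?nnegrE ?exprn_ge0 ?sys_ge0 //.
- by move=> t u; rewrite prodr_ge0.
- by move=> t u; rewrite prodr_ge0.
by apply: IH => u; rewrite prodr_ge0.
Qed.

End System.

(** * Comparing partition functions of tori of different sizes *)

Lemma convex_chord (R : realFieldType) (b : nat -> R) :
  (forall k, b k.+1 *+ 2 <= b k + b k.+2) ->
  forall p m, (p <= m)%N -> m%:R * b p <= (m - p)%:R * b 0%N + p%:R * b m.
Proof.
move=> cvx.
have A k : k.+1%:R * b k <= k%:R * b k.+1 + b 0%N.
  elim: k => [|k IH]; first by rewrite !mul1r mul0r add0r.
  have := cvx k; rewrite -!(natr1 k.+1) -!(natr1 k) mulr2n => c.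
  rewrite -(natr1 k) in IH.
  have : k.+1%:R * (b k.+1 + b k.+1) <= k.+1%:R * (b k + b k.+2) by rewrite ler_wpM2l ?ler0n.
  rewrite -(natr1 k); have := ler0n R k; nra.
move=> p m pm; rewrite -(subnKC pm); elim: (m - p)%N => [|j IH].
  by rewrite addn0 subnn mul0r add0r.
move: IH; rewrite addnS !addKn subSn ?leq_addr // addKn; set q := (p + j)%N => IH.
case: (posnP q) => q0.
  have [-> ->] : p = 0%N /\ j = 0%N by rewrite /q in q0; lia.
  by rewrite q0 mul0r addr0.
have := A q; have := ler0n R p; have := ler0n R j.
have qE : q%:R = p%:R + j%:R :> R by rewrite /q natrD.
have q0' : 0 < q%:R :> R by rewrite ltr0n.
rewrite -(natr1 q) -(natr1 j) => j0 p0 Aq.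
rewrite -(ler_pM2l q0').
have h1 : (q%:R + 1) * (q%:R * b p) <= (q%:R + 1) * (j%:R * b 0%N + p%:R * b q).
  by rewrite ler_wpM2l // addr_ge0 // ltW.
have h2 : p%:R * ((q%:R + 1) * b q) <= p%:R * (q%:R * b q.+1 + b 0%N) by rewrite ler_wpM2l.
by rewrite qE in h1 h2 q0' *; nra.
Qed.

(** The chord between [2] and [m], divided by [p]: the coefficient of [b m] is at most [1 / m], and
    that of [b 2] is [(m - p) / (p * (m - 2))], bounded by [kap]. *)
Lemma convex_average (R : realFieldType) (b : nat -> R) (p m : nat) (kap : R) :
  (forall k, (1 < k)%N -> b k.+1 *+ 2 <= b k + b k.+2) ->
  (forall k, (1 < k)%N -> 0 <= b k) -> (1 < p)%N -> (p <= m)%N ->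
  m%:R - p%:R <= kap * (p%:R * (m%:R - 2)) -> 0 <= kap ->
  b p / p%:R <= b m / m%:R + kap * b 2%N.
Proof.
move=> cvx b0 p1 pm hk k0.
have m1 : (1 < m)%N by apply: leq_trans pm.
have p0 : 0 < p%:R :> R by rewrite ltr0n ltnW.
have m0 : 0 < m%:R :> R by rewrite ltr0n ltnW.
have ch : (m%:R - 2) * b p <= (m%:R - p%:R) * b 2%N + (p%:R - 2) * b m.
  move: p1 m1 pm {p0 m0 hk}; case: p => [|[|p]] // _; case: m => [|[|m]] // _ pm.
  have := @convex_chord R (fun k => b k.+2) (fun k => cvx k.+2 isT) p m pm.
  rewrite -(addn2 p) -(addn2 m) !natrD (natrB _ (_ : (p <= m)%N)) //.
  by rewrite /= !addrK opprD addrACA subrr addr0 !addn2.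
have bm := b0 _ m1; have b2 := b0 2%N isT.
case: (leqP m 2) => m2.
  have -> : p = 2%N by apply/eqP; rewrite eqn_leq p1 andbT (leq_trans pm).
  have -> : m = 2%N by apply/eqP; rewrite eqn_leq m2.
  by rewrite lerDl mulr_ge0.
have pm' : p%:R <= m%:R :> R by rewrite ler_nat.
have m3 : 0 < m%:R - 2 :> R by rewrite subr_gt0 ltr_nat.
rewrite -(ler_pM2r p0) mulrDl mulfVK ?gt_eqF // -(ler_pM2r m0) mulrDl.
rewrite (_ : b m / m%:R * p%:R * m%:R = p%:R * b m); last by field; rewrite gt_eqF.
rewrite -(ler_pM2l m3).
have h1 : m%:R * ((m%:R - 2) * b p) <= m%:R * ((m%:R - p%:R) * b 2%N + (p%:R - 2) * b m).
  by rewrite ler_pM2l.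
have h2 : m%:R * ((m%:R - p%:R) * b 2%N) <= m%:R * (kap * (p%:R * (m%:R - 2)) * b 2%N).
  by rewrite ler_pM2l // ler_wpM2r.
have x1 : 0 <= b m * (m%:R - p%:R) by rewrite mulr_ge0 // subr_ge0.
by move: h1 h2 x1; clear; lra.
Qed.

Definition path3 : rel 'I_3 := fun a b => (a.+1 == b) || (b.+1 == a).

(** * Homomorphism counts on tori *)

Section Homs.
Variable R : realType.

Section Defs.
Variables (T : finType) (w : pred T) (h : rel T).

Definition hom_on (V : finType) (e : rel V) (u : {ffun V -> T}) : bool :=
  [forall y, w (u y)] && [forall y, forall y', e y y' ==> h (u y) (u y')].

Definition block_hom d (u : {ffun box 'I_3 d -> T}) : bool := hom_on (@box_adj 'I_3 path3 d) u.

Definition hom_sys (K C : finType) (st : K -> 'I_3 -> C) d : R :=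
  sys st (fun (_ : box K d) u => (block_hom u)%:R).

Definition cube_homs d := #|[set u | hom_on (@cube_adj d) u]|.

Variables (K0 C0 : finType) (st0 : K0 -> 'I_3 -> C0).

(** [wabs] and [habs] form an exponential graph: its letters are homomorphisms from the absorbed
    direction, adjacent if they are so at every site. By [hom_sysS] an induction on the dimension
    changes only the target, which is why targets are kept general. *)
Definition wabs (x : {ffun C0 -> T}) : bool :=
  [forall k, hom_on path3 [ffun a => x (st0 k a)]].

Definition habs (x y : {ffun C0 -> T}) : bool :=
  [forall k, forall a, h (x (st0 k a)) (y (st0 k a))].

End Defs.

Lemma hom_onP (T : finType) (w : pred T) (h : rel T) (V : finType) (e : rel V) (u : {ffun V -> T}) :
  reflect ((forall y, w (u y)) /\ (forall y y', e y y' -> h (u y) (u y')))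
          (@hom_on T w h V e u).
Proof.
apply: (iffP andP) => -[h1 h2]; split.
- exact/forallP.
- by move=> y y' yy'; have /forallP/(_ y)/forallP/(_ y')/implyP := h2; apply.
- exact/forallP.
- by apply/forallP => y; apply/forallP => y'; apply/implyP; apply: h2.
Qed.

Lemma prod_bool (I : finType) (P : pred I) :
  \prod_(i : I) (P i)%:R = [forall i, P i]%:R :> R.
Proof.
case: forallP => [h|/forallP]; first by rewrite big1 // => i _; rewrite h.
rewrite negb_forall => /existsP [i /negbTE Pi].
by rewrite (bigD1 i) //= Pi mul0r.
Qed.

Lemma absorb_hom (T : finType) (w : pred T) (h : rel T) (K0 C0 : finType)
    (st0 : K0 -> 'I_3 -> C0) (I : Type) d (t : I) u :
  absorb st0 (fun _ _ v => (@block_hom T w h d.+1 v)%:R) t u =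
  (block_hom (wabs w h st0) (habs h st0) u)%:R :> R.
Proof.
rewrite /absorb prod_bool; congr (nat_of_bool _)%:R.
apply/forallP/hom_onP => [H|[H1 H2] k].
  split=> [y|y y' yy'].
    apply/forallP => k; apply/hom_onP; split=> [a|a a' aa'].
      by have /hom_onP[/(_ (a, y)) + _] := H k; rewrite !ffunE.
    have /hom_onP[_ /(_ (a, y) (a', y))] := H k; rewrite !ffunE /= aa' eqxx.
    exact.
  apply/forallP => k; apply/forallP => a.
  have /hom_onP[_ /(_ (a, y) (a, y'))] := H k; rewrite !ffunE /= eqxx yy' orbT.
  exact.
apply/hom_onP; split=> [[a y]|[a y] [a' y']].
  by have /forallP/(_ k)/hom_onP[/(_ a) + _] := H1 y; rewrite !ffunE.
rewrite /= !ffunE /= => /orP[/andP[aa' /eqP <-]|/andP[/eqP <- yy']].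
  by have /forallP/(_ k)/hom_onP[_ /(_ a a' aa')] := H1 y; rewrite !ffunE.
by have /forallP/(_ k)/forallP/(_ a) := H2 y y' yy'.
Qed.

Lemma hom_sysS (T : finType) (w : pred T) (h : rel T) (K C : finType)
    (st : K -> 'I_3 -> C) d :
  hom_sys w h st d.+1 = hom_sys (wabs w h st) (habs h st) st d.
Proof.
rewrite /hom_sys sys_absorb; apply: eq_bigr => x _; apply: eq_bigr => t _.
exact: absorb_hom.
Qed.

Lemma habs_sym (T : finType) (h : rel T) (K0 C0 : finType) (st0 : K0 -> 'I_3 -> C0) :
  symmetric h -> symmetric (habs h st0).
Proof.
by move=> hs x y; apply: eq_forallb => k; apply: eq_forallb => a; rewrite hs.
Qed.

Lemma hom_sys_ge0 (T : finType) (w : pred T) (h : rel T) (K C : finType)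
    (st : K -> 'I_3 -> C) d : 0 <= hom_sys w h st d.
Proof. by apply: sys_ge0 => t u; rewrite ler0n. Qed.

Lemma eq_hom_sys (T : finType) (w w' : pred T) (h h' : rel T) (K C : finType)
    (st : K -> 'I_3 -> C) d : w =1 w' -> h =2 h' -> hom_sys w h st d = hom_sys w' h' st d.
Proof.
move=> ww hh; apply: eq_bigr => x _; apply: eq_bigr => t _; congr (nat_of_bool _)%:R.
congr (_ && _); first by apply: eq_forallb => y.
by apply: eq_forallb => y; apply: eq_forallb => y'; rewrite hh.
Qed.

Lemma path3_sym : symmetric path3.
Proof. by move=> a b; rewrite /path3 orbC. Qed.

Lemma path3_rev a b : path3 (rev_ord a) (rev_ord b) = path3 a b.
Proof. by case: a => -[|[|[|]]] // ?; case: b => -[|[|[|]]]. Qed.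

Lemma wabs_alt (T : finType) (w : pred T) (h : rel T) p :
  wabs w h (@alt p) =1 wabs w h (@cyc p).
Proof.
move=> x; apply: eq_forallb => k; rewrite /alt.
case: (odd k) => //; apply/hom_onP/hom_onP => -[h1 h2]; split=> [y|y y' yy'].
- by have := h1 (rev_ord y); rewrite !ffunE rev_ordK.
- by have := h2 (rev_ord y) (rev_ord y'); rewrite !ffunE !rev_ordK path3_rev; apply.
- by have := h1 (rev_ord y); rewrite !ffunE.
- by have := h2 (rev_ord y) (rev_ord y'); rewrite !ffunE path3_rev; apply.
Qed.

Lemma habs_alt (T : finType) (h : rel T) p : habs h (@alt p) =2 habs h (@cyc p).
Proof.
move=> x y; apply: eq_forallb => k; rewrite /alt.
case: (odd k) => //; apply/forallP/forallP => H a; last exact: H.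
by have := H (rev_ord a); rewrite rev_ordK.
Qed.

Lemma hom_sys_alt d (T : finType) (w : pred T) (h : rel T) p :
  hom_sys w h (@alt p) d = hom_sys w h (@cyc p) d.
Proof.
elim: d T w h => [|d IH] T w h; last first.
  rewrite !hom_sysS IH; apply: eq_hom_sys; [exact: wabs_alt|exact: habs_alt].
by apply: eq_bigr => x _; apply: eq_bigr => -[] _.
Qed.

Section Transfer.
Variables (T : finType) (w : pred T) (h : rel T) (K C : finType)
  (st : K -> 'I_3 -> C) (d : nat).
Hypothesis h_sym : symmetric h.

Definition stage k := hom_sys (wabs w h (@cyc k)) (habs h (@cyc k)) st d.

Definition layer_adj (x y : {ffun box C d -> T}) : bool :=
  [forall t, [&& block_hom w h [ffun v => x (bsite st t v)],
                 block_hom w h [ffun v => y (bsite st t v)] &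
                 [forall v, h (x (bsite st t v)) (y (bsite st t v))]]].

Lemma layer_adj_sym : symmetric layer_adj.
Proof.
move=> x y; apply: eq_forallb => t; rewrite andbCA; congr [&& _, _ & _].
by apply: eq_forallb => v; rewrite h_sym.
Qed.

Let B : 'M[R]_#|{ffun box C d -> T}| := kmx (fun x y => (layer_adj x y)%:R).

Lemma slab_layer (x y z : {ffun box C d -> T}) :
  slab st (fun _ v => (@block_hom T w h d.+1 v)%:R) x y z =
  (layer_adj x y)%:R * (layer_adj y z)%:R :> R.
Proof.
rewrite -natrM mulnb /slab prod_bool; congr (nat_of_bool _)%:R.
apply/forallP/andP => [H|[/forallP Hxy /forallP Hyz] t].
  have sub a t : block_hom w h [ffun v => tri x y z a (bsite st t v)].
    apply/hom_onP; have /hom_onP[H1 H2] := H t; split=> [v|v v' vv'].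
      by have := H1 (a, v); rewrite !ffunE.
    have := H2 (a, v) (a, v'); rewrite !ffunE /= eqxx vv' orbT; exact.
  have edge a a' t v : path3 a a' -> h (tri x y z a (bsite st t v)) (tri x y z a' (bsite st t v)).
    have /hom_onP[_ H2] := H t => aa'.
    by have := H2 (a, v) (a', v); rewrite !ffunE /= aa' eqxx; apply.
  split; apply/forallP => t; apply/and3P; split.
  - exact: (sub o0).
  - exact: (sub o1).
  - by apply/forallP => v; apply: (edge o0 o1).
  - exact: (sub o1).
  - exact: (sub o2).
  - by apply/forallP => v; apply: (edge o1 o2).
have /and3P[bx by_ /forallP exy] := Hxy t; have /and3P[_ bz /forallP eyz] := Hyz t.
have sub a : block_hom w h [ffun v => tri x y z a (bsite st t v)].
  by rewrite /tri; case: (a == o0); case: (a == o1).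
apply/hom_onP; split=> [[a v]|[a v] [a' v']].
  by have /hom_onP[/(_ v) + _] := sub a; rewrite !ffunE.
rewrite /= !ffunE /= => /orP[/andP[aa' /eqP <-]|/andP[/eqP <- vv']]; last first.
  by have /hom_onP[_ /(_ v v' vv')] := sub a; rewrite !ffunE.
have hyx : h (y (bsite st t v)) (x (bsite st t v)) by rewrite h_sym.
have hzy : h (z (bsite st t v)) (y (bsite st t v)) by rewrite h_sym.
by case: a aa' {sub} => -[|[|[|]]] // ?; case: a' => -[|[|[|]]].
Qed.

Lemma stageE k : (0 < k)%N -> stage k = \tr (B ^+ (2 * k)).
Proof.
case: k => // k _.
transitivity (sys st (absorb (@cyc k.+1) (fun _ _ v => (@block_hom T w h d.+1 v)%:R)) : R).
  by apply: eq_bigr => x _; apply: eq_bigr => t _; rewrite absorb_hom.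
rewrite (@sys_cyc _ _ _ st _ _ _ _ (fun _ => slab st (fun _ v => (@block_hom T w h d.+1 v)%:R))) //.
rewrite cyc_sumE prodr_const card_ord exprM expr2 kmx_mul; congr (\tr (_ ^+ _)).
apply: eq_kmx => x z; apply: eq_bigr => y _; exact: slab_layer.
Qed.

(** Cauchy-Schwarz for the trace of [B ^+ k * B ^+ k.+2], where [B] is the symmetric transfer matrix
    between adjacent layers. *)
Lemma stage_logconvex k : (0 < k)%N -> stage k.+1 ^+ 2 <= stage k * stage k.+2.
Proof.
move=> k0; rewrite !stageE //.
have Bt : B^T = B by rewrite kmx_tr; apply: eq_kmx => x y; rewrite layer_adj_sym.
have -> : B ^+ (2 * k.+1) = B ^+ k * B ^+ k.+2 by rewrite -exprD; congr (_ ^+ _); lia.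
apply: le_trans (tr_mul_sqr _ _) _.
by rewrite !trmx_exp Bt -!exprD !addnn -!mul2n.
Qed.

End Transfer.

Lemma hom_sys0 (T : finType) (w : pred T) (h : rel T) (K C : finType) (st : K -> 'I_3 -> C) :
  hom_sys w h st 0 = #|[set a | w a]|%:R.
Proof.
rewrite -sum1_card natr_sum /hom_sys /sys.
rewrite (reindex (fun a : T => [ffun _ : box C 0 => a])) /=; last first.
  exists (fun x : {ffun box C 0 -> T} => x tt) => x _; first by rewrite ffunE.
  by apply/ffunP => -[]; rewrite ffunE.
rewrite [RHS]big_mkcond /=; apply: eq_bigr => a _.
rewrite (big_pred1 (tt : box K 0)) => [|[]] //; rewrite inE.
rewrite (_ : block_hom _ _ _ = w a); first by case: (w a).
apply/hom_onP/idP => [[/(_ tt) + _]|wa]; first by rewrite !ffunE.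
by split=> [y|[] []] //; rewrite !ffunE.
Qed.

(** Choosing letters from [S b] according to the parity of the site always gives a homomorphism;
    these ground states yield [hom_sys_lower]. *)
Definition biclique (T : finType) (w : pred T) (h : rel T) (S : bool -> {set T}) :=
  (forall b a, a \in S b -> w a) /\
  (forall b a a', a \in S b -> a' \in S (~~ b) -> h a a').

Definition lift_set (T : finType) (S : bool -> {set T}) k (b : bool) :
    {set {ffun csite k -> T}} := 
  [set x : {ffun csite k -> T} | [forall c : csite k, x c \in S (b (+) c.2)]].

Lemma cyc_parity m (k : 'I_m) a a' : path3 a a' -> (cyc k a').2 = ~~ (cyc k a).2.
Proof. by case: a => -[|[|[|]]] // ?; case: a' => -[|[|[|]]]. Qed.

Lemma biclique_lift (T : finType) (w : pred T) (h : rel T) S k : biclique w h S ->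
  biclique (wabs w h (@cyc k)) (habs h (@cyc k)) (lift_set S k).
Proof.
move=> [Sw Sh]; split=> [b x|b x y]; rewrite inE => /forallP xS.
  apply/forallP => j; apply/hom_onP; split=> [a|a a' aa']; rewrite !ffunE.
    exact: Sw (xS _).
  apply: Sh (xS _) _; have := xS (cyc j a'); rewrite (cyc_parity _ aa').
  by rewrite addbN.
rewrite inE => /forallP yS; apply/forallP => j; apply/forallP => a.
by apply: Sh (xS _) _; have := yS (cyc j a); rewrite addNb.
Qed.

Lemma card_lift_set (T : finType) (S : bool -> {set T}) k b :
  #|lift_set S k b| = ((#|S true| * #|S false|) ^ k)%N.
Proof.
transitivity (\sum_(x : {ffun csite k -> T}) \prod_(c : csite k) (x c \in S (b (+) c.2) : nat))%N.
  rewrite -sum1_card big_mkcond /=; apply: eq_bigr => x _; rewrite inE.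
  case: forallP => [H|/forallP]; first by rewrite big1 // => c _; rewrite H.
  rewrite negb_forall => /existsP[c /negbTE xc].
  by rewrite (bigD1 c) //= xc.
rewrite -(bigA_distr_bigA (fun (c : csite k) a => (a \in S (b (+) c.2) : nat))) /=.
rewrite -(pair_bigA _ (fun (i : 'I_k) (j : bool) => \sum_a (a \in S (b (+) j) : nat)))%N /=.
have cS j : (\sum_a (a \in S j : nat) = #|S j|)%N.
  by rewrite -sum1_card [RHS]big_mkcond /=; apply: eq_bigr => a _; case: (a \in _).
rewrite (eq_bigr (fun _ => #|S true| * #|S false|)%N) ?prod_nat_const ?card_ord // => i _.
by rewrite big_bool !cS; case: (b); rewrite //= mulnC.
Qed.

(** The square avoids halving the number of sites, which is odd in dimension [0]. *)
Lemma hom_sys_lower m d (T : finType) (w : pred T) (h : rel T) S : biclique w h S ->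
  ((#|S true| * #|S false|) ^ ((2 * m) ^ d))%:R <= hom_sys w h (@cyc m) d ^+ 2.
Proof.
elim: d T w h S => [|d IH] T w h S SB.
  rewrite hom_sys0 expn0 expn1 -natrX ler_nat expnS expn1.
  by apply: leq_mul; apply: subset_leq_card; apply/subsetP => a; rewrite inE; apply: SB.1.
rewrite hom_sysS; apply: le_trans (IH _ _ _ _ (biclique_lift m SB)).
by rewrite !card_lift_set -expnD addnn -mul2n -!expnM -expnS.
Qed.

(** Only [k] disjoint edges of the cycle of length [2 * k] are kept; each of them, times the cube of
    dimension [d], is a cube of dimension [d.+1]. *)
Lemma cube_homs_lift (T : finType) (w : pred T) (h : rel T) k d :
  (cube_homs (wabs w h (@cyc k)) (habs h (@cyc k)) d <= cube_homs w h d.+1 ^ k)%N.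
Proof.
rewrite /cube_homs.
set A := [set u | _]; set B := [set u | _].
have -> : (#|B| ^ k = #|[set x : {ffun 'I_k -> _} | [forall j, x j \in B]]|)%N.
  rewrite -[k in LHS]card_ord -card_ffun_on; apply: eq_card => x; rewrite inE.
  by apply/ffun_onP/forallP.
pose F (u : {ffun box bool d -> {ffun csite k -> T}}) : {ffun 'I_k -> {ffun box bool d.+1 -> T}} :=
  [ffun j => [ffun v => u v.2 (j, v.1)]].
have Finj : injective F.
  move=> u u' /ffunP uu; apply/ffunP => v; apply/ffunP => -[j b].
  by have := uu j; rewrite !ffunE => /ffunP/(_ (b, v)); rewrite !ffunE.
rewrite -(card_imset _ Finj); apply: subset_leq_card; apply/subsetP => _ /imsetP[u uA ->].
rewrite inE; apply/forallP => j; rewrite inE ffunE.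
move: uA; rewrite inE => /hom_onP[H1 H2].
apply/hom_onP; split=> [[b v]|[b v] [b' v']].
  have /forallP/(_ j)/hom_onP[H3 _] := H1 v.
  have := H3 (if b then o1 else o0); rewrite !ffunE /=.
  by case: (b).
rewrite !ffunE /cube_adj /= => /orP[/andP[bb /eqP <-]|/andP[/eqP <- vv']].
  have /forallP/(_ j)/hom_onP[_ H3] := H1 v.
  have := H3 (if b then o1 else o0) (if b' then o1 else o0).
  by rewrite !ffunE; case: b bb => [] bb; case: b' bb => [] // _; apply.
have /forallP/(_ j)/forallP/(_ (if b then o1 else o0)) := H2 v v' vv'.
by case: (b).
Qed.

Lemma hom_sys_upper m d (T : finType) (w : pred T) (h : rel T) :
  hom_sys w h (@cyc m) d <= (cube_homs w h d ^ (m ^ d))%:R.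
Proof.
elim: d T w h => [|d IH] T w h.
  rewrite hom_sys0 expn0 expn1 ler_nat.
  rewrite -(card_imset _ (_ : injective (fun a : T => [ffun _ : box bool 0 => a]))).
    apply: subset_leq_card; apply/subsetP => _ /imsetP[a aw ->].
    rewrite inE; apply/hom_onP; split=> // y; rewrite ffunE; by rewrite inE in aw.
  by move=> a b /ffunP/(_ tt); rewrite !ffunE.
rewrite hom_sysS; apply: le_trans (IH _ _ _) _.
rewrite ler_nat [(m ^ d.+1)%N]expnS expnM.
case: (posnP (m ^ d)%N) => [->|md]; first by rewrite !expn0.
by rewrite leq_exp2r // cube_homs_lift.
Qed.

Lemma ln_hom_sys_lower m d (T : finType) (w : pred T) (h : rel T) S (lam : R) :
  biclique w h S -> (#|S true| * #|S false|)%:R = expR (2 * lam) ->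
  0 < hom_sys w h (@cyc m) d /\ lam * (2 * m%:R) ^+ d <= ln (hom_sys w h (@cyc m) d).
Proof.
move=> SB se; have := hom_sys_lower m d SB; rewrite natrX se -expRM_natl => le.
set Z := hom_sys _ _ _ _ in le *.
have Z0 : 0 < Z.
  rewrite lt_neqAle hom_sys_ge0 andbT; apply/eqP => Z0.
  by move: le; rewrite -Z0 expr0n /= leNgt expR_gt0.
split=> //; rewrite -(lnK Z0) -expRM_natl ler_expR in le.
by move: le; rewrite natrX natrM; lra.
Qed.

(** The directions are changed one at a time. The excess [b k] of the logarithm over the biclique
    bound is nonnegative, convex by [stage_logconvex], and at [k = 2] at most [2 * mu * m ^ d] by
    [hom_sys_upper]; so [convex_average] costs [2 * mu * kap] per direction. *)
Lemma hom_sys_compare d p m (T : finType) (w : pred T) (h : rel T) S (lam mu kap : R) :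
  (1 < p)%N -> (p <= m)%N ->
  m%:R - p%:R <= kap * (p%:R * (m%:R - 2)) -> 0 <= kap -> symmetric h -> biclique w h S ->
  (#|S true| * #|S false|)%:R = expR (2 * lam) -> 0 <= mu ->
  (cube_homs w h d)%:R <= expR (lam * 2 ^+ d + mu) ->
  ln (hom_sys w h (@cyc p) d) / p%:R ^+ d <=
  ln (hom_sys w h (@cyc m) d) / m%:R ^+ d + 2 * d%:R * mu * kap.
Proof.
move=> p1 pm hk k0; have p0 : 0 < p%:R :> R by rewrite ltr0n ltnW.
have m0 : 0 < m%:R :> R by rewrite ltr0n (leq_trans _ pm) // ltnW.
elim: d T w h S lam mu => [|d IH] T w h S lam mu hs SB se mu0 cub.
  by rewrite !hom_sys0 mulr0 !mul0r addr0.
pose a k := stage w h (@cyc m) d k.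
have aE k : a k = hom_sys (wabs w h (@cyc k)) (habs h (@cyc k)) (@cyc m) d by [].
have lS k : (#|lift_set S k true| * #|lift_set S k false|)%:R = expR (2 * (lam * (2 * k%:R))).
  rewrite !card_lift_set -expnD natrX se -expRM_natl natrD; congr expR; ring.
have low k := ln_hom_sys_lower m d (biclique_lift k SB) (lS k).
have cubk k : (cube_homs (wabs w h (@cyc k)) (habs h (@cyc k)) d)%:R <=
    expR (lam * (2 * k%:R) * 2 ^+ d + k%:R * mu).
  apply: le_trans (_ : (cube_homs w h d.+1 ^ k)%:R <= _).
    by rewrite ler_nat cube_homs_lift.
  rewrite natrX; apply: le_trans (_ : expR (lam * 2 ^+ d.+1 + mu) ^+ k <= _).
    by rewrite lerXn2r // nnegrE ?ler0n ?expR_ge0.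
  by rewrite -expRM_natl ler_expR le_eqVlt exprS; apply/orP; left; apply/eqP; ring.
pose b k := ln (a k) - lam * (2 * k%:R) * (2 * m%:R) ^+ d.
have b0 k : (1 < k)%N -> 0 <= b k by rewrite /b subr_ge0 aE => _; apply: (low k).2.
have bc k : (1 < k)%N -> b k.+1 *+ 2 <= b k + b k.+2.
  move=> k1; have := stage_logconvex w (@cyc m) d hs (ltnW k1).
  have [a0 _] := low k; have [a1 _] := low k.+1; have [a2 _] := low k.+2.
  rewrite -!aE in a0 a1 a2; rewrite -/(a k) -/(a k.+1) -/(a k.+2) => lc.
  have : ln (a k.+1 ^+ 2) <= ln (a k * a k.+2).
    by rewrite ler_ln ?posrE ?exprn_gt0 ?mulr_gt0.
  rewrite lnXn // lnM ?posrE // /b -!(natr1 k.+1) -(natr1 k) !mulr2n.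
  by clear; lra.
have avg := convex_average bc b0 p1 pm hk k0.
have b2 : b 2%N <= 2 * mu * m%:R ^+ d.
  have [a2 _] := low 2%N; rewrite -aE in a2.
  have : ln (a 2%N) <= (m%:R ^+ d) * (lam * (2 * 2) * 2 ^+ d + 2 * mu).
    rewrite -ler_expR lnK ?posrE // aE; apply: le_trans (hom_sys_upper _ _ _ _) _.
    rewrite natrX -(natrX _ m d) expRM_natl lerXn2r ?nnegrE ?ler0n ?expR_ge0 //; exact: cubk.
  by rewrite /b exprMn; clear; lra.
have step : ln (a p) / p%:R <= ln (a m) / m%:R + kap * (2 * mu * m%:R ^+ d).
  have : kap * b 2%N <= kap * (2 * mu * m%:R ^+ d) by rewrite ler_wpM2l.
  have bE k : 0 < k%:R :> R -> b k / k%:R = ln (a k) / k%:R - 2 * lam * (2 * m%:R) ^+ d.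
    by move=> k0'; rewrite /b; field; rewrite gt_eqF.
  by move: avg; rewrite !bE //; clear; lra.
have pmu : 0 <= p%:R * mu by rewrite mulr_ge0 // ltW.
have := IH _ _ _ _ _ _ (habs_sym (@cyc p) hs) (biclique_lift p SB) (lS p) pmu (cubk p).
rewrite !hom_sysS -aE -/(a m).
set Z := ln (hom_sys _ _ (@cyc p) d).
have md : 0 < m%:R ^+ d :> R by rewrite exprn_gt0.
have pd : 0 < p%:R ^+ d :> R by rewrite exprn_gt0.
move=> ih; rewrite !exprSr !invfM !mulrA.
apply: le_trans (_ : (ln (a p) / m%:R ^+ d + 2 * d%:R * (p%:R * mu) * kap) / p%:R <= _).
  by rewrite ler_pM2r ?invr_gt0.
have : ln (a p) / p%:R / m%:R ^+ d <= (ln (a m) / m%:R + kap * (2 * mu * m%:R ^+ d)) / m%:R ^+ d.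
  by rewrite ler_pM2r ?invr_gt0.
have -> : (ln (a m) / m%:R + kap * (2 * mu * m%:R ^+ d)) / m%:R ^+ d =
   ln (a m) / m%:R ^+ d / m%:R + 2 * mu * kap.
  by field; rewrite !gt_eqF.
have -> : (ln (a p) / m%:R ^+ d + 2 * d%:R * (p%:R * mu) * kap) / p%:R =
   ln (a p) / p%:R / m%:R ^+ d + 2 * d%:R * mu * kap.
  by field; rewrite !gt_eqF.
rewrite -(natr1 d); move: (ln (a p) / p%:R / _) (ln (a m) / _ / _) => u v.
by clear; lra.
Qed.

End Homs.

(** * Percolation of phases in a grid *)

Section Lines.
Variables d : nat.

Definition grid m := {ffun 'I_d.+1 -> 'I_m}.
Definition lines m := {ffun 'I_d -> 'I_m}.

Definition point m (i : 'I_d.+1) (l : lines m) (a : 'I_m) : grid m :=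
  [ffun j => if unlift i j is Some j' then l j' else a].
Definition line_of m (i : 'I_d.+1) (t : grid m) : lines m := [ffun j => t (lift i j)].

Lemma point_line m i (t : grid m) : point i (line_of i t) (t i) = t.
Proof.
by apply/ffunP => j; rewrite ffunE; case: unliftP => [j' ->|->] //; rewrite ffunE.
Qed.

Lemma line_point m i (l : lines m) a : line_of i (point i l a) = l.
Proof. by apply/ffunP => j; rewrite !ffunE liftK. Qed.

Lemma point_at m i (l : lines m) a : point i l a i = a.
Proof. by rewrite ffunE unlift_none. Qed.

Definition consistent m (B : {set grid m}) (ph : grid m -> bool) :=
  forall i (l : lines m) (a a' : 'I_m), a.+1 = a' :> nat ->
    point i l a \notin B -> point i l a' \notin B -> ph (point i l a) = ph (point i l a').

Definition bad_lines m (B : {set grid m}) i : {set lines m} :=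
  [set l | [exists a, point i l a \in B]].

Definition phase_set m (B : {set grid m}) (ph : grid m -> bool) b : {set grid m} :=
  [set t | (t \notin B) && (ph t == b)].

Lemma chain m (B : {set grid m}) ph i l (x y : 'I_m) : consistent B ph -> (x <= y)%N ->
  (forall z : 'I_m, (x <= z <= y)%N -> point i l z \notin B) ->
  ph (point i l x) = ph (point i l y).
Proof.
move=> con; case: y => y ym /=; elim: y ym => [|y IH] ym xy H.
  by congr (ph (point _ _ _)); apply/val_inj/eqP; rewrite /= -leqn0.
case: (ltngtP x y.+1) xy => // [xy|xy] _; last first.
  by congr (ph (point _ _ _)); apply/val_inj.
have ym' : (y < m)%N by apply: ltnW.
rewrite (IH ym') // => [|z /andP[z1 z2]]; last by apply: H; rewrite z1 ltnW.
by apply: con => //; apply: H; rewrite /= ?leqnn ?leqnSn ?andbT // ltnW.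
Qed.

Lemma free_line m (B : {set grid m}) ph i l a a' : consistent B ph ->
  l \notin bad_lines B i -> ph (point i l a) = ph (point i l a').
Proof.
move=> con; rewrite inE negb_exists => /forallP fr.
by case/orP: (leq_total a a') => le; [|symmetry]; apply: chain con le _ => z _; apply: fr.
Qed.

(* The points [mix j t t'] lead from [t] to [t'] by changing one coordinate at a time. *)
Definition mix m j (t t' : grid m) : grid m := [ffun i : 'I_d.+1 => if (i < j)%N then t' i else t i].

Lemma mix0 m (t t' : grid m) : mix 0 t t' = t.
Proof. by apply/ffunP => i; rewrite ffunE. Qed.

Lemma mix_all m (t t' : grid m) : mix d.+1 t t' = t'.
Proof. by apply/ffunP => i; rewrite ffunE ltn_ord. Qed.

Lemma mix_line m (i : 'I_d.+1) (t t' : grid m) :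
  line_of i (mix i.+1 t t') = line_of i (mix i t t').
Proof.
apply/ffunP => j; rewrite !ffunE ltnS leq_eqVlt.
by rewrite (inj_eq val_inj) eq_sym (negbTE (neq_lift _ _)).
Qed.

Lemma mix_phase m (B : {set grid m}) ph (t t' : grid m) : consistent B ph ->
  (forall i, line_of i (mix i t t') \notin bad_lines B i) ->
  [/\ t \notin B, t' \notin B & ph t = ph t'].
Proof.
move=> con fr.
have good i a : point i (line_of i (mix i t t')) a \notin B.
  by have := fr i; rewrite inE negb_exists => /forallP.
have step j : (j <= d.+1)%N -> ph (mix j t t') = ph t.
  elim: j => [|j IH] jd; first by rewrite mix0.
  rewrite -IH; last exact: ltnW.
  rewrite -(point_line (Ordinal jd) (mix j t t')) -(point_line (Ordinal jd) (mix j.+1 t t')).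
  by rewrite (mix_line (Ordinal jd)); apply: free_line con (fr (Ordinal jd)).
split; last by rewrite -(step d.+1) ?mix_all.
  by have := good ord0 (t ord0); rewrite /= mix0 point_line.
have := good ord_max (t' ord_max); rewrite -mix_line /= mix_all.
by rewrite point_line.
Qed.

Lemma card_grid m : #|{: grid m}| = (m ^ d.+1)%N.
Proof. by rewrite card_ffun !card_ord. Qed.

Lemma card_lines m : #|{: lines m}| = (m ^ d)%N.
Proof. by rewrite card_ffun !card_ord. Qed.

Lemma card_on_lines m i (L : {set lines m}) :
  #|[set t : grid m | line_of i t \in L]| = (#|L| * m)%N.
Proof.
have -> : [set t : grid m | line_of i t \in L] =
    [set point i p.1 p.2 | p in setX L [set: 'I_m]].
  apply/setP => t; rewrite inE; apply/idP/imsetP => [tL|[[l a]]].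
    by exists (line_of i t, t i); rewrite ?point_line // !inE tL.
  by rewrite !inE /= andbT => lL ->; rewrite line_point.
rewrite card_imset ?cardsX ?cardsT ?card_ord // => -[l a] [l' a'] /= e.
by congr (_, _); [rewrite -(line_point i l a) e line_point|rewrite -(point_at i l a) e point_at].
Qed.

Section Dominate.
Variable R : realFieldType.

(** For a random pair [(t, t')], the line used by the path [mix] in direction [i] is uniformly
    distributed. So all but a fraction [d.+1 * rho] of the pairs are joined along free lines and
    have the same phase. Since [x ^ 2 + y ^ 2 <= max x y * N] when [x + y <= N], one phase
    dominates. *)
Lemma dominating_phase m (B : {set grid m}) ph (rho : R) : consistent B ph ->
  (forall i, #|bad_lines B i|%:R <= rho * m%:R ^+ d) ->
  exists b, (1 - d.+1%:R * rho) * m%:R ^+ d.+1 <= #|phase_set B ph b|%:R.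
Proof.
move=> con hb; set N := m%:R ^+ d.+1 : R.
have NE : N = #|{: grid m}|%:R by rewrite card_grid natrX.
have N0 : 0 <= N by rewrite NE ler0n.
pose P b := phase_set B ph b.
pose Q i := [set p : grid m * grid m | line_of i (mix i p.1 p.2) \in bad_lines B i].
have cQ i : #|Q i|%:R <= rho * (N * N).
  (* Exchanging the first [i] coordinates is an involution that makes [mix i p.1 p.2] the first
     component. *)
  pose f (p : grid m * grid m) := (mix i p.1 p.2, mix i p.2 p.1).
  have fK : cancel f f.
    by move=> [t t']; congr (_, _); apply/ffunP => j; rewrite !ffunE; case: ifP => h; rewrite ?ffunE ?h.
  have -> : Q i = f @: setX [set t : grid m | line_of i t \in bad_lines B i] setT.
    apply/setP => p; rewrite inE; apply/idP/imsetP => [h|[[u v]]].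
      exists (mix i p.1 p.2, mix i p.2 p.1); first by rewrite in_setX in_setT andbT inE.
      by rewrite -[LHS]fK.
    by rewrite in_setX in_setT andbT inE => h ->; rewrite -[X in line_of i X]/((f (f (u, v))).1) fK.
  rewrite (card_imset _ (can_inj fK)) cardsX cardsT card_on_lines !natrM -NE.
  rewrite [rho * _]mulrA ler_wpM2r // /N exprSr mulrA ler_wpM2r ?ler0n //.
have cov : (#|{: grid m * grid m}| <= #|P true| ^ 2 + #|P false| ^ 2 + \sum_i #|Q i|)%N.
  apply: leq_trans (_ : #|(setX (P true) (P true) :|: setX (P false) (P false)) :|: \bigcup_i Q i| <= _)%N.
    rewrite -cardsT; apply: subset_leq_card; apply/subsetP => -[t t'] _.
    rewrite in_setU; case: (boolP ((t, t') \in \bigcup_i Q i)) => [h|nQ].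
      by apply/orP; right.
    apply/orP; left.
    have [|tB t'B pt] := @mix_phase _ B ph t t' con.
      by move=> i; apply: contra nQ => h; apply/bigcupP; exists i => //; rewrite inE.
    by rewrite in_setU !in_setX !inE tB t'B pt /=; case: (ph t').
  apply: leq_trans (leq_card_setU _ _) _; apply: leq_add.
    by apply: leq_trans (leq_card_setU _ _) _; rewrite !cardsX !mulnn.
  exact: leq_card_bigcups.
have cQs : (\sum_i #|Q i|)%:R <= d.+1%:R * rho * (N * N).
  rewrite natr_sum; apply: le_trans (ler_sum _ (fun i _ => cQ i)) _.
  by rewrite sumr_const card_ord -[leLHS]mulr_natl -[leRHS]mulrA.
have dis : (#|P true| + #|P false| <= #|{: grid m}|)%N.
  have e : P true :&: P false = set0.
    by apply/setP => t; rewrite !inE; case: (ph t); rewrite ?andbF.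
  by have := cardsUI (P true) (P false); rewrite e cards0 addn0 => <-; apply: max_card.
move: dis cov; rewrite card_prod -(ler_nat R) natrD -NE -(ler_nat R).
rewrite natrM !natrD !natrX -NE => dis cov.
have [N00|Npos] := eqVneq N 0.
  by exists true; rewrite N00 mulr0 ler0n.
have {}Npos : 0 < N by rewrite lt_neqAle eq_sym Npos.
have : (1 - d.+1%:R * rho) * (N * N) <= #|P true|%:R ^+ 2 + #|P false|%:R ^+ 2.
  by move: cov cQs; clear; lra.
have p1 := ler0n R #|P true|; have p2 := ler0n R #|P false|.
case/orP: (leq_total #|P true| #|P false|); rewrite -(ler_nat R) => le h.
  exists false; rewrite -(ler_pM2r Npos) -mulrA; apply: le_trans h _.
  by rewrite -/(P false); move: dis le p1 p2; clear; nra.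
exists true; rewrite -(ler_pM2r Npos) -mulrA; apply: le_trans h _.
by rewrite -/(P true); move: dis le p1 p2; clear; nra.
Qed.

End Dominate.

(** * Grouping points into cells *)

Section Coarse.
Variables (m w q : nat).
Hypothesis qw : (q * w <= m)%N.

Lemma fine_lt (a : 'I_q) (r : 'I_w) : (a * w + r < m)%N.
Proof.
apply: leq_trans qw; apply: leq_trans (_ : a * w + w <= _)%N; first by rewrite ltn_add2l.
by rewrite addnC -mulSn leq_mul2r ltn_ord orbT.
Qed.

Definition fine (a : 'I_q) (r : 'I_w) : 'I_m := Ordinal (fine_lt a r).

Definition emb k (T : {ffun 'I_k -> 'I_q}) (r : {ffun 'I_k -> 'I_w}) : {ffun 'I_k -> 'I_m} :=
  [ffun j => fine (T j) (r j)].

Lemma emb_point i (L : lines q) A (l : lines w) a :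
  emb (point i L A) (point i l a) = point i (emb L l) (fine A a).
Proof. by apply/ffunP => j; rewrite !ffunE; case: unliftP => [j' _|_] //; rewrite ffunE. Qed.

Lemma emb_inj k (T T' : {ffun 'I_k -> 'I_q}) r r' : emb T r = emb T' r' -> T = T' /\ r = r'.
Proof.
move=> /ffunP e.
have h j : T j = T' j /\ r j = r' j.
  have := e j; rewrite !ffunE => /(congr1 val) /= e'.
  have w0 : (0 < w)%N by apply: leq_ltn_trans (ltn_ord (r j)).
  split; apply/val_inj => /=.
    have := congr1 (divn^~ w) e'; rewrite /= !divnMDl // !divn_small ?ltn_ord //.
    by rewrite !addn0.
  by have := congr1 (modn^~ w) e'; rewrite /= !modnMDl !modn_small ?ltn_ord.
by split; apply/ffunP => j; case: (h j).
Qed.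

Variables (B : {set grid m}) (ph : grid m -> bool).
Hypothesis con : consistent B ph.

Definition cell (T : grid q) : {set grid w} := [set r | emb T r \in B].
Definition cell_phase (T : grid q) (r : grid w) := ph (emb T r).

Lemma cell_consistent T : consistent (cell T) (cell_phase T).
Proof.
move=> i l a a' aa'.
have e x : emb T (point i l x) = point i (emb (line_of i T) l) (fine (T i) x).
  by rewrite -emb_point point_line.
rewrite /cell_phase !inE !e.
by apply: con; rewrite /= -aa' addnS.
Qed.

Definition coarse_bad r0 : {set grid q} :=
  [set T | [exists i, (r0 <= #|bad_lines (cell T) i|)%N]].

Definition coarse_phase (T : grid q) : bool :=
  (w ^ d.+1 < 2 * #|phase_set (cell T) (cell_phase T) true|)%N.

Section Step.
Variables (R : realFieldType) (rho : R) (r0 : nat).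
Hypothesis w_gt0 : (0 < w)%N.
Hypothesis rho_small : 2 * d.+2%:R * rho < 1.
Hypothesis rho_gt0 : 0 < rho.
Hypothesis r0_le : r0%:R <= rho * w%:R ^+ d + 1.

Local Notation W := (w%:R ^+ d.+1 : R).

Let W_gt0 : 0 < W.
Proof. by rewrite exprn_gt0 // ltr0n. Qed.

Lemma cell_lines T i : T \notin coarse_bad r0 ->
  #|bad_lines (cell T) i|%:R <= rho * w%:R ^+ d.
Proof.
rewrite inE negb_exists => /forallP/(_ i); rewrite -ltnNge => lt.
have : #|bad_lines (cell T) i|.+1%:R <= r0%:R :> R by rewrite ler_nat.
by rewrite -natr1 => h; have := le_trans h r0_le; rewrite lerD2r.
Qed.

Lemma card_phase_sum T : (#|phase_set (cell T) (cell_phase T) true| +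
  #|phase_set (cell T) (cell_phase T) false| <= w ^ d.+1)%N.
Proof.
rewrite -card_grid.
have e : phase_set (cell T) (cell_phase T) true :&: phase_set (cell T) (cell_phase T) false = set0.
  by apply/setP => t; rewrite !inE; case: (cell_phase T t); rewrite ?andbF.
have := cardsUI (phase_set (cell T) (cell_phase T) true) (phase_set (cell T) (cell_phase T) false).
by rewrite e cards0 addn0 => <-; apply: max_card.
Qed.

Lemma coarse_phaseP T : T \notin coarse_bad r0 ->
  (1 - d.+1%:R * rho) * W <= #|phase_set (cell T) (cell_phase T) (coarse_phase T)|%:R.
Proof.
move=> TB; have [b hb] := dominating_phase (@cell_consistent T) (fun i => cell_lines i TB).
suff -> : coarse_phase T = b by [].
rewrite /coarse_phase; have := card_phase_sum T; rewrite -(ler_nat R) natrD natrX => sm.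
have hd : 2 * (d.+1%:R * rho) < 1.
  by move: rho_small rho_gt0; rewrite -(natr1 d.+1); clear -d m w q qw B ph con R rho r0 w_gt0 rho_small rho_gt0 r0_le W_gt0; nra.
case: b hb => hb.
  by rewrite -(ltr_nat R) natrX natrM; move: hb hd W_gt0; clear -d m w q qw B ph con R rho r0 w_gt0 rho_small rho_gt0 r0_le W_gt0; nra.
apply/negbTE; rewrite -leqNgt -(ler_nat R) natrX natrM.
by move: hb hd W_gt0 sm; clear -d m w q qw B ph con R rho r0 w_gt0 rho_small rho_gt0 r0_le W_gt0; nra.
Qed.

(** In two adjacent good cells, all but a fraction [2 * rho + 2 * d.+1 * rho < 1] of the positions
    [r] lie on a line in direction [i] that is free in both cells and carry the majority phase in
    both. Along such a line the phase is constant from one cell to the other. *)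
Lemma coarse_consistent : consistent (coarse_bad r0) coarse_phase.
Proof.
move=> i L A A' AA' TB TB'; set T := point i L A in TB *; set T' := point i L A' in TB' *.
have P1 := coarse_phaseP TB; have P2 := coarse_phaseP TB'.
pose Fr (T : grid q) := [set r : grid w | line_of i r \notin bad_lines (cell T) i].
have cFr T0 : T0 \notin coarse_bad r0 -> #|~: Fr T0|%:R <= rho * W.
  move=> h; have -> : ~: Fr T0 = [set r | line_of i r \in bad_lines (cell T0) i].
    by apply/setP => r; rewrite !inE negbK.
  rewrite card_on_lines natrM exprSr mulrA ler_wpM2r ?ler0n //; exact: cell_lines.
pose Ph T := phase_set (cell T) (cell_phase T) (coarse_phase T).
have cPh T0 : T0 \notin coarse_bad r0 -> #|~: Ph T0|%:R <= d.+1%:R * rho * W.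
  move=> h; have := coarse_phaseP h; have := cardsC (Ph T0); rewrite card_grid => /(congr1 (fun n => n%:R : R)).
  by rewrite natrD natrX /Ph; move: (#|~: _|%:R) (#|phase_set _ _ _|%:R) => x y; clear -d m w q qw B ph con R rho r0 w_gt0 rho_small rho_gt0 r0_le W_gt0; nra.
have [r] : exists r, [&& r \in Fr T, r \in Fr T', r \in Ph T & r \in Ph T'].
  apply/existsP; apply: contraT; rewrite negb_exists => /forallP nr.
  have cov : (#|{: grid w}| <= #|~: Fr T| + #|~: Fr T'| + (#|~: Ph T| + #|~: Ph T'|))%N.
    apply: leq_trans (_ : #|(~: Fr T :|: ~: Fr T') :|: (~: Ph T :|: ~: Ph T')| <= _)%N.
      rewrite -cardsT; apply: subset_leq_card; apply/subsetP => r _.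
      rewrite 3!in_setU 4!in_setC; have := nr r.
      by case: (r \in Fr T); case: (r \in Fr T'); case: (r \in Ph T); case: (r \in Ph T').
    apply: leq_trans (leq_card_setU _ _) _.
    by apply: leq_add; apply: leq_card_setU.
  move: cov; rewrite card_grid -(ler_nat R) natrX !natrD => cov.
  have := cFr _ TB; have := cFr _ TB'; have := cPh _ TB; have := cPh _ TB'.
  have : 2 * d.+2%:R * rho * W < W by rewrite -[ltRHS]mul1r ltr_pM2r.
  rewrite -(natr1 d.+1); move: cov; clear -d m w q qw B ph con R rho r0 w_gt0 rho_small rho_gt0 r0_le W_gt0; lra.
case/and4P => rF rF'; rewrite !inE => /andP[_ /eqP <-] /andP[_ /eqP <-].
rewrite /cell_phase -(point_line i r) !emb_point.
apply: (chain con) => [|z]; first by rewrite /= -AA' leq_add2r leq_mul2r leqnSn orbT.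
have frT T0 : r \in Fr T0 -> forall a, emb T0 (point i (line_of i r) a) \notin B.
  by rewrite !inE negb_exists => /forallP h a; have := h a; rewrite inE.
rewrite /= => /andP[z1 z2].
case: (ltnP z (A' * w)) => zA.
  have az : (z - A * w < w)%N by move: zA; rewrite -AA' mulSn; move: z1; clear; lia.
  have := frT T rF (Ordinal az); rewrite emb_point; congr (point _ _ _ \notin B).
  by apply/val_inj; rewrite /= subnKC //; apply: leq_trans z1; rewrite leq_addr.
have az : (z - A' * w < w)%N.
  by rewrite ltn_subLR // (leq_ltn_trans z2) // ltn_add2l.
have := frT T' rF' (Ordinal az); rewrite emb_point; congr (point _ _ _ \notin B).
by apply/val_inj; rewrite /= subnKC.
Qed.

End Step.
End Coarse.

(** * Rarity of bad cells *)

Section Renormalize.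
Variables (R : realFieldType) (m w q : nat) (Om : finType) (Bo : Om -> {set grid m}).
Variables (K z : R) (r0 : nat).
Hypothesis qw : (q * w <= m)%N.
Hypothesis K_ge0 : 0 <= K.
Hypothesis z_ge0 : 0 <= z.
Hypothesis w_gt0 : (0 < w)%N.
Hypothesis wz : w%:R * z <= 1.
Hypothesis HB : forall U : {set grid m}, #|[set o | U \subset Bo o]|%:R <= K * z ^+ #|U|.

(* A choice of marked points, at most one on each line. *)
Let marks := {ffun lines w -> option 'I_w}.
Let supp (F : marks) := [set l | F l].
Let marked (T : grid q) (iF : 'I_d.+1 * marks) : {set grid m} :=
  [set emb qw T (point iF.1 p.1 p.2) | p in [set p : lines w * 'I_w | iF.2 p.1 == Some p.2]].

Let card_marked T iF : #|marked T iF| = #|supp iF.2|.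
Proof.
rewrite card_in_imset => [|[l a] [l' a']]; last first.
  move=> _ _ /= /emb_inj [_ e].
  by congr (_, _); [rewrite -(line_point iF.1 l a) e line_point|
                    rewrite -(point_at iF.1 l a) e point_at].
rewrite -[RHS](card_in_imset (_ : {in supp iF.2 &, injective (fun l =>
   (l, odflt (Ordinal w_gt0) (iF.2 l)))})) => [|l l' _ _ []] //.
apply: eq_card => -[l a]; rewrite inE /=; apply/eqP/imsetP => [e|[l' ]].
  by exists l; rewrite ?inE e.
by rewrite inE => h [-> ->]; case: (iF.2 l') h.
Qed.

(** As [w * z <= 1], each term is at most [(w * z) ^ r0] times the power of [1 / w] given by the
    support, and the sum of these powers factorises over the lines into
    [(1 + w * (1 / w)) ^ (w ^ d)]. *)
Let sum_marks : \sum_(F : marks | (r0 <= #|supp F|)%N) z ^+ #|supp F| <=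
  2 ^+ (w ^ d) * (w%:R * z) ^+ r0.
Proof.
have w0 : 0 < w%:R :> R by rewrite ltr0n.
apply: le_trans (_ : \sum_(F : marks) (w%:R * z) ^+ r0 * (w%:R^-1) ^+ #|supp F| <= _).
  rewrite big_mkcond /=; apply: ler_sum => F _; case: ifP => [h|_]; last first.
    by rewrite mulr_ge0 ?exprn_ge0 ?mulr_ge0 ?invr_ge0 // ltW.
  have -> : z ^+ #|supp F| = (w%:R * z) ^+ #|supp F| * w%:R^-1 ^+ #|supp F|.
    by rewrite -exprMn mulrAC mulfV ?mul1r // gt_eqF.
  rewrite ler_wpM2r ?exprn_ge0 ?invr_ge0 ?(ltW w0) //.
  by rewrite ler_wiXn2l // mulr_ge0 // ltW.
rewrite -mulr_sumr mulrC ler_wpM2r ?exprn_ge0 ?mulr_ge0 ?(ltW w0) //.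
rewrite (eq_bigr (fun F : marks => \prod_l (if F l then w%:R^-1 else 1))) => [|F _].
  rewrite -(bigA_distr_bigA (fun (l : lines w) (o : option 'I_w) => if o then w%:R^-1 else 1 : R)) /=.
  rewrite (eq_bigr (fun _ => 2)) => [|l _].
    by rewrite prodr_const card_lines.
  rewrite (bigD1 None) //= (reindex_omap Some id) => [|[a|]] //=.
  rewrite (eq_bigl xpredT) => [|a]; last by rewrite eqxx.
  by rewrite sumr_const card_ord -[_ *+ w]mulr_natl mulfV ?gt_eqF.
rewrite -prodr_const big_mkcond /=; apply: eq_bigr => l _.
by rewrite inE; case: (F l).
Qed.

Let zc : R := d.+1%:R * 2 ^+ (w ^ d) * (w%:R * z) ^+ r0.

Let zc_ge0 : 0 <= zc.
Proof. by rewrite !mulr_ge0 ?exprn_ge0 ?mulr_ge0. Qed.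

(** Cells are treated one by one: a bad cell contains a marked set with one bad point on each of at
    least [r0] lines in some direction, and this set is added to [U]. Cells are disjoint, so the
    added points are new and the powers of [z] multiply. *)
Let renorm_seq (s : seq (grid q)) (U : {set grid m}) : uniq s ->
  (forall T r, T \in s -> emb qw T r \notin U) ->
  #|[set o | (U \subset Bo o) && all (fun T => T \in coarse_bad qw (Bo o) r0) s]|%:R
    <= K * z ^+ #|U| * zc ^+ size s.
Proof.
elim: s U => [|T s IH] U.
  move=> _ _; rewrite expr0 mulr1; apply: le_trans (HB U).
  by rewrite ler_nat subset_leq_card //; apply/subsetP => o; rewrite !inE andbT.
rewrite /= => /andP[Ts us] hU.
pose V iF := [set o | (U :|: marked T iF \subset Bo o) &&
   all (fun T => T \in coarse_bad qw (Bo o) r0) s].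
apply: le_trans (_ : (\sum_(iF : 'I_d.+1 * marks | (r0 <= #|supp iF.2|)%N) #|V iF|)%:R <= _).
  rewrite ler_nat; apply: card_le_cover => o; rewrite !inE.
  case/and3P => UB /existsP[i hi] hs.
  pose F : marks := [ffun l => [pick a | emb qw T (point i l a) \in Bo o]].
  have FS : supp F = bad_lines (cell qw (Bo o) T) i.
    apply/setP => l; rewrite !inE ffunE; case: pickP => [a ha|no] /=.
      by apply/esym/existsP; exists a; rewrite inE.
    by apply/esym/negbTE; rewrite negb_exists; apply/forallP => a; rewrite inE no.
  exists (i, F); first by rewrite /= FS.
  rewrite inE hs andbT subUset UB /=; apply/subsetP => _ /imsetP[[l a] + ->].
  by rewrite inE /= ffunE; case: pickP => // b hb /eqP [<-].
rewrite natr_sum.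
apply: le_trans (_ : \sum_(iF : 'I_d.+1 * marks | (r0 <= #|supp iF.2|)%N)
    K * z ^+ #|U| * zc ^+ size s * z ^+ #|supp iF.2| <= _).
  apply: ler_sum => iF _; rewrite /V.
  apply: le_trans (IH _ us _) _ => [T' r T's|].
    rewrite !inE negb_or hU ?inE ?T's ?orbT //=.
    apply/negP => /imsetP[[l a] _ /emb_inj [e _]].
    by rewrite -e T's in Ts.
  rewrite (cardsU U) (_ : U :&: marked T iF = set0) ?cards0 ?subn0; last first.
    apply/setP => t; rewrite !inE; apply/negP => /andP[tU /imsetP[[l a] _ e]].
    by move: tU; rewrite e; apply/negP/hU; rewrite inE eqxx.
  rewrite card_marked exprD le_eqVlt; apply/orP; left; apply/eqP.
  by rewrite mulrA mulrAC.
rewrite -mulr_sumr exprSr mulrA ler_wpM2l ?mulr_ge0 ?exprn_ge0 //.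
rewrite -(pair_big_dep xpredT (fun _ F => (r0 <= #|supp F|)%N) (fun _ F => z ^+ #|supp F|)) /=.
rewrite sumr_const card_ord -[leLHS]mulr_natl /zc -mulrA ler_wpM2l //.
Qed.

Lemma renormalize (U : {set grid q}) :
  #|[set o | U \subset coarse_bad qw (Bo o) r0]|%:R <= K * zc ^+ #|U|.
Proof.
have := @renorm_seq (enum U) set0 (enum_uniq _).
rewrite cards0 expr0 mulr1 -cardE => h; apply: le_trans (h _); last by move=> T r; rewrite inE.
rewrite ler_nat subset_leq_card //; apply/subsetP => o; rewrite !inE sub0set /= => /subsetP s.
by apply/allP => T; rewrite mem_enum; apply: s.
Qed.

End Renormalize.

End Lines.

Lemma coarse_density (R : realFieldType) d m w q (qw : (q * w <= m)%N) (B : {set grid d m}) ph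
    (rho : R) r0 b : consistent B ph -> (0 < w)%N -> 2 * d.+2%:R * rho < 1 -> 0 < rho ->
  r0%:R <= rho * w%:R ^+ d + 1 ->
  #|phase_set (coarse_bad qw B r0) (coarse_phase qw B ph) b|%:R * ((1 - d.+1%:R * rho) * w%:R ^+ d.+1)
   <= #|phase_set B ph b|%:R.
Proof.
move=> con w0 rs rp r0le.
set P := phase_set (coarse_bad _ _ _) _ _.
pose Q (T : grid d q) := phase_set (cell qw B T) (cell_phase qw ph T) b.
pose Z := [set p : grid d q * grid d w | (p.1 \in P) && (p.2 \in Q p.1)].
have le1 : (#|Z| <= #|phase_set B ph b|)%N.
  rewrite -(card_imset _ (_ : injective (fun p : grid d q * grid d w => emb qw p.1 p.2))).
    apply: subset_leq_card; apply/subsetP => _ /imsetP[[T r] + ->].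
    by rewrite !inE /cell_phase /= => /andP[_ /andP[-> ->]].
  by move=> [T r] [T' r'] /= /emb_inj [-> ->].
apply: le_trans (_ : #|Z|%:R <= _); last by rewrite ler_nat.
have -> : #|Z| = (\sum_(T in P) #|Q T|)%N.
  rewrite -sum1_card (eq_bigl (fun p : grid d q * grid d w => (p.1 \in P) && (p.2 \in Q p.1))).
    by rewrite -(pair_big_dep (mem P) (fun T => mem (Q T)) (fun _ _ => 1%N)) /=;
      apply: eq_bigr => T _; rewrite sum1_card.
  by move=> p; rewrite inE.
rewrite natr_sum mulr_natl -sumr_const; apply: ler_sum => T.
rewrite inE => /andP[TB /eqP Tb].
by have := coarse_phaseP con w0 rs rp r0le TB; rewrite Tb.
Qed.

(** * Iterated coarsening *)

Section Percolation.
Variable R : realType.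
Local Notation ln2 := (ln 2%:R : R).

(* When [ln m > E / 2] one passes to cells of side about [expR (E / 4)], which multiplies the
   rate of the bad cells by a large power of the side; the loss is the factor [(E / ln m) ^ 2]. *)
Definition rate (m : nat) (E : R) : R :=
  if ln m%:R <= E / 2 then E else E ^+ 2 / ln m%:R ^+ 2.

(** [d.+1] is at most [2 ^ (w ^ d)], so the first two factors cost at most [2 * w ^ d] in the
    exponent, the [2] in [2 + E]; the [r0] factors [expR (- s)] provide the decay. *)
Lemma renorm_factor d w (z E rho s : R) r0 : (1 < w)%N -> 0 <= z -> w%:R * z <= expR (- s) ->
  0 <= s -> rho * w%:R ^+ d <= r0%:R -> (2 + E <= s * rho) ->
  d.+1%:R * 2 ^+ (w ^ d) * (w%:R * z) ^+ r0 <= expR (- (E * w%:R ^+ d)).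
Proof.
move=> w1 z0 wz s0 r0ge Es.
have dw : (d.+1 <= 2 ^ (w ^ d))%N.
  apply: leq_trans (ltn_expl d (ltnSn 1)) _; rewrite leq_exp2l //.
  by apply: leq_trans (ltnW (ltn_expl d w1)) _.
have l1 := ln2_le1 R; have l0 := ln2_gt0 R.
set W := w%:R ^+ d.
have W0 : 0 <= W by rewrite exprn_ge0.
have wz0 : 0 <= w%:R * z by rewrite mulr_ge0.
apply: le_trans (_ : expR (ln2 * (w ^ d)%:R) * expR (ln2 * (w ^ d)%:R) * expR (- s) ^+ r0 <= _).
  apply: ler_pM; rewrite ?mulr_ge0 ?exprn_ge0 //; last by rewrite lerXn2r // nnegrE expR_ge0.
  by rewrite -!exp2E natrX ler_wpM2r ?exprn_ge0 // -natrX ler_nat.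
rewrite -expRM_natl -!expRD ler_expR natrX -/W.
have : (2 + E) * W <= s * rho * W by rewrite ler_wpM2r.
have : s * (rho * W) <= s * r0%:R by rewrite ler_wpM2l.
have : ln2 * W <= W by rewrite ler_piMl.
by clear; lra.
Qed.

Lemma bernoulli_le (x : R) n : 0 <= x <= 1 -> 1 - n%:R * x <= (1 - x) ^+ n.
Proof.
move=> /andP[x0 x1]; elim: n => [|n IH]; first by rewrite mul0r subr0 expr0.
rewrite exprS; apply: le_trans (_ : (1 - x) * (1 - n%:R * x) <= _); last first.
  by rewrite ler_wpM2l // subr_ge0.
by rewrite -natr1; have := ler0n R n; have := sqr_ge0 x; nra.
Qed.

Definition undominated (Om : finType) d m (Bo : Om -> {set grid d m}) (ph : Om -> grid d m -> bool)
    (c : R) : {set Om} :=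
  [set o | [forall b, #|phase_set (Bo o) (ph o) b|%:R < (1 - c) * m%:R ^+ d.+1]].

(** The whole grid is a single cell: by [dominating_phase] an undominated outcome makes this cell
    bad, and [renormalize] counts such outcomes. *)
Lemma percolation_single d m (Om : finType) (Bo : Om -> {set grid d m}) ph (K E c : R) :
  (1 < m)%N -> (forall o, consistent (Bo o) (ph o)) -> 0 <= K ->
  (forall U : {set grid d m}, #|[set o | U \subset Bo o]|%:R <= K * expR (- E) ^+ #|U|) ->
  0 < c -> 128 * d.+1%:R / c <= E -> ln m%:R <= E / 2 ->
  #|undominated Bo ph c|%:R <= K * expR (- (c / (4 * d.+1%:R) * m%:R ^+ d * E)).
Proof.
move=> m1 con K0 HB c0 Ec lm.
set D := d.+1%:R in Ec *; have D0 : 0 < D by rewrite ltr0n.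
pose rho := c / D; have rho0 : 0 < rho by rewrite divr_gt0.
have Erho : 128 <= E * rho.
  rewrite -ler_pdivrMr //; apply: le_trans Ec.
  by rewrite /rho invf_div mulrA.
have E0 : 0 < E by apply: lt_le_trans Ec; rewrite divr_gt0 // mulr_gt0.
pose x := rho * m%:R ^+ d; have x0 : 0 <= x by rewrite mulr_ge0 ?exprn_ge0 // ltW.
pose r0 := (Num.truncn x).+1.
have xr0 : x < r0%:R by rewrite truncnS_gt.
have m0 : 0 < m%:R :> R by rewrite ltr0n ltnW.
have mz : m%:R * expR (- E) <= expR (- (E / 2)).
  rewrite -{1}(lnK (_ : m%:R \is Num.pos)) ?posrE // -expRD ler_expR; lra.
have mz1 : m%:R * expR (- E) <= 1.
  by apply: le_trans mz _; rewrite -[leRHS]expR0 ler_expR; lra.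
have qw : (1 * m <= m)%N by rewrite mul1n.
have := renormalize r0 qw K0 (expR_ge0 _) (ltnW m1) mz1 HB setT.
rewrite cardsT card_grid exp1n expr1 => h.
apply: le_trans (_ : K * expR (- (E * rho / 4 * m%:R ^+ d)) <= _); last first.
  by rewrite ler_wpM2l // ler_expR /rho lerN2 le_eqVlt; apply/orP; left; apply/eqP; clearbody D; field; rewrite gt_eqF.
apply: le_trans (_ : K * (D * 2 ^+ (m ^ d) * (m%:R * expR (- E)) ^+ r0) <= _); last first.
  rewrite ler_wpM2l //; apply: (renorm_factor m1 (expR_ge0 _) mz _ (ltW xr0)).
    by rewrite divr_ge0 // ltW.
  by move: Erho; clear; lra.
apply: le_trans h; rewrite ler_nat; apply: subset_leq_card; apply/subsetP => o.
rewrite !inE => /forallP und; apply/subsetP => T _.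
have cT : cell qw (Bo o) T = Bo o.
  apply/setP => r; rewrite inE; congr (_ \in Bo o); apply/ffunP => j; rewrite ffunE.
  by apply/val_inj; rewrite /= (ord1 (T j)).
rewrite inE; apply: contraT; rewrite negb_exists => /forallP nb.
have [|b hb] := @dominating_phase d R m (Bo o) (ph o) rho (con o).
  move=> i; have := nb i; rewrite cT -ltnNge ltnS => le.
  by apply: le_trans (_ : (Num.truncn x)%:R <= _); [rewrite ler_nat|rewrite truncn_le].
have := und b; rewrite ltNge => /negP; case.
apply: le_trans hb; rewrite ler_wpM2r ?exprn_ge0 // /rho -/D.
by rewrite mulrCA mulfV ?mulr1 // gt_eqF.
Qed.

(** Strong induction on [m]. When lines are too long, the grid is coarsened to cells of side [w],
    about [expR (E / 4)], so that [w * expR (- E)] is still small; [E] becomes [E'], larger by a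
    factor of order [w ^ d], and [c] is halved. The condition [1 < d] makes [w ^ d] large enough to
    pay for the constants lost in each round. *)
Lemma percolation d (d2 : (1 < d)%N) (Om : finType) (K : R) (K0 : 0 <= K) m :
  forall (Bo : Om -> {set grid d m}) ph (E c : R),
  (1 < m)%N -> (forall o, consistent (Bo o) (ph o)) ->
  (forall U : {set grid d m}, #|[set o | U \subset Bo o]|%:R <= K * expR (- E) ^+ #|U|) ->
  0 < c -> c <= 1 -> 128 * d.+1%:R / c <= E ->
  #|undominated Bo ph c|%:R <= K * expR (- (c / (4 * d.+1%:R) * m%:R ^+ d * rate m E)).
Proof.
elim/ltn_ind: m => m IH Bo ph E c m1 con HB c0 c1 Ec; rewrite /rate.
case: (leP (ln m%:R) (E / 2)) => [lm|lm]; first exact: percolation_single.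
have Dd : d.+1%:R = d.+1%:R :> R by [].
move: Ec IH; set D := (d.+1%:R in X in X -> _) => Ec IH.
have D3 : 3 <= D by rewrite (ler_nat R 3).
have ltc (x y : R) : 0 <= x -> 0 < y <= 1 -> x <= x / y.
  by move=> x0 /andP[y0 y1]; rewrite ler_pdivlMr // ler_piMr.
have DcE : D <= D / c by apply: ltc; [move: D3; clear; lra|rewrite c0].
have Dc3 : 3 <= D / c by apply: le_trans DcE.
have Ec' : 128 * (D / c) <= E by rewrite mulrA.
have E384 : 384 <= E by move: Ec' Dc3; clear; lra.
have E0 : 0 < E by move: E384; clear; lra.
pose x : R := expR (E / 4); pose w := Num.truncn x.
have x0 : 0 <= x := expR_ge0 _.
have wx : w%:R <= x by rewrite truncn_le.
have xw : x < w%:R + 1 by rewrite natr1 truncnS_gt.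
have wE : E / 4 <= w%:R by have := expR_ge1Dx (E / 4); rewrite -/x; move: xw; clear; lra.
have wDc : 32 * (D / c) <= w%:R by move: wE Ec'; clear; lra.
have w1 : (1 < w)%N by rewrite -(ltr_nat R); move: wE E384; clear; lra.
have w0 : (0 < w)%N := ltnW w1.
have m0 : (0 < m)%N := ltnW m1.
have W0 : 0 < w%:R :> R by rewrite ltr0n.
have M0 : 0 < m%:R :> R by rewrite ltr0n.
have mexp : expR (E / 2) < m%:R by rewrite -[ltRHS]lnK ?posrE // ltr_expR.
have wwR : w%:R * w%:R <= m%:R :> R.
  apply: le_trans (ltW mexp); apply: le_trans (_ : x * x <= _); first exact: ler_pM.
  by rewrite -expRD le_eqVlt (_ : E / 4 + E / 4 = E / 2) ?eqxx //; clear; field.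
have ww : (w * w <= m)%N by rewrite -(ler_nat R) natrM.
pose q := (m %/ w)%N.
have qw : (q * w <= m)%N by apply: leq_divM.
have q1 : (1 < q)%N by apply: leq_trans w1 _; rewrite leq_divRL.
have qm : (q < m)%N by apply: ltn_Pdiv.
have mqw : m%:R - w%:R <= (q * w)%:R :> R.
  by rewrite lerBlDr -natrD ler_nat addnC -mulSn ltnW // ltn_ceil.
have wm : w%:R / m%:R <= c / (32 * D).
  rewrite ler_pdivrMr //; apply: le_trans (_ : w%:R / w%:R * w%:R <= _).
    by rewrite mulfV ?mul1r // gt_eqF.
  rewrite mulrAC ler_pdivrMr //.
  have cD : 0 <= c / (32 * D) by rewrite divr_ge0 ?(ltW c0) //; move: D3; clear; lra.
  apply: le_trans (_ : c / (32 * D) * w%:R * (w%:R * w%:R) <= _); last first.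
    by rewrite -[leLHS]mulrA -[leRHS]mulrA ler_wpM2l // [leRHS]mulrC ler_wpM2l // ler0n.
  rewrite ler_peMl ?mulr_ge0 //.
  apply: le_trans (_ : c / (32 * D) * (32 * (D / c)) <= _); last by rewrite ler_wpM2l.
  rewrite (_ : c / (32 * D) * (32 * (D / c)) = 1) //; move: c0 D3; clearbody D; clear => c0 D3.
  by field; rewrite !gt_eqF //; lra.
pose rho := c / (4 * D).
have D0 : 0 < D by move: D3; clear; lra.
have rho0 : 0 < rho by rewrite divr_gt0 // mulr_gt0.
have Drho : D * rho = c / 4 by clearbody D; rewrite /rho; field; rewrite gt_eqF.
have Erho : 32 <= E * rho.
  rewrite /rho mulrA ler_pdivlMr ?mulr_gt0 //.
  by move: Ec; rewrite ler_pdivrMr //; clear; lra.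
pose r0 := (Num.truncn (rho * w%:R ^+ d)).+1.
have rW0 : 0 <= rho * w%:R ^+ d by rewrite mulr_ge0 ?exprn_ge0 // ltW.
have r0ge : rho * w%:R ^+ d <= r0%:R by rewrite ltW // truncnS_gt.
have r0le : r0%:R <= rho * w%:R ^+ d + 1 by rewrite -natr1 lerD2r truncn_le.
have rs : 2 * d.+2%:R * rho < 1.
  rewrite -natr1 -/D mulrDr mulr1 mulrDl -mulrA Drho.
  have : 2 * rho <= D * rho by rewrite ler_wpM2r ?(ltW rho0) //; move: D3; clear; lra.
  by rewrite Drho; move: c1; clear; lra.
have wz : w%:R * expR (- E) <= expR (- (3 * E / 4)).
  apply: le_trans (_ : x * expR (- E) <= _); first by rewrite ler_wpM2r // expR_ge0.
  by rewrite -expRD ler_expR; clear; lra.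
have wz1 : w%:R * expR (- E) <= 1.
  by apply: le_trans wz _; rewrite -[leRHS]expR0 ler_expR; move: E0; clear; lra.
pose E' := E * rho / 2 * w%:R ^+ d.
have zc : d.+1%:R * 2 ^+ (w ^ d) * (w%:R * expR (- E)) ^+ r0 <= expR (- E').
  apply: (renorm_factor w1 (expR_ge0 _) wz _ r0ge); first by move: E0; clear; lra.
  by move: Erho; clear; lra.
have WdDc : 32 ^+ 2 * (D / c) ^+ 2 <= w%:R ^+ d.
  rewrite -exprMn; apply: le_trans (_ : w%:R ^+ 2 <= _).
    by rewrite lerXn2r // nnegrE; move: Dc3 W0; clear; lra.
  by rewrite ler_eXn2l // (ltr_nat R 1).
have E'16 : 16 * w%:R ^+ d <= E'.
  by rewrite ler_wpM2r ?exprn_ge0 ?(ltW W0) //; move: Erho; clear; lra.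
have HB' (U : {set grid d q}) :
    #|[set o | U \subset coarse_bad qw (Bo o) r0]|%:R <= K * expR (- E') ^+ #|U|.
  have := renormalize r0 qw K0 (expR_ge0 _) w0 wz1 HB U; move/le_trans; apply.
  rewrite ler_wpM2l // lerXn2r // nnegrE ?expR_ge0 //.
  by rewrite mulr_ge0 ?mulr_ge0 ?exprn_ge0 // mulr_ge0 ?expR_ge0.
have con' o : consistent (coarse_bad qw (Bo o) r0) (coarse_phase qw (Bo o) (ph o)).
  exact: (coarse_consistent (con o) w0 rs rho0 r0le).
have c20 : 0 < c / 2 by rewrite divr_gt0.
have c21 : c / 2 <= 1 by move: c1 c0; clear; lra.
have Ec2 : 128 * D / (c / 2) <= E'.
  apply: le_trans E'16.
  have -> : 128 * D / (c / 2) = 256 * (D / c).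
    by clearbody D; field; rewrite gt_eqF.
  have : D / c * 3 <= D / c * (D / c) by rewrite ler_wpM2l //; move: Dc3; clear; lra.
  by move: WdDc Dc3; clear; rewrite !expr2; lra.
have := IH q qm _ _ E' (c / 2) q1 con' HB' c20 c21 Ec2.
set A' := (X in expR (- X)) => IHq.
have Dw : D * (w%:R / m%:R) <= c / 32.
  apply: le_trans (_ : D * (c / (32 * D)) <= _); first by rewrite ler_wpM2l // ltW.
  by rewrite le_eqVlt (_ : D * _ = c / 32) ?eqxx //; clearbody D; field; rewrite gt_eqF.
have wm01 : 0 <= (w%:R / m%:R : R) <= 1.
  rewrite divr_ge0 ?ler0n //= ler_pdivrMr // mul1r ler_nat.
  by apply: leq_trans ww; rewrite leq_pmulr.
have qwm n : (n <= d.+1)%N -> (1 - c / 32) * m%:R ^+ n <= (q%:R * w%:R) ^+ n.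
  move=> nd; apply: le_trans (_ : ((1 - w%:R / m%:R) * m%:R) ^+ n <= _); last first.
    rewrite lerXn2r ?nnegrE ?mulr_ge0 // ?subr_ge0 ?(andP wm01).2 //.
    by rewrite mulrBl mul1r divfK ?gt_eqF // -natrM.
  rewrite exprMn ler_wpM2r ?exprn_ge0 //; apply: le_trans (bernoulli_le n wm01).
  have : n%:R * (w%:R / m%:R) <= D * (w%:R / m%:R).
    by rewrite ler_wpM2r ?(andP wm01).1 // ler_nat.
  by move: Dw; clear; lra.
apply: le_trans (_ : K * expR (- A') <= _).
  apply: le_trans IHq; rewrite ler_nat; apply: subset_leq_card; apply/subsetP => o.
  rewrite !inE => /forallP und; apply/forallP => b.
  rewrite ltNge; apply/negP => hb; have := und b; rewrite ltNge => /negP; case.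
  apply: le_trans (coarse_density qw b (con o) w0 rs rho0 r0le).
  (* The budget [c] is split into [c / 2] for the coarse grid, [c / 4] for points inside good cells
     and [c / 32] for points outside all cells. *)
  apply: le_trans (_ : (1 - c / 2) * q%:R ^+ d.+1 * ((1 - c / 4) * w%:R ^+ d.+1) <= _); last first.
    rewrite -/D Drho ler_wpM2r //; apply: mulr_ge0; last by rewrite exprn_ge0 // ltW.
    by move: c1; clear; lra.
  rewrite mulrACA -exprMn.
  apply: le_trans (_ : (1 - c / 2) * (1 - c / 4) * ((1 - c / 32) * m%:R ^+ d.+1) <= _); last first.
    rewrite ler_wpM2l ?qwm //; apply: mulr_ge0; move: c1; clear; lra.
  rewrite mulrA ler_wpM2r ?exprn_ge0 //.
  by move: c0 c1; clear; nra.
rewrite ler_wpM2l // ler_expR lerN2 /A' {IHq A' IH}.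
have lm0 : 0 < ln m%:R :> R by move: lm E0; clear; lra.
have Wd0 : 0 < w%:R ^+ d :> R by rewrite exprn_gt0.
have qd : m%:R ^+ d / (2 * w%:R ^+ d) <= q%:R ^+ d :> R.
  rewrite ler_pdivrMr ?mulr_gt0 //.
  have := qwm d (leqnSn d); rewrite exprMn.
  have : c / 32 * m%:R ^+ d <= 1 / 32 * m%:R ^+ d.
    by rewrite ler_wpM2r ?exprn_ge0 //; move: c1; clear; lra.
  have : 0 <= m%:R ^+ d :> R by rewrite exprn_ge0.
  by clear; lra.
(* The factor [4 * w ^ d] makes up for the factor [2 * w ^ d] lost in [qd] and for the [2] lost in
   passing from [c] to [c / 2]. *)
have key : 4 * w%:R ^+ d * (E ^+ 2 / ln m%:R ^+ 2) <= rate q E'.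
  rewrite /rate; case: ifP => _.
    apply: le_trans E'16.
    have : E ^+ 2 / ln m%:R ^+ 2 <= 4.
      rewrite ler_pdivrMr ?exprn_gt0 // (_ : 4 * ln m%:R ^+ 2 = (2 * ln m%:R) ^+ 2); last by clear; ring.
      rewrite lerXn2r ?nnegrE //; [exact: ltW|by rewrite mulr_ge0 // ltW|].
      by move: lm; clear; lra.
    have W4 : 0 <= 4 * w%:R ^+ d :> R by rewrite mulr_ge0 // ltW.
    by move/(ler_wpM2l W4); clear; lra.
  have lq0 : 0 < ln q%:R :> R by rewrite ln_gt0 // (ltr_nat R 1).
  apply: le_trans (_ : E' ^+ 2 / ln m%:R ^+ 2 <= _); last first.
    rewrite ler_wpM2l ?sqr_ge0 // lef_pV2 ?posrE ?exprn_gt0 //.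
    rewrite lerXn2r ?nnegrE ?(ltW lq0) ?(ltW lm0) // ler_ln ?posrE ?ltr0n ?(ltnW q1) //.
    by rewrite ler_nat ltnW.
  rewrite mulrA ler_wpM2r ?invr_ge0 ?exprn_ge0 ?(ltW lm0) //.
  have -> : E' ^+ 2 = rho ^+ 2 * w%:R ^+ d / 4 * w%:R ^+ d * E ^+ 2 by rewrite /E'; clear; field.
  rewrite ler_wpM2r ?sqr_ge0 // ler_wpM2r ?(ltW Wd0) //.
  have : rho ^+ 2 * (32 ^+ 2 * (D / c) ^+ 2) <= rho ^+ 2 * w%:R ^+ d by rewrite ler_wpM2l ?sqr_ge0.
  have -> : rho ^+ 2 * (32 ^+ 2 * (D / c) ^+ 2) = 64.
    by rewrite /rho; clearbody D; field; rewrite !gt_eqF.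
  by clear; lra.
rewrite -/rho (_ : c / 2 / (4 * D) = rho / 2); last by rewrite /rho mulrAC.
have r20 : 0 <= rho / 2 by move: rho0; clear; lra.
have e20 : 0 <= E ^+ 2 / ln m%:R ^+ 2 by rewrite divr_ge0 ?sqr_ge0.
rewrite -mulrA -[leRHS]mulrA [in leLHS](_ : rho = rho / 2 * 2); last by clear; field.
rewrite -[leLHS]mulrA ler_wpM2l //.
apply: le_trans (_ : m%:R ^+ d / (2 * w%:R ^+ d) * (4 * w%:R ^+ d * (E ^+ 2 / ln m%:R ^+ 2)) <= _); last first.
  apply: ler_pM => //; first by rewrite divr_ge0 ?exprn_ge0 // mulr_ge0 // ltW.
  by rewrite mulr_ge0 // mulr_ge0 // ltW.
rewrite le_eqVlt; apply/orP; left; apply/eqP.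
by move: (gt_eqF Wd0) (E ^+ 2 / ln m%:R ^+ 2); clear => Wn e; field; rewrite Wn.
Qed.

End Percolation.

(** * Directions and blocks in a box *)

(** Insertion of [c] at position [i], or at the end if [i] exceeds [d]; with [nat] indices the
    recursion stays structural. *)
Fixpoint ins (C : finType) (i d : nat) : C -> box C d -> box C d.+1 :=
  match i, d return C -> box C d -> box C d.+1 with
  | i'.+1, d'.+1 => fun c v => (v.1, @ins C i' d' c v.2)
  | _, _ => fun c v => (c, v)
  end.

Lemma ins_inj (C : finType) i d (c c' : C) (v v' : box C d) :
  ins i c v = ins i c' v' -> c = c' /\ v = v'.
Proof.
elim: i d v v' => [|i IH] [|d] v v' /=; try by case.
by case: v v' => [x v] [x' v'] /= [-> /IH[-> ->]].
Qed.

Lemma ins_eq (C : finType) i d (c c' : C) (v v' : box C d) :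
  (ins i c v == ins i c' v') = (c == c') && (v == v').
Proof. by apply/eqP/andP => [/ins_inj[-> ->]|[/eqP-> /eqP->]]. Qed.

Lemma box_adj_ins (C : finType) (e : rel C) i d (c c' : C) (v v' : box C d) :
  box_adj e (ins i c v) (ins i c' v') =
  (e c c' && (v == v')) || ((c == c') && box_adj e v v').
Proof.
elim: i d v v' => [|i IH] [|d] v v' //.
case: v v' => [x v] [x' v'].
transitivity ((e x x' && (ins i c v == ins i c' v')) ||
  ((x == x') && box_adj e (ins i c v) (ins i c' v'))) => //.
rewrite IH ins_eq xpair_eqE /=.
by case: (x == x'); case: (c == c'); case: (v == v'); case: (e c c'); case: (e x x').
Qed.

Lemma bsite_ins (K C : finType) (st : K -> 'I_3 -> C) i d k t a y :
  bsite st (@ins K i d k t) (ins i a y) = ins i (st k a) (bsite st t y).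
Proof.
elim: i d t y => [|i IH] [|d] t y //.
transitivity ((st t.1 y.1, bsite st (ins i k t.2) (ins i a y.2)) : box C d.+2) => //.
by rewrite IH.
Qed.

Definition rot (C : finType) i d (y : box C d.+1) : box C d.+1 := ins i y.1 y.2.

Lemma rot_inj (C : finType) i d : injective (@rot C i d).
Proof. by move=> [c v] [c' v'] /ins_inj /= [-> ->]. Qed.

Lemma rot_bij (C : finType) i d : bijective (@rot C i d).
Proof. exact: injF_bij (@rot_inj C i d). Qed.

Lemma box_adj_rot (C : finType) (e : rel C) i d (v v' : box C d.+1) :
  box_adj e (rot i v) (rot i v') = box_adj e v v'.
Proof. exact: box_adj_ins. Qed.

Lemma bsite_rot (K C : finType) (st : K -> 'I_3 -> C) i d (t : box K d.+1) y :
  bsite st (rot i t) (rot i y) = rot i (bsite st t y).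
Proof. exact: bsite_ins. Qed.

Fixpoint bw (R : pzRingType) (C : finType) (om : C -> R) d : box C d -> R :=
  if d is d'.+1 then fun y => om y.1 * @bw R C om d' y.2 else fun _ => 1.

Lemma bw_ins (R : comPzRingType) (C : finType) (om : C -> R) i d c (v : box C d) :
  bw om (ins i c v) = om c * bw om v.
Proof.
elim: i d v => [|i IH] [|d] v //.
transitivity (om v.1 * bw om (ins i c v.2)) => //.
by rewrite IH mulrCA.
Qed.

Lemma sum_bw (R : comPzRingType) (C : finType) (om : C -> R) d :
  \sum_(v : box C d) bw om v = (\sum_c om c) ^+ d.
Proof.
elim: d => [|d IH]; first by rewrite (big_pred1 tt) => [|[]].
rewrite -(pair_bigA _ (fun c (v : box C d) => om c * bw om v)) /= exprS -IH mulr_suml.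
by apply: eq_bigr => c _; rewrite mulr_sumr.
Qed.

Lemma sum_pair (V : nmodType) (I J : finType) (F : I * J -> V) :
  \sum_p F p = \sum_i \sum_j F (i, j).
Proof. by rewrite pair_bigA; apply: eq_bigr => -[]. Qed.

(** If overlapping blocks weighted by [om] add up to the site weight [chi] in one direction, so do
    the product weights in all dimensions. This turns sums of block imbalances into the imbalance of
    the torus. *)
Lemma sum_bsite (R : comPzRingType) (K C : finType) (st : K -> 'I_3 -> C) (om : 'I_3 -> R) (chi : C -> R) :
  (forall G : C -> R, \sum_k \sum_a om a * G (st k a) = \sum_c chi c * G c) ->
  forall d (F : box C d -> R),
    \sum_t \sum_y bw om y * F (bsite st t y) = \sum_v bw chi v * F v.
Proof.
move=> H; elim=> [|d IH] F.
  by rewrite !(big_pred1 tt) => [||[]|[]].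
rewrite [RHS](sum_pair (fun v : C * box C d => bw chi (v : box C d.+1) * F v)) /=.
transitivity (\sum_c chi c * \sum_(v : box C d) bw chi v * F (c, v)); last first.
  by apply: eq_bigr => c _; rewrite mulr_sumr; apply: eq_bigr => v _; rewrite mulrA.
rewrite -H [LHS](sum_pair (fun t : K * box K d => \sum_y bw om y * F (@bsite K C st d.+1 t y))) /=.
apply: eq_bigr => k _.
transitivity (\sum_(t : box K d) \sum_a \sum_(y : box 'I_3 d) om a * bw om y * F (st k a, bsite st t y)).
  by apply: eq_bigr => t _; rewrite (sum_pair (fun y : 'I_3 * box 'I_3 d => bw om (y : box 'I_3 d.+1) * F _)).
rewrite exchange_big /=; apply: eq_bigr => a _; rewrite -IH mulr_sumr.
by apply: eq_bigr => t _; rewrite mulr_sumr; apply: eq_bigr => y _; rewrite mulrA.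
Qed.

Definition st_adj (K C : finType) (st : K -> 'I_3 -> C) : rel C := fun c c' =>
  [exists k, exists a, exists a', [&& path3 a a', st k a == c & st k a' == c']].

Lemma st_adjP (K C : finType) (st : K -> 'I_3 -> C) c c' :
  reflect (exists k a a', [/\ path3 a a', st k a = c & st k a' = c']) (st_adj st c c').
Proof.
apply: (iffP existsP) => [[k /existsP[a /existsP[a' /and3P[aa /eqP e /eqP e']]]]|[k [a [a' [aa e e']]]]].
  by exists k, a, a'.
by exists k; apply/existsP; exists a; apply/existsP; exists a'; rewrite aa e e' !eqxx.
Qed.

Lemma bsite_surj (K C : finType) (st : K -> 'I_3 -> C) :
  (forall c, exists k a, st k a = c) -> forall d (v : box C d), exists t y, bsite st t y = v.
Proof.
move=> sj; elim=> [[]|d IH [c v]]; first by exists tt, tt.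
have [k [a <-]] := sj c; have [t [y <-]] := IH v.
by exists (k, t), (a, y).
Qed.

Lemma box_adj_bsiteP (K C : finType) (st : K -> 'I_3 -> C) :
  (forall c, exists k a, st k a = c) -> forall d (v v' : box C d),
  reflect (exists t y y', [/\ box_adj path3 y y', bsite st t y = v & bsite st t y' = v'])
    (box_adj (st_adj st) v v').
Proof.
move=> sj d v v'; apply: (iffP idP); elim: d v v' => [|d IH] v v' //=; last 1 first.
- move=> [[k t] [[a y] [[a' y'] [/= aa <- <-]]]] /=.
  case/orP: aa => /andP[].
    move=> aa /eqP ->; apply/orP; left; rewrite eqxx andbT; apply/st_adjP.
    by exists k, a, a'.
  move=> /eqP -> yy; apply/orP; right; rewrite eqxx /=; apply: IH.
  by exists t, y, y'.
- case: v v' => [c v] [c' v'] /= /orP[/andP[/st_adjP[k [a [a' [aa <- <-]]]] /eqP <-]|].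
    have [t [y <-]] := bsite_surj sj v.
    by exists (k, t), (a, y), (a', y); split=> //=; rewrite aa eqxx.
  move=> /andP[/eqP <- /IH[t [y [y' [yy <- <-]]]]].
  have [k [a <-]] := sj c.
  by exists (k, t), (a, y), (a, y'); split=> //=; rewrite yy eqxx orbT.
by move=> [? [? [? []]]].
Qed.

Lemma all_block_hom (T : finType) (w : pred T) (h : rel T) (K C : finType) (st : K -> 'I_3 -> C) :
  (forall c, exists k a, st k a = c) -> forall d (x : {ffun box C d -> T}),
  [forall t : box K d, block_hom w h [ffun y => x (bsite st t y)]] =
  hom_on w h (@box_adj C (st_adj st) d) x.
Proof.
move=> sj d x; apply/forallP/hom_onP => [H|[H1 H2] t].
  split=> [v|v v' /(box_adj_bsiteP sj)[t [y [y' [yy <- <-]]]]].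
    have [t [y <-]] := bsite_surj sj v.
    by have /hom_onP[/(_ y) + _] := H t; rewrite ffunE.
  by have /hom_onP[_ /(_ y y' yy)] := H t; rewrite !ffunE.
apply/hom_onP; split=> [y|y y' yy]; rewrite !ffunE; first exact: H1.
by apply: H2; apply/(box_adj_bsiteP sj); exists t, y, y'.
Qed.

(** * Balanced configurations on the torus of side 4 *)

Definition hc : rel bool := fun a b => ~~ (a && b).

Lemma hc_sym : symmetric hc.
Proof. by move=> a b; rewrite /hc andbC. Qed.

Definition sgb (R : pzRingType) (b : bool) : R := (-1) ^+ b.

Fixpoint par n : box bool n -> bool :=
  if n is n'.+1 then fun v => v.1 (+) @par n' v.2 else fun _ => false.

Lemma bw_par (R : pzRingType) n (v : box bool n) : bw (sgb R) v = (-1) ^+ par v.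
Proof. by elim: n v => [|n IH] v //=; rewrite IH /sgb signr_addb. Qed.

Lemma par_adj n (v v' : box bool n) : cube_adj v v' -> par v' = ~~ par v.
Proof.
elim: n v v' => [|n IH] [] // b v [b' v'] /= /orP[/andP[/= bb /eqP /= ->]|/andP[/= /eqP -> /IH ->]].
  by rewrite -addNb; case: b bb; case: b'.
by rewrite addbN.
Qed.

Section CubePairs.
Variable n : nat.

(* Deleting the first coordinate maps each parity class of the cube bijectively onto [box bool n]. *)
Definition to_pair (u : {ffun box bool n.+1 -> bool}) : {set box bool n} * {set box bool n} :=
  ([set v | u (par v, v)], [set v | u (~~ par v, v)]).

Lemma to_pair_inj : injective to_pair.
Proof.
move=> u u' [/setP e1 /setP e2]; apply/ffunP => -[b v].
have := e1 v; have := e2 v; rewrite !inE.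
by case: (par v); case: b.
Qed.

Lemma to_pair_hc u : hom_on xpredT hc (@cube_adj n.+1) u -> to_pair u \in hc_pairs (@cube_cl n).
Proof.
move=> /hom_onP[_ H]; rewrite inE; apply/pred0P => v /=; apply/negP => /andP[].
rewrite inE => uv /nbsP[v']; rewrite inE => uv' /orP[/eqP e|vv'].
  have E : @cube_adj n.+1 (par v, v) (~~ par v, v) by rewrite /cube_adj /= eqxx; case: (par v).
  by rewrite e in uv'; have := H _ _ E; rewrite /hc uv uv'.
have E : @cube_adj n.+1 (par v', v') (~~ par v, v).
  by rewrite (par_adj vv') negbK /cube_adj /= eqxx; apply/orP; right.
by have := H _ _ E; rewrite /hc uv uv'.
Qed.

Lemma to_pair_imb (R : comPzRingType) u :
  #|(to_pair u).1|%:R - #|(to_pair u).2|%:R = \sum_y bw (sgb R) y * (u y)%:R.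
Proof.
rewrite (sum_pair (fun y : bool * box bool n => bw (sgb R) (y : box bool n.+1) * (u y)%:R)).
rewrite exchange_big /= -!sum1_card !natr_sum [X in X - _]big_mkcond [X in _ - X]big_mkcond -sumrB.
apply: eq_bigr => v _; rewrite big_bool /= bw_par !inE /sgb -!signr_addb.
by case: (par v) => /=; case: (u (true, v)); case: (u (false, v)); rewrite /= ?expr0 ?expr1 ?mulr1 ?mulr0 ?mul1r; ring.
Qed.

End CubePairs.

Definition cube_imb (R : pzRingType) n (u : {ffun box bool n -> bool}) : R :=
  \sum_y bw (sgb R) y * (u y)%:R.

Definition cube_ind n (A : pred {ffun box bool n -> bool}) : {set {ffun box bool n -> bool}} :=
  [set u | hom_on xpredT hc (@cube_adj n) u && A u].

Lemma cube_homs_ind n : cube_homs xpredT hc n = #|@cube_ind n xpredT|.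
Proof. by apply: eq_card => u; rewrite !inE andbT. Qed.

(** The edges in direction [i] are dropped, which decouples the two halves; the event concerns only
    one of them. *)
Lemma card_cube_split n i b (A : pred {ffun box bool n -> bool}) :
  (#|cube_ind (fun u : {ffun box bool n.+1 -> bool} => A [ffun v => u (ins i b v)])|
    <= #|cube_ind A| * #|@cube_ind n xpredT|)%N.
Proof.
pose F (u : {ffun box bool n.+1 -> bool}) :=
  ([ffun v => u (ins i b v)], [ffun v => u (ins i (~~ b) v)]) :
  {ffun box bool n -> bool} * {ffun box bool n -> bool}.
have Finj : injective F.
  move=> u u' [/ffunP e /ffunP e']; apply/ffunP => y.
  have [g gK Kg] := rot_bij bool i n; rewrite -(Kg y) /rot.
  have := e (g y).2; have := e' (g y).2; rewrite !ffunE.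
  by move: (g y).1; clear; case; case: (b).
rewrite -cardsX -(card_imset _ Finj); apply: subset_leq_card.
apply/subsetP => _ /imsetP[u + ->]; rewrite !inE /= => /andP[/hom_onP[_ H] Au].
have hs c : hom_on xpredT hc (@cube_adj n) [ffun v => u (ins i c v)].
  apply/hom_onP; split=> // v v' vv'; rewrite !ffunE; apply: H.
  by rewrite /cube_adj box_adj_ins eqxx; apply/orP; right.
by rewrite !hs Au.
Qed.

Section CubeBounds.
Variable R : realType.
Local Notation ln2 := (ln 2%:R : R).

Lemma cube_homs_bound : exists n0, forall n, (n0 <= n)%N ->
  #|@cube_ind n.+1 xpredT|%:R <= expR (ln2 * ((2 ^ n)%:R * (1 + (n%:R ^+ 5)^-1))).
Proof.
have [n0 H] := hc_pairs_cube_bound R; exists n0 => n nn.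
apply: le_trans (H n nn); rewrite ler_nat -(card_imset _ (@to_pair_inj n)).
apply: subset_leq_card; apply/subsetP => _ /imsetP[u + ->].
by rewrite inE => /andP[/to_pair_hc].
Qed.

Lemma cube_balanced_bound (e : R) : 0 < e -> e <= 1 / 2 -> exists n0, forall n, (n0 <= n)%N ->
  #|cube_ind (fun u : {ffun box bool n.+1 -> bool} => `|cube_imb R u| <= (1 / 2 - e) * (2 ^ n)%:R)|%:R
    <= expR (ln2 * ((2 ^ n)%:R * (1 - 1 / n%:R))).
Proof.
move=> e0 e1; have [n0 H] := hc_balanced_cube_bound e0 e1; exists n0 => n nn.
apply: le_trans (H n nn); rewrite ler_nat -(card_imset _ (@to_pair_inj n)).
apply: subset_leq_card; apply/subsetP => _ /imsetP[u + ->].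
by rewrite !inE => /andP[/to_pair_hc]; rewrite inE to_pair_imb => -> ->.
Qed.

End CubeBounds.

(* A Gray code: the cycle of length 4 is a square, with parity [b1 (+) b2]. *)
Definition code (b1 b2 : bool) : csite 2 := (if b1 then ord_max else ord0, b1 (+) b2).

Fixpoint ungray d : box bool d.*2 -> box (csite 2) d :=
  match d return box bool d.*2 -> box (csite 2) d with
  | 0 => fun _ => tt
  | d'.+1 => fun v : bool * (bool * box bool d'.*2) => (code v.1 v.2.1, @ungray d' v.2.2)
  end.

Lemma code_inj b1 b2 c1 c2 : code b1 b2 = code c1 c2 -> b1 = c1 /\ b2 = c2.
Proof. by case: b1; case: b2; case: c1; case: c2. Qed.

Lemma ungray_inj d : injective (@ungray d).
Proof.
elim: d => [|d IH]; first by move=> [] [].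
move=> [b1 [b2 v]] [c1 [c2 w]] e.
by have /= [-> ->] := code_inj (congr1 fst e); have /= -> := IH _ _ (congr1 snd e).
Qed.

Lemma ungray_bij d : bijective (@ungray d).
Proof.
apply: inj_card_bij (@ungray_inj d) _.
by rewrite !card_box card_bool card_prod card_ord card_bool -muln2 mulnC expnM.
Qed.

Lemma st_adj_sym (K C : finType) (st : K -> 'I_3 -> C) : symmetric (st_adj st).
Proof.
by move=> c c'; apply/st_adjP/st_adjP => -[k [a [a' [aa e e']]]];
  exists k, a', a; rewrite path3_sym.
Qed.

Lemma code_adj b1 b2 c1 c2 : (b1 != c1) && (b2 == c2) || (b1 == c1) && (b2 != c2) ->
  st_adj (@alt 2) (code b1 b2) (code c1 c2).
Proof.
have h1 : st_adj (@alt 2) (code false false) (code false true).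
  by apply/st_adjP; exists ord0, o0, o1; split=> //; apply/eqP.
have h2 : st_adj (@alt 2) (code false true) (code true true).
  by apply/st_adjP; exists ord0, o1, o2; split=> //; apply/eqP.
have h3 : st_adj (@alt 2) (code false false) (code true false).
  by apply/st_adjP; exists ord_max, o0, o1; split=> //; apply/eqP.
have h4 : st_adj (@alt 2) (code true true) (code true false).
  by apply/st_adjP; exists ord_max, o2, o1; split=> //; apply/eqP.
move: (st_adj_sym (@alt 2)) h1 h2 h3 h4; move: (st_adj (@alt 2)) => P sym h1 h2 h3 h4.
by case: b1; case: b2; case: c1; case: c2 => // _; rewrite sym.
Qed.

Lemma alt2_surj (c : csite 2) : exists k a, alt k a = c.
Proof.
case: c => -[[|[|]]] // lt [].
- by exists ord0, o1; apply/eqP.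
- by exists ord0, o0; apply/eqP.
- by exists ord_max, o1; apply/eqP.
- by exists ord0, o2; apply/eqP.
Qed.

Lemma ungray_adj d (v v' : box bool d.*2) : cube_adj v v' ->
  box_adj (st_adj (@alt 2)) (ungray v) (ungray v').
Proof.
elim: d v v' => [|d IH] // [b1 [b2 v]] [c1 [c2 w]].
rewrite /cube_adj /= xpair_eqE => /orP[/andP[h /andP[/eqP h2 /eqP ->]]|].
  by rewrite code_adj ?h ?h2 ?eqxx.
move=> /andP[/eqP -> /orP[/andP[h2 /eqP ->]|/andP[/eqP -> /IH vw]]].
  by rewrite code_adj ?h2 ?eqxx.
by rewrite eqxx; apply/orP; right.
Qed.

Definition chi (R : pzRingType) m (c : csite m) : R := sgb R c.2.

Lemma bw_ungray (R : pzRingType) d (v : box bool d.*2) :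
  bw (@chi R 2) (ungray v) = bw (sgb R) v.
Proof.
elim: d v => [|d IH] // [b1 [b2 v]].
transitivity (chi R (code b1 b2) * bw (@chi R 2) (ungray v)) => //.
rewrite IH /chi /sgb /= signr_addb -mulrA.
by [].
Qed.

Section Events.
Variable R : realType.
Local Notation ln2 := (ln 2%:R : R).

(* A site lying on [k] of the faces of a block is shared by [2 ^ k] blocks, whence the weights
   [1 / 2]; the signs are the parity signs. *)
Definition om3 : 'I_3 -> R := tri (1 / 2) (- 1) (1 / 2).
Definition sg3 : 'I_3 -> R := tri 1 (- 1) 1.

Definition lay d (a : 'I_3) (u : {ffun box 'I_3 d.+1 -> bool}) : R :=
  sg3 a * \sum_(y : box 'I_3 d) bw om3 y * (u (a, y))%:R.

(* The window [w] is a layer, counted twice, if [w.1 = w.2], and otherwise a pair of adjacent layers. *)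
Definition bal (e : R) d (w : 'I_3 * 'I_3) (u : {ffun box 'I_3 d.+1 -> bool}) : bool :=
  ((w.1 == w.2) || path3 w.1 w.2) &&
  (`|lay w.1 u + lay w.2 u| <= (1 / 4 - e) * 2 ^+ d.+1).

Lemma sum_alt2 (G : csite 2 -> R) :
  \sum_(k : 'I_2) \sum_(a : 'I_3) om3 a * G (alt k a) = \sum_c chi R c * G c.
Proof.
rewrite [RHS]sum_pair !big_ord_recl !big_ord0 !big_bool.
have e x y : x == y -> G x = G y by move/eqP ->.
rewrite (e (alt ord0 ord0) (ord0, false)) // (e (alt ord0 _) (ord0, true)) //.
rewrite (e (alt ord0 _) (lift ord0 ord0, false)) // (e (alt (lift ord0 ord0) ord0) (ord0, false)) //.
rewrite (e (alt _ (lift ord0 ord0)) (lift ord0 ord0, true)) // (e (alt (lift ord0 ord0) _) (lift ord0 ord0, false)) //.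
by rewrite /om3 /tri /chi /sgb /= !expr0 !expr1; clear; lra.
Qed.

Definition t4_ok d (x : {ffun box (csite 2) d -> bool}) :=
  hom_on xpredT hc (@box_adj _ (st_adj (@alt 2)) d) x.

Lemma t4_cube d (x : {ffun box (csite 2) d -> bool}) : t4_ok x ->
  hom_on xpredT hc (@cube_adj d.*2) [ffun v => x (ungray v)].
Proof.
move=> /hom_onP[_ H]; apply/hom_onP; split=> // v v' /ungray_adj vv'.
by rewrite !ffunE; apply: H.
Qed.

(** A layer of the torus of side 4 is again such a torus, hence a cube of dimension [d.*2], and the
    layers of the blocks add up to its signed imbalance. *)
Lemma sum_lay_t4 d a (x : {ffun box (csite 2) d.+1 -> bool}) :
  \sum_(t : box 'I_2 d) lay a [ffun y => x (bsite (@alt 2) ((ord0, t) : box 'I_2 d.+1) y)] =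
  sg3 a * \sum_(v : box bool d.*2) bw (sgb R) v * (x ((alt ord0 a, ungray v) : box (csite 2) d.+1))%:R.
Proof.
rewrite -mulr_sumr; congr (_ * _).
transitivity (\sum_(t : box 'I_2 d) \sum_(y : box 'I_3 d) bw om3 y *
   (x ((alt ord0 a, bsite (@alt 2) t y) : box (csite 2) d.+1))%:R).
  by apply: eq_bigr => t _; apply: eq_bigr => y _; rewrite ffunE.
rewrite (sum_bsite sum_alt2 (fun v => (x ((alt ord0 a, v) : box (csite 2) d.+1))%:R)).
have [g gK Kg] := ungray_bij d.
rewrite (reindex (@ungray d)) /=; last by exists g => v _.
by apply: eq_bigr => v _; rewrite bw_ungray.
Qed.

Definition bal4 e d w (x : {ffun box (csite 2) d.+1 -> bool}) :=
  [forall t : box 'I_2 d.+1, bal e w [ffun y => x (bsite (@alt 2) t y)]].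

Lemma bal4_sum e d w (x : {ffun box (csite 2) d.+1 -> bool}) : bal4 e w x ->
  `|\sum_(v : box bool d.*2) bw (sgb R) v *
     (sg3 w.1 * (x ((alt ord0 w.1, ungray v) : box (csite 2) d.+1))%:R +
      sg3 w.2 * (x ((alt ord0 w.2, ungray v) : box (csite 2) d.+1))%:R)|
    <= (1 / 4 - e) * (2 * 4 ^+ d).
Proof.
move=> /forallP H.
have -> : \sum_(v : box bool d.*2) bw (sgb R) v *
     (sg3 w.1 * (x ((alt ord0 w.1, ungray v) : box (csite 2) d.+1))%:R +
      sg3 w.2 * (x ((alt ord0 w.2, ungray v) : box (csite 2) d.+1))%:R) =
   \sum_(t : box 'I_2 d) (lay w.1 [ffun y => x (bsite (@alt 2) ((ord0, t) : box 'I_2 d.+1) y)] +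
     lay w.2 [ffun y => x (bsite (@alt 2) ((ord0, t) : box 'I_2 d.+1) y)]).
  rewrite big_split /= !sum_lay_t4 !mulr_sumr -big_split /=; apply: eq_bigr => v _.
  by rewrite mulrDr; congr (_ + _); rewrite mulrCA.
apply: le_trans (ler_norm_sum _ _ _) _.
apply: le_trans (_ : \sum_(t : box 'I_2 d) (1 / 4 - e) * 2 ^+ d.+1 <= _).
  by apply: ler_sum => t _; have /andP[_] := H (ord0, t).
rewrite sumr_const card_box card_ord -[leLHS]mulr_natr natrX le_eqVlt; apply/orP; left; apply/eqP.
by rewrite -mulrA exprS -mulrA -exprMn; congr (_ * (_ * _ ^+ _)); rewrite -natrM.
Qed.

Definition cube_bal n (th : R) (u : {ffun box bool n -> bool}) : bool := `|cube_imb R u| <= th.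

Lemma alt_code a : alt ord0 a = code (tri false false true a) (tri false true true a).
Proof. by apply/eqP; case: a => -[|[|[|]]]. Qed.


Fixpoint cbox (C : finType) (c : C) d : box C d := if d is d'.+1 then (c, cbox c d') else tt.

Let S d (u : {ffun box bool d.*2.+2 -> bool}) (b1 b2 : bool) : R :=
  \sum_(v : box bool d.*2) bw (sgb R) v * (u ((b1, (b2, v)) : box bool d.*2.+2))%:R.

Let imb d (u : {ffun box bool d.*2.+2 -> bool}) i b : cube_imb R [ffun v => u (ins i b v)] =
    \sum_(v : box bool d.*2) bw (sgb R) v * (u (ins i b ((false, v) : box bool d.*2.+1)))%:R -
    \sum_(v : box bool d.*2) bw (sgb R) v * (u (ins i b ((true, v) : box bool d.*2.+1)))%:R.
Proof.
rewrite /cube_imb [LHS](sum_pair (fun v : bool * box bool d.*2 =>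
  bw (sgb R) (v : box bool d.*2.+1) * ([ffun v => u (ins i b v)] (v : box bool d.*2.+1))%:R)).
rewrite big_bool /= [LHS]addrC -sumrN; congr (_ + _); apply: eq_bigr => v _;
by rewrite !ffunE /sgb ?expr0 ?expr1 ?mul1r // mulN1r mulNr.
Qed.

Let imb0 d (u : {ffun box bool d.*2.+2 -> bool}) b :
  cube_imb R [ffun v => u (ins 0 b v)] = S u b false - S u b true.
Proof. by rewrite imb. Qed.

Let imb1 d (u : {ffun box bool d.*2.+2 -> bool}) b :
  cube_imb R [ffun v => u (ins 1 b v)] = S u false b - S u true b.
Proof. by rewrite imb. Qed.

Let imb2 d (u : {ffun box bool d.*2.+2 -> bool}) b1 b2 :
  cube_imb R [ffun v => [ffun v' => u (ins 0 b1 v')] (ins 0 b2 v)] = S u b1 b2.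
Proof. by apply: eq_bigr => v _; rewrite !ffunE. Qed.

Definition as_cube d (x : {ffun box (csite 2) d.+1 -> bool}) : {ffun box bool d.*2.+2 -> bool} :=
  [ffun v => x (@ungray d.+1 v)].

Let bal4_S e d w (x : {ffun box (csite 2) d.+1 -> bool}) : bal4 e w x ->
  `|sg3 w.1 * S (as_cube x) (tri false false true w.1) (tri false true true w.1) +
    sg3 w.2 * S (as_cube x) (tri false false true w.2) (tri false true true w.2)|
   <= (1 / 4 - e) * (2 * 4 ^+ d).
Proof.
move/bal4_sum; rewrite !alt_code.
set A := (X in `|X| <= _ -> _); set B := (X in _ -> `|X| <= _).
suff -> : A = B by [].
rewrite /A /B !mulr_sumr -big_split /=; apply: eq_bigr => v _.
by rewrite mulrDr !ffunE; congr (_ + _); rewrite mulrCA.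
Qed.

Lemma t4_window e d w : (w.1 == w.2) || path3 w.1 w.2 ->
  (exists b1 b2, forall x : {ffun box (csite 2) d.+1 -> bool}, bal4 e w x ->
     cube_bal ((1 / 4 - e) * 4 ^+ d) [ffun v => [ffun v' => as_cube x (ins 0 b1 v')] (ins 0 b2 v)]) \/
  (exists i b, forall x : {ffun box (csite 2) d.+1 -> bool}, bal4 e w x ->
     cube_bal ((1 / 4 - e) * (2 * 4 ^+ d)) [ffun v => as_cube x (ins i b v)]).
Proof.
set th := (1 / 4 - e) * (2 * 4 ^+ d).
case/orP => [/eqP ww|].
  left; exists (tri false false true w.1), (tri false true true w.1) => x /bal4_S.
  rewrite -ww /cube_bal imb2 -mulr2n normrMn normrM.
  have -> : `|sg3 w.1| = 1.
    by rewrite /sg3 /tri; case: ifP => _; [|case: ifP => _]; rewrite ?normrN normr1.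
  by rewrite [1 * `|_|]mul1r mulrCA -[X in X <= _ -> _]mulr_natl ler_pM2l.
move=> ww; right.
suff [i [b H]] : exists i b, forall x : {ffun box (csite 2) d.+1 -> bool}, 
  `|sg3 w.1 * S (as_cube x) (tri false false true w.1) (tri false true true w.1) +
    sg3 w.2 * S (as_cube x) (tri false false true w.2) (tri false true true w.2)| =
   `|cube_imb R [ffun v => as_cube x (ins i b v)]|.
  by exists i, b => x /bal4_S; rewrite H.
move: w.1 w.2 ww; case=> -[|[|[|]]] // ?; case=> -[|[|[|]]] //= ? _;
  rewrite /sg3 /tri /=.
- by exists 0%N, false => x; rewrite imb0 mul1r mulN1r.
- by exists 0%N, false => x; rewrite imb0 mul1r mulN1r addrC.
- by exists 1%N, true => x; rewrite imb1 mul1r mulN1r -normrN opprD opprK.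
- by exists 1%N, true => x; rewrite imb1 mul1r mulN1r -normrN opprD opprK addrC.
Qed.

Lemma as_cube_inj d : injective (@as_cube d).
Proof.
move=> x x' /ffunP e; apply/ffunP => v; have [g gK Kg] := ungray_bij d.+1.
by have := e (g v); rewrite !ffunE Kg.
Qed.

Lemma t4_card e d w :
  (#|[set x : {ffun box (csite 2) d.+1 -> bool} | t4_ok x && bal4 e w x]| <=
    maxn (#|cube_ind (@cube_bal d.*2 ((1 / 4 - e) * 4 ^+ d))| * #|@cube_ind d.*2 xpredT| * #|@cube_ind d.*2.+1 xpredT|)
     (#|cube_ind (@cube_bal d.*2.+1 ((1 / 4 - e) * (2 * 4 ^+ d)))| * #|@cube_ind d.*2.+1 xpredT|))%N.
Proof.
set A := @cube_bal d.*2 _; set B := @cube_bal d.*2.+1 _.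
have [cw|nw] := boolP ((w.1 == w.2) || path3 w.1 w.2); last first.
  rewrite (_ : [set x | _] = set0) ?cards0 //; apply/setP => x; rewrite !inE.
  apply/negP => /andP[_ /forallP/(_ (cbox ord0 d.+1))/andP[cw _]].
  by rewrite cw in nw.
rewrite -(card_imset _ (@as_cube_inj d)) leq_max.
have [[b1 [b2 H]]|[i [b H]]] := @t4_window e d w cw; apply/orP; [left|right].
  pose A1 (u : {ffun box bool d.*2.+1 -> bool}) := A [ffun v => u (ins 0 b2 v)].
  apply: leq_trans (_ : #|cube_ind A1| * #|@cube_ind d.*2.+1 xpredT| <= _)%N; last first.
    by rewrite leq_mul2r card_cube_split orbT.
  apply: leq_trans (card_cube_split 0 b1 A1); apply: subset_leq_card.
  apply/subsetP => _ /imsetP[x + ->]; rewrite !inE => /andP[/(@t4_cube d.+1) -> /H].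
  exact.
apply: leq_trans (card_cube_split i b B); apply: subset_leq_card.
by apply/subsetP => _ /imsetP[x + ->]; rewrite !inE => /andP[/(@t4_cube d.+1) -> /H].
Qed.

End Events.

Section T4Bound.
Variable R : realType.
Local Notation ln2 := (ln 2%:R : R).

(** The relative gain [1 / n] on the balanced subcube outweighs the relative errors [1 / n ^ 5] on
    all subcubes, as their sizes are comparable. *)
Lemma t4_bound (e : R) : 0 < e -> e <= 1 / 4 -> exists d0, forall d, (d0 <= d)%N -> forall w,
  #|[set x : {ffun box (csite 2) d.+1 -> bool} | t4_ok x && bal4 e w x]|%:R <=
    expR (ln2 * (4 ^+ d.+1 * (1 / 2 - 1 / (32 * d.+1%:R)))).
Proof.
move=> e0 e1.
have e20 : 0 < 2 * e by rewrite mulr_gt0.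
have e21 : 2 * e <= 1 / 2 by move: e1; clear; lra.
have [n1 H1] := cube_homs_bound R; have [n2 H2] := cube_balanced_bound e20 e21.
exists (n1 + n2 + 2)%N => d dd w.
apply: le_trans (_ : (maxn _ _)%:R <= _); first by rewrite ler_nat; apply: t4_card.
set n' := d.*2.-1.
have nE : d.*2 = n'.+1 by rewrite prednK // double_gt0; move: dd; clear; lia.
have nn' : (n1 + n2 + 3 <= n'.+1)%N by rewrite -nE; move: dd; clear; lia.
rewrite nE; pose M : R := (2 ^ n')%:R.
have M0 : 0 < M by rewrite ltr0n expn_gt0.
have d4 : 4 ^+ d = 2 * M.
  by rewrite /M -natrM -expnS -nE -muln2 mulnC expnM natrX.
(* A fraction [1 / 4 - e] of a cube is a fraction [1 / 2 - 2 * e] of one parity class, the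
   normalisation of [cube_balanced_bound]. *)
have th1 : (1 / 4 - e) * 4 ^+ d = (1 / 2 - 2 * e) * (2 ^ n')%:R.
  by rewrite d4 -/M; clear; field.
have th2 : (1 / 4 - e) * (2 * 4 ^+ d) = (1 / 2 - 2 * e) * (2 ^ n'.+1)%:R.
  by rewrite d4 expnS natrM -/M; clear; field.
pose y : R := n'%:R^-1; pose z : R := n'.+1%:R^-1; pose g : R := d.+1%:R^-1.
have N0 : 0 < n'%:R :> R by rewrite ltr0n; move: nn'; clear; lia.
have y0 : 0 < y by rewrite invr_gt0.
have z0 : 0 < z by rewrite invr_gt0 ltr0n.
have y3 : y <= 1 / 3.
  rewrite /y -[1 / 3]invf_div divr1 lef_pV2 ?posrE // ?divr1 ?ltr0n //.
  by rewrite (ler_nat R 3); move: dd; rewrite /n'; clear; lia.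
have zy : z <= y by rewrite lef_pV2 ?posrE ?ler_nat // ltr0n.
have gz : g <= 2 * z.
  have d0 : 0 < d%:R :> R by rewrite ltr0n; move: dd; clear; lia.
  have -> : 2 * z = d%:R^-1 by rewrite /z -nE -muln2 natrM; move: (gt_eqF d0); clear => dn; field; rewrite dn.
  by rewrite lef_pV2 ?posrE ?ler_nat // ltr0n.
have pw (x : R) : 0 < x -> x <= 1 / 3 -> x ^+ 5 <= x / 81.
  move=> x0 x3; rewrite exprS ler_pM2l //.
  have -> : 81^-1 = (1 / 3) ^+ 4 :> R by clear; field.
  by rewrite lerXn2r // nnegrE; [exact: ltW|rewrite divr_ge0].
have y5 := pw y y0 y3; have z5 := pw z z0 (le_trans zy y3).
have l0 := ln2_gt0 R.
have tgt : 4 ^+ d.+1 * (1 / 2 - 1 / (32 * d.+1%:R)) = 4 * M - M / 4 * g.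
  by rewrite exprS d4 /g; clear; field; rewrite addrC natr1 pnatr_eq0.
rewrite tgt.
have A1 := H2 n' _; have A2 := H1 n' _; have A3 := H1 n'.+1 _; have A4 := H2 n'.+1 _.
rewrite /maxn; case: ifP => _; rewrite !natrM.
  apply: le_trans (_ : expR (ln2 * (2 * M * (1 - z))) * expR (ln2 * (2 * M * (1 + z ^+ 5))) <= _).
    apply: ler_pM => //.
      by rewrite th2 /M -natrM -expnS /z -[n'.+1%:R^-1]div1r; apply: A4; move: nn'; clear; lia.
    by rewrite /M -natrM -expnS /z exprVn; apply: A3; move: nn'; clear; lia.
  rewrite -expRD ler_expR -mulrDr ler_pM2l // -mulrDr.
  have : M * (g / 4) <= M * (2 * (z - z ^+ 5)).
    by rewrite ler_pM2l //; move: gz z5 z0; clear; lra.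
  by clear; lra.
apply: le_trans (_ : expR (ln2 * (M * (1 - y))) * expR (ln2 * (M * (1 + y ^+ 5))) *
   expR (ln2 * (2 * M * (1 + z ^+ 5))) <= _).
  apply: ler_pM; rewrite ?mulr_ge0 //; last first.
    by rewrite /M -natrM -expnS /z exprVn; apply: A3; move: nn'; clear; lia.
  apply: ler_pM => //.
    by rewrite th1 /M /y -[n'%:R^-1]div1r; apply: A1; move: nn'; clear; lia.
  by rewrite /M /y exprVn; apply: A2; move: nn'; clear; lia.
rewrite -!expRD ler_expR -!mulrDr ler_pM2l //.
have : M * (g / 4) <= M * (y - y ^+ 5 - 2 * z ^+ 5).
  by rewrite ler_pM2l //; move: gz zy y5 z5 z0; clear; lra.
by clear; lra.
Qed.

End T4Bound.

(** * Dissemination of bad blocks *)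

Section Chess.
Variable R : realType.
Local Notation ln2 := (ln 2%:R : R).

Definition blk (K C : finType) (st : K -> 'I_3 -> C) d (t : box K d)
    (x : {ffun box C d -> bool}) : {ffun box 'I_3 d -> bool} := [ffun y => x (bsite st t y)].

Definition hardcore (K C : finType) (st : K -> 'I_3 -> C) d (x : {ffun box C d -> bool}) : bool :=
  [forall t : box K d, block_hom xpredT hc (blk st t x)].

Lemma sys_card (K C : finType) (st : K -> 'I_3 -> C) d (g : box K d -> pred {ffun box 'I_3 d -> bool}) :
  sys st (fun t u => (g t u)%:R) = #|[set x | [forall t, g t (blk st t x)]]|%:R :> R.
Proof.
rewrite -sum1_card natr_sum [RHS]big_mkcond /=; apply: eq_bigr => x _.
by rewrite prod_bool inE /blk; case: [forall t, _].
Qed.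

(** Permuting coordinates is a symmetry of the torus, so windows in direction [i] reduce to windows
    in the first direction. *)
Lemma sys_alt2_rot d i (g : pred {ffun box 'I_3 d.+1 -> bool}) :
  sys (@alt 2) (fun (_ : box 'I_2 d.+1) u =>
      (block_hom xpredT hc u && g [ffun y => u (rot i y)])%:R) =
  #|[set x : {ffun box (csite 2) d.+1 -> bool} | t4_ok x && [forall t, g (blk (@alt 2) t x)]]|%:R :> R.
Proof.
rewrite (sys_card _ (fun _ u => block_hom xpredT hc u && g [ffun y => u (rot i y)])).
congr _%:R; have [q qK Kq] := rot_bij (csite 2) i d; have [q' qK' Kq'] := rot_bij 'I_2 i d.
pose F (x : {ffun box (csite 2) d.+1 -> bool}) : {ffun box (csite 2) d.+1 -> bool} :=
  [ffun v => x (q v)].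
have Fi : injective F.
  by move=> x x' /ffunP e; apply/ffunP => v; have := e (rot i v); rewrite !ffunE qK.
rewrite -[RHS](card_imset _ Fi); apply: eq_card => z.
have -> : z = F [ffun v => z (rot i v)] by apply/ffunP => v; rewrite !ffunE Kq.
rewrite (mem_imset _ _ Fi) !inE; move: [ffun v => z (rot i v)] => x.
transitivity (hardcore (@alt 2) (F x) &&
   [forall t, g [ffun y => blk (@alt 2) t (F x) (rot i y)]]).
  apply/forallP/andP => [H|[/forallP H1 /forallP H2] t]; last by rewrite H1 H2.
  by split; apply/forallP => t; have /andP[] := H t.
congr (_ && _).
  rewrite /hardcore /blk (all_block_hom _ _ alt2_surj).
  apply/hom_onP/hom_onP => -[_ H]; split=> // v v' vv'.
    by have := H (rot i v) (rot i v'); rewrite box_adj_rot !ffunE !qK => /(_ vv').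
  by rewrite !ffunE; apply: H; rewrite -(box_adj_rot _ i) !Kq.
have e t : [ffun y => blk (@alt 2) (rot i t) (F x) (rot i y)] = blk (@alt 2) t x.
  by apply/ffunP => y; rewrite !ffunE bsite_rot qK.
apply/forallP/forallP => H t; first by have := H (rot i t); rewrite e.
by rewrite -(Kq' t) e.
Qed.

(** The ground states of the hard-core model: one class is free, the other empty. *)
Definition hc_sides (b : bool) : {set bool} := if b then setT else [set false].

Lemma hc_sides_biclique : biclique xpredT hc hc_sides.
Proof. by split=> // b a a'; rewrite /hc; case: b; case: a; case: a'; rewrite !inE. Qed.

Lemma card_hc_sides : (#|hc_sides true| * #|hc_sides false|)%:R = expR (2 * (ln2 / 2)).
Proof.
rewrite /hc_sides cardsT cards1 card_bool muln1 (_ : 2 * (ln2 / 2) = ln2); last by field.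
by rewrite lnK // posrE ltr0n.
Qed.

(** By [chessboard] the count is bounded by a product over blocks. For a block of [A], the
    assumption on the torus of side 4 is set against the ground state bound for [Zp], which saves
    [del * (2 * p) ^ d] in the exponent; the other blocks contribute [Zp]. Then [hom_sys_compare]
    replaces [Zp] by [Zm] at the cost of the term with [mu]. *)
Lemma chess_events d m (g : box 'I_m d -> pred {ffun box 'I_3 d -> bool}) (A : {set box 'I_m d})
    (del mu : R) : (1 < m)%N ->
  (forall t, sys (@alt 2) (fun (_ : box 'I_2 d) u => (block_hom xpredT hc u && g t u)%:R)
     <= expR (4 ^+ d * (ln2 / 2 - del))) ->
  0 <= mu -> (cube_homs xpredT hc d)%:R <= expR (ln2 / 2 * 2 ^+ d + mu) ->
  #|[set x | hardcore (@cyc m) x && [forall t in A, g t (blk (@cyc m) t x)]]|%:R <=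
  #|[set x : {ffun box (csite m) d -> bool} | hardcore (@cyc m) x]|%:R *
    expR (9 * d%:R * mu * m%:R ^+ d / m%:R ^+ 2 - del * 2 ^+ d * #|A|%:R).
Proof.
move=> m1 H mu0 cub; pose j := m./2; pose p := (2 * j)%N.
have pm : (p <= m)%N by rewrite /p /j mul2n -{2}(odd_double_half m) leq_addl.
have j0 : (0 < j)%N by rewrite half_gt0.
have p1 : (1 < p)%N by rewrite /p; move: j0; clear; lia.
have p0 : 0 < p%:R :> R by rewrite ltr0n ltnW.
have m0 : 0 < m%:R :> R by rewrite ltr0n ltnW.
(* For odd [m] one has [p = m - 1], and [(m - 1) * (m - 2) >= 2 / 9 * m ^ 2] for [m >= 3], with
   equality at [3]. *)
pose kap : R := 9 / 2 / m%:R ^+ 2.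
have kap0 : 0 <= kap by rewrite divr_ge0 ?divr_ge0 ?exprn_ge0.
have kapm : m%:R - p%:R <= kap * (p%:R * (m%:R - 2)).
  have m2 : 2 <= m%:R :> R by rewrite (ler_nat R 2).
  case: (boolP (odd m)) => om; last first.
    have mp : m%:R = p%:R :> R by rewrite /p /j mul2n -{1}(odd_double_half m) (negbTE om).
    by rewrite -mp subrr mulr_ge0 // mulr_ge0 // subr_ge0.
  have m3 : 3 <= m%:R :> R.
    by rewrite (ler_nat R 3) ltn_neqAle m1 andbT; apply/eqP => e; rewrite -e in om.
  have mp : m%:R = p%:R + 1 :> R.
    by rewrite /p /j mul2n -{1}(odd_double_half m) om addnC natrD.
  have -> : p%:R = m%:R - 1 :> R by rewrite mp addrK.
  rewrite /kap mulrAC ler_pdivlMr ?exprn_gt0 // opprB addrC subrK mul1r.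
  by move: m3; clear; nra.
have lowp := ln_hom_sys_lower p d hc_sides_biclique card_hc_sides.
have lowm := ln_hom_sys_lower m d hc_sides_biclique card_hc_sides.
have cmp := hom_sys_compare p1 pm kapm kap0 hc_sym hc_sides_biclique card_hc_sides mu0 cub.
set Zp := hom_sys R _ _ (@cyc p) d in lowp cmp *.
set Zm := hom_sys R _ _ (@cyc m) d in lowm cmp *.
have ZmE : Zm = #|[set x : {ffun box (csite m) d -> bool} | hardcore (@cyc m) x]|%:R.
  by rewrite /Zm /hom_sys (sys_card (@cyc m) (fun _ : box _ d => @block_hom bool xpredT hc d)).
rewrite -ZmE.
pose f t (u : {ffun box 'I_3 d -> bool}) : R := (block_hom xpredT hc u && ((t \in A) ==> g t u))%:R.
have f0 t u : 0 <= f t u by [].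
have cb := chessboard j0 pm f0.
have fE : sys (@cyc m) f = #|[set x | hardcore (@cyc m) x && [forall t in A, g t (blk (@cyc m) t x)]]|%:R.
  rewrite (sys_card _ (fun t u => block_hom xpredT hc u && ((t \in A) ==> g t u))).
  congr _%:R; apply: eq_card => x; rewrite !inE.
  apply/forallP/andP => [h|[/forallP h1 /forallP h2] t]; last by rewrite h1 h2.
  by split; apply/forallP => t; have /andP[] := h t.
rewrite -fE; set X := expR _.
have pd : (0 < p ^ d)%N by rewrite expn_gt0 ltnW.
have pdR : 0 < p%:R ^+ d :> R by rewrite exprn_gt0.
have md : 0 < m%:R ^+ d :> R by rewrite exprn_gt0.
rewrite -(ler_pXn2r pd) ?nnegrE ?sys_ge0 ?mulr_ge0 ?expR_ge0 ?ler0n //; last first.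
  by rewrite ltW // lowm.1.
apply: le_trans cb _.
have each t : 0 <= sys (@alt p) (fun _ => f t) <= Zp * expR (- (p%:R ^+ d * 2 ^+ d * del)) ^+ (t \in A).
  rewrite sys_ge0 //=; case: (boolP (t \in A)) => tA.
    rewrite expr1; apply: le_trans (sys_alt_le j0 (f0 t)) _.
    apply: le_trans (_ : expR (4 ^+ d * (ln2 / 2 - del)) ^+ (j ^ d) <= _).
      rewrite lerXn2r ?nnegrE ?sys_ge0 ?expR_ge0 //; apply: le_trans (H t).
      by rewrite /f tA.
    rewrite -[Zp]lnK ?posrE ?lowp.1 // -expRD -expRM_natl ler_expR.
    have := lowp.2; rewrite -/Zp.
    have -> : (j ^ d)%:R * (4 ^+ d * (ln2 / 2 - del)) =
       ln2 / 2 * (2 * p%:R) ^+ d - p%:R ^+ d * 2 ^+ d * del.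
      rewrite natrX mulrA -exprMn (_ : j%:R * 4 = 2 * p%:R); last by rewrite /p natrM; clear; ring.
      by rewrite mulrBr mulrC -[p%:R ^+ d * _]exprMn [p%:R * 2]mulrC.
    by clear; lra.
  rewrite expr0 mulr1 le_eqVlt /Zp -(hom_sys_alt R d xpredT hc p) /hom_sys.
  apply/orP; left; apply/eqP; apply: eq_bigr => x _; apply: eq_bigr => t' _.
  by rewrite /f (negbTE tA) andbT.
apply: le_trans (_ : \prod_t (Zp * expR (- (p%:R ^+ d * 2 ^+ d * del)) ^+ (t \in A)) <= _).
  by apply: ler_prod => t _; exact: each.
rewrite big_split /= prodr_const card_box card_ord prodrXr.
have -> : (\sum_t (t \in A))%N = #|A| by rewrite -sum1_card [RHS]big_mkcond; apply: eq_bigr => t _; case: (t \in A).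
rewrite -[Zp]lnK ?posrE ?lowp.1 // -[Zm in X in _ <= X]lnK ?posrE ?lowm.1 //.
rewrite -expRD -!expRM_natl -!expRD ler_expR !natrX.
have := ler_wpM2l (ltW md) (ler_wpM2l (ltW pdR) cmp).
have -> : m%:R ^+ d * (p%:R ^+ d * (ln Zp / p%:R ^+ d)) = m%:R ^+ d * ln Zp.
  by congr (_ * _); rewrite mulrC divfK // gt_eqF.
have -> : m%:R ^+ d * (p%:R ^+ d * (ln Zm / m%:R ^+ d + 2 * d%:R * mu * kap)) =
    p%:R ^+ d * (ln Zm + 9 * d%:R * mu * m%:R ^+ d / m%:R ^+ 2).
  by rewrite /kap; move: (gt_eqF md) (gt_eqF m0); clear => h1 h2; field; rewrite h1 h2.
by clear; lra.
Qed.

End Chess.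

(** * Phases of good blocks *)

Fixpoint tobox (C : finType) d : {ffun 'I_d -> C} -> box C d :=
  match d return {ffun 'I_d -> C} -> box C d with
  | 0 => fun _ => tt
  | d'.+1 => fun f => (f ord0, @tobox C d' [ffun j => f (lift ord0 j)])
  end.

Lemma tobox_inj (C : finType) d : injective (@tobox C d).
Proof.
elim: d => [|d IH] f g; first by move=> _; apply/ffunP => -[].
move=> e; apply/ffunP => j; case: (unliftP ord0 j) => [j' ->|->]; last exact: (congr1 fst e).
by have /ffunP/(_ j') := IH _ _ (congr1 snd e); rewrite !ffunE.
Qed.

Lemma tobox_bij (C : finType) d : bijective (@tobox C d).
Proof.
apply: inj_card_bij (@tobox_inj C d) _.
by rewrite card_box card_ffun card_ord.
Qed.

Lemma tobox_ins (C : finType) d (i : 'I_d.+1) (f : {ffun 'I_d.+1 -> C}) :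
  tobox f = ins i (f i) (tobox [ffun j => f (lift i j)]).
Proof.
elim: d i f => [|d IH] i f.
  by rewrite (ord1 i) /=.
case: (unliftP ord0 i) => [i' ->|->]; last first.
  by [].
transitivity ((f ord0, tobox [ffun j => f (lift ord0 j)]) : box C d.+2) => //.
rewrite (IH i') !ffunE.
transitivity ((([ffun j => f (lift (lift ord0 i') j)] : {ffun 'I_d.+1 -> C}) ord0,
  ins i' (f (lift ord0 i')) (tobox [ffun j => [ffun j => f (lift (lift ord0 i') j)] (lift ord0 j)])) : box C d.+2) => //.
have e0 : lift (lift ord0 i') ord0 = ord0 by apply/val_inj.
have e1 j : lift (lift ord0 i') (lift ord0 j) = lift ord0 (lift i' j).
  by apply/val_inj; rewrite /= /bump /= !add1n ltnS; case: (i' <= j)%N.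
rewrite ffunE e0; congr (_, ins _ _ (tobox _)).
by apply/ffunP => j; rewrite !ffunE e1.
Qed.

Lemma tobox_point d m (i : 'I_d.+1) (l : lines d m) a :
  tobox (point i l a) = ins i a (tobox l).
Proof.
rewrite (tobox_ins i) point_at; congr (ins _ _ (tobox _)).
by apply/ffunP => j; rewrite !ffunE liftK.
Qed.

Section Blocks.
Variable R : realType.
Local Notation ln2 := (ln 2%:R : R).
Local Notation om3 := (@om3 R).
Local Notation lay := (@lay R _).

Definition block_imb d (u : {ffun box 'I_3 d -> bool}) : R := \sum_y bw om3 y * (u y)%:R.

Lemma norm_bw (C : finType) (om : C -> R) d (y : box C d) : `|bw om y| = bw (fun a => `|om a|) y.
Proof. by elim: d y => [|d IH] y /=; rewrite ?normr1 // normrM IH. Qed.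

(** The weights add up to [0] and their absolute values to [2 ^ d], so the positive weights add up
    to half of that, and so do the negative ones in absolute value. *)
Lemma block_imb_le d (u : {ffun box 'I_3 d -> bool}) : (0 < d)%N -> `|block_imb u| <= 2 ^+ d / 2.
Proof.
move=> d0; have s0 : \sum_(y : box 'I_3 d) bw om3 y = 0.
  rewrite sum_bw !big_ord_recl big_ord0 /om3 /tri /= addr0.
  by rewrite (_ : _ + _ = 0) ?expr0n ?gtn_eqF //; lra.
have s1 : \sum_(y : box 'I_3 d) `|bw om3 y| = 2 ^+ d.
  rewrite (eq_bigr _ (fun y _ => norm_bw om3 y)) sum_bw !big_ord_recl big_ord0 /om3 /tri /= addr0.
  by rewrite normrN normr1 ger0_norm ?divr_ge0 //; congr (_ ^+ _); lra.
have up : block_imb u <= \sum_(y : box 'I_3 d) (`|bw om3 y| + bw om3 y) / 2.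
  apply: ler_sum => y _; have := ler_norm (bw om3 y); have := normr_ge0 (bw om3 y).
  by have := ler_norm (- bw om3 y); rewrite normrN; case: (u y); rewrite ?mulr1 ?mulr0; lra.
have lo : - block_imb u <= \sum_(y : box 'I_3 d) (`|bw om3 y| - bw om3 y) / 2.
  rewrite -sumrN; apply: ler_sum => y _; have := ler_norm (bw om3 y); have := normr_ge0 (bw om3 y).
  by have := ler_norm (- bw om3 y); rewrite normrN; case: (u y); rewrite ?mulr1 ?mulr0; lra.
rewrite -mulr_suml big_split /= s0 s1 addr0 in up.
rewrite -mulr_suml big_split /= sumrN s0 s1 subr0 in lo.
by rewrite ler_norml up andbT; move: lo; lra.
Qed.

Lemma lay_le d a (u : {ffun box 'I_3 d.+1 -> bool}) : (0 < d)%N -> `|lay a u| <= 2 ^+ d / 2.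
Proof.
move=> d0; rewrite normrM (_ : `|sg3 R a| = 1).
  rewrite mul1r; have := block_imb_le [ffun y : box 'I_3 d => u ((a, y) : box 'I_3 d.+1)] d0.
  by rewrite /block_imb; under eq_bigr do rewrite ffunE.
by rewrite /sg3 /tri; case: ifP => _; [|case: ifP => _]; rewrite ?normrN normr1.
Qed.

Lemma block_imb_lay d i (u : {ffun box 'I_3 d.+1 -> bool}) :
  block_imb u = (lay o0 [ffun y => u (rot i y)] + lay o2 [ffun y => u (rot i y)]) / 2 +
                lay o1 [ffun y => u (rot i y)].
Proof.
have [q qK Kq] := rot_bij 'I_3 i d.
rewrite /block_imb (reindex (@rot 'I_3 i d)) /=; last by exists q => y _.
rewrite [LHS](sum_pair (fun y : 'I_3 * box 'I_3 d => bw om3 (@rot 'I_3 i d y) * (u (@rot 'I_3 i d y))%:R)).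
have e a : \sum_(y : box 'I_3 d) bw om3 (@rot 'I_3 i d (a, y)) * (u (@rot 'I_3 i d (a, y)))%:R =
   om3 a * sg3 R a * lay a [ffun y => u (rot i y)].
  have s1 : sg3 R a * sg3 R a = 1.
    by rewrite /sg3 /tri; case: ifP => _; [|case: ifP => _]; rewrite ?mulrNN mulr1.
  rewrite /lay mulrA -[_ * _ * sg3 R a]mulrA s1 mulr1 mulr_sumr.
  by apply: eq_bigr => y _; rewrite ffunE mulrA -(bw_ins om3 i).
rewrite !big_ord_recl big_ord0 addr0 !e.
have -> : lift ord0 ord0 = o1 :> 'I_3 by apply/val_inj.
have -> : lift ord0 (lift ord0 ord0) = o2 :> 'I_3 by apply/val_inj.
rewrite (_ : ord0 = o0); last exact/val_inj.
by rewrite /om3 /sg3 /tri /=; lra.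
Qed.

Definition bad_block (e : R) d (u : {ffun box 'I_3 d.+1 -> bool}) : bool :=
  [exists r : 'I_d.+1 * ('I_3 * 'I_3), bal e r.2 [ffun y => u (rot r.1 y)]].

(** Opposite signs would give [x + y] an absolute value of at most [M / 2 - t <= 2 * t], against the
    condition on the pair. *)
Lemma same_side (x y t M : R) : - (M / 2) <= x -> x <= M / 2 -> - (M / 2) <= y -> y <= M / 2 ->
  (2 * t < x + x) || (2 * t < - (x + x)) -> (2 * t < y + y) || (2 * t < - (y + y)) ->
  (2 * t < x + y) || (2 * t < - (x + y)) -> M <= 6 * t ->
  (t < x /\ t < y) \/ (x < - t /\ y < - t).
Proof.
move=> x1 x2 y1 y2 /orP[] gx /orP[] gy /orP[] gxy tM;
  by [left; split; lra|right; split; lra|exfalso; lra].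
Qed.

(** Windows of one layer push every layer beyond [t] in absolute value, and windows of two layers
    make the signs of the three layers agree. Different directions agree because the layers in each
    of them determine the imbalance of the same block. [e <= 1 / 12] makes [t] at least a sixth of
    [2 ^ d], as [same_side] requires. *)
Lemma good_block e d (u : {ffun box 'I_3 d.+1 -> bool}) : (0 < d)%N -> e <= 1 / 12 ->
  ~~ bad_block e u ->
  if 0 < block_imb u
  then (1 / 4 - e) * 2 ^+ d.+1 <= block_imb u /\
       forall (i : 'I_d.+1) a, 0 < lay a [ffun y => u (rot i y)]
  else block_imb u <= - ((1 / 4 - e) * 2 ^+ d.+1) /\
       forall (i : 'I_d.+1) a, lay a [ffun y => u (rot i y)] < 0.
Proof.
move=> d0 e12; rewrite negb_exists => /forallP good.
set M : R := 2 ^+ d; have M0 : 0 < M by rewrite exprn_gt0.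
pose t := (1 / 4 - e) * M.
have tM : M <= 6 * t by rewrite /t mulrA -[leLHS]mul1r ler_pM2r //; move: e12; lra.
have t0 : 0 < t by move: tM M0; lra.
have key (i : 'I_d.+1) : let L a := lay a [ffun y => u (rot i y)] in
   (forall a, t < L a) \/ (forall a, L a < - t).
  move=> L.
  have g w : (w.1 == w.2) || path3 w.1 w.2 -> (1 / 4 - e) * 2 ^+ d.+1 < `|L w.1 + L w.2|.
    by move=> cw; have := good (i, w); rewrite /bal cw /= -ltNge.
  rewrite exprS mulrCA -/M -/t in g.
  have b a : `|L a| <= M / 2 := lay_le _ _ d0.
  have := g (o0, o1) isT; have := g (o1, o2) isT.
  have := g (o0, o0) isT; have := g (o1, o1) isT; have := g (o2, o2) isT.
  have := b o0; have := b o1; have := b o2 => /=.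
  rewrite !ler_norml !ltr_normr => /andP[b1 b2] /andP[b3 b4] /andP[b5 b6].
  have h a (P : 'I_3 -> Prop) : P o0 -> P o1 -> P o2 -> P a.
    by case: a => -[|[|[|]]] // lt; [rewrite (_ : Ordinal lt = o0)|rewrite (_ : Ordinal lt = o1)|
      rewrite (_ : Ordinal lt = o2)] => //; apply/val_inj.
  move=> g2 g1 g0 g12 g01.
  have [[h0 h1]|[h0 h1]] := same_side b5 b6 b3 b4 g0 g1 g01 tM;
    have [[h1' h2]|[h1' h2]] := same_side b3 b4 b1 b2 g1 g2 g12 tM.
  - by left=> a; apply: (h a (fun a => is_true (t < L a))).
  - by exfalso; move: t0 h1 h1'; lra.
  - by exfalso; move: t0 h1 h1'; lra.
  - by right=> a; apply: (h a (fun a => is_true (L a < - t))).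
have t2 : (1 / 4 - e) * 2 ^+ d.+1 = 2 * t by rewrite exprS mulrCA.
have [h|h] := key (@ord0 d); have := block_imb_lay (@ord0 d) u => E; rewrite t2.
  have := h o0; have := h o1; have := h o2 => h2 h1 h0.
  have -> : 0 < block_imb u by rewrite E; move: h0 h1 h2 t0; lra.
  split; first by rewrite E; move: h0 h1 h2 t0; lra.
  move=> i a; have [k|k] := key i; first exact: lt_trans (k a).
  have := block_imb_lay i u; have := k o0; have := k o1; have := k o2.
  by move: E h0 h1 h2 t0; lra.
have := h o0; have := h o1; have := h o2 => h2 h1 h0.
rewrite ifN; last by rewrite -leNgt E; move: h0 h1 h2 t0; lra.
split; first by rewrite E; move: h0 h1 h2 t0; lra.
move=> i a; have [k|k] := key i; last by apply: lt_trans (k a) _; rewrite oppr_lt0.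
have := block_imb_lay i u; have := k o0; have := k o1; have := k o2.
by move: E h0 h1 h2 t0; lra.
Qed.

Lemma lay_shared d m (i : nat) (l : box 'I_m d) (k k' : 'I_m) (x : {ffun box (csite m) d.+1 -> bool}) :
  k.+1 = k' :> nat ->
  lay o2 [ffun y => blk (@cyc m) (ins i k l) x (rot i y)] =
  lay o0 [ffun y => blk (@cyc m) (ins i k' l) x (rot i y)].
Proof.
move=> kk; congr (_ * _); apply: eq_bigr => y _; congr (_ * (nat_of_bool _)%:R).
have E kk' a : blk (@cyc m) (ins i kk' l) x (rot i ((a, y) : box 'I_3 d.+1)) =
    x (ins i (cyc kk' a) (bsite (@cyc m) l y)).
  by rewrite ffunE; congr (x _); apply: bsite_ins.
rewrite [LHS]ffunE [RHS]ffunE !E (_ : cyc k o2 = cyc k' o0) //.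
by congr (_, _); apply/val_inj; rewrite /= modn_small kk.
Qed.

Lemma sum_cyc m (G : csite m -> R) :
  \sum_k \sum_a om3 a * G (cyc k a) = \sum_c chi R c * G c.
Proof.
rewrite [RHS]sum_pair.
transitivity (\sum_(k < m) (1 / 2 * G (k, false) - G (k, true)) + \sum_(k < m) 1 / 2 * G (ordS k, false)).
  rewrite -big_split /=; apply: eq_bigr => k _.
  by rewrite !big_ord_recl big_ord0 /om3 /tri /= /cyc /tri /=; lra.
have -> : \sum_(k < m) 1 / 2 * G (ordS k, false) = \sum_(k < m) 1 / 2 * G (k, false).
  by rewrite [RHS](reindex_inj (@ordS_inj m)).
rewrite -big_split /=; apply: eq_bigr => k _.
by rewrite big_bool /chi /sgb /= expr0 expr1; lra.
Qed.

Lemma sum_block_imb d m (x : {ffun box (csite m) d -> bool}) :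
  \sum_t block_imb (blk (@cyc m) t x) = \sum_v bw (@chi R m) v * (x v)%:R.
Proof.
rewrite -(sum_bsite (@sum_cyc m) (fun v => (x v)%:R)).
by apply: eq_bigr => t _; apply: eq_bigr => y _; rewrite ffunE.
Qed.

End Blocks.

Section Balanced.
Variable R : realType.
Local Notation ln2 := (ln 2%:R : R).
Variables (d m : nat) (e mu : R).
Hypothesis m_gt1 : (1 < m)%N.
Hypothesis t4 : forall w,
  #|[set x : {ffun box (csite 2) d.+1 -> bool} | t4_ok x && bal4 e w x]|%:R <=
    expR (ln2 * (4 ^+ d.+1 * (1 / 2 - 1 / (32 * d.+1%:R)))).
Hypothesis mu_ge0 : 0 <= mu.
Hypothesis cub : (cube_homs xpredT hc d.+1)%:R <= expR (ln2 / 2 * 2 ^+ d.+1 + mu).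

Definition hardcore_configs : {set {ffun box (csite m) d.+1 -> bool}} := [set x | hardcore (@cyc m) x].

(** The subtracted logarithm pays for choosing a direction and one of [9] windows at every bad
    block; [loss] is the term with [mu] in [chess_events]. *)
Definition bad_rate : R := ln2 / (32 * d.+1%:R) * 2 ^+ d.+1 - ln (9 * d.+1)%:R.
Definition loss : R := 9 * d.+1%:R * mu * m%:R ^+ d.+1 / m%:R ^+ 2.

Lemma bad_count (U : {set box 'I_m d.+1}) :
  #|[set x in hardcore_configs | [forall t in U, bad_block e (blk (@cyc m) t x)]]|%:R <=
    #|hardcore_configs|%:R * expR loss * expR (- bad_rate) ^+ #|U|.
Proof.
pose I : finType := ('I_d.+1 * ('I_3 * 'I_3))%type.
pose r0 : I := (ord0, (o0, o0)).
pose g (r : {ffun box 'I_m d.+1 -> I}) t (u : {ffun box 'I_3 d.+1 -> bool}) :=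
  bal e (r t).2 [ffun y => u (rot (r t).1 y)].
pose F r := [set x | hardcore (@cyc m) x && [forall t in U, g r t (blk (@cyc m) t x)]].
pose P := pffun_on r0 (mem U) (mem [set: I]).
have cov x : x \in [set x in hardcore_configs | [forall t in U, bad_block e (blk (@cyc m) t x)]] ->
    exists2 r, r \in P & x \in F r.
  rewrite !inE => /andP[hx /forall_inP bx].
  exists [ffun t => if t \in U then odflt r0 [pick r : I | bal e r.2 [ffun y => blk (@cyc m) t x (rot r.1 y)]] else r0].
    apply/pffun_onP; split; last by move=> r _; rewrite inE.
    by apply/supportP => t tU; rewrite ffunE (negbTE tU).
  rewrite inE hx /=; apply/forall_inP => t tU; rewrite /g ffunE tU.
  case: pickP => [//|no]; have /existsP[r br] := bx t tU.
  by have := no r; rewrite br.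
apply: le_trans (_ : (\sum_(r in P) #|F r|)%:R <= _); first by rewrite ler_nat card_le_cover.
pose X := #|hardcore_configs|%:R * expR (loss - ln2 / (32 * d.+1%:R) * 2 ^+ d.+1 * #|U|%:R).
have each r : #|F r|%:R <= X.
  apply: (@chess_events R d.+1 m (g r) U (ln2 / (32 * d.+1%:R)) mu m_gt1 _ mu_ge0 cub) => t.
  rewrite (sys_alt2_rot R (r t).1 (fun v => bal e (r t).2 v)).
  apply: le_trans (t4 (r t).2) _; rewrite ler_expR le_eqVlt; apply/orP; left; apply/eqP.
  by field; rewrite addrC natr1 pnatr_eq0.
rewrite natr_sum; apply: le_trans (ler_sum _ (fun r _ => each r)) _.
rewrite sumr_const card_pffun_on cardsT !card_prod !card_ord.
have D0 : 0 < (9 * d.+1)%:R :> R by rewrite ltr0n.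
rewrite -[leLHS]mulr_natr natrX (_ : (d.+1 * (3 * 3) = 9 * d.+1)%N); last by rewrite mulnC.
rewrite -[(9 * d.+1)%:R]lnK ?posrE // /X -!mulrA ler_wpM2l // -!expRM_natl -!expRD ler_expR.
by rewrite /bad_rate le_eqVlt; apply/orP; left; apply/eqP; ring.
Qed.

Let Om : finType := {x | x \in hardcore_configs}.
Let config (o : Om) : {ffun box (csite m) d.+1 -> bool} := val o.
Let cell_of (o : Om) (T : grid d m) := blk (@cyc m) (tobox T) (config o).
Let bads (o : Om) : {set grid d m} := [set T | bad_block e (cell_of o T)].
Let phase (o : Om) (T : grid d m) : bool := 0 < block_imb R (cell_of o T).

Hypothesis d_gt1 : (1 < d)%N.
Hypothesis e_gt0 : 0 < e.
Hypothesis e_le : e <= 1 / 12.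

Let good (o : Om) T : T \notin bads o ->
  if phase o T
  then (1 / 4 - e) * 2 ^+ d.+1 <= block_imb R (cell_of o T) /\
       forall (i : 'I_d.+1) a, 0 < lay R a [ffun y => cell_of o T (rot i y)]
  else block_imb R (cell_of o T) <= - ((1 / 4 - e) * 2 ^+ d.+1) /\
       forall (i : 'I_d.+1) a, lay R a [ffun y => cell_of o T (rot i y)] < 0.
Proof. by rewrite inE => ng; apply: good_block e_le ng; apply: ltnW. Qed.

Let bads_consistent (o : Om) : consistent (bads o) (phase o).
Proof.
move=> i l a a' aa' /good g /good g'.
have := lay_shared R i (tobox l) (config o) aa'; rewrite -!tobox_point => sh.
move: g g'; rewrite /phase; case: ifP => _ [_ g]; case: ifP => _ [_ g'] //; exfalso;
  have := g i o2; have := g' i o0; rewrite /cell_of sh => h1 h2;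
  by have := lt_trans h1 h2; rewrite ltxx.
Qed.

Let bads_count (U : {set grid d m}) :
  #|[set o | U \subset bads o]|%:R <= #|hardcore_configs|%:R * expR loss * expR (- bad_rate) ^+ #|U|.
Proof.
rewrite -(card_imset U (@tobox_inj 'I_m d.+1)); apply: le_trans (bad_count _).
rewrite ler_nat -(card_imset [set o | U \subset bads o] (val_inj : injective (val : Om -> _))).
apply: subset_leq_card; apply/subsetP => _ /imsetP[o + ->]; rewrite !inE => /subsetP sub.
have /= := valP o; rewrite inE => -> /=.
apply/forall_inP => _ /imsetP[T /sub + ->]; by rewrite inE.
Qed.

Let majority_sum (T : finType) (P : {set T}) (S : T -> R) (A B c : R) :
  (forall t, t \in P -> A <= S t) -> (forall t, - B <= S t) -> 0 <= A -> 0 <= B ->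
  (1 - c) * #|T|%:R <= #|P|%:R -> ((1 - c) * A - c * B) * #|T|%:R <= \sum_t S t.
Proof.
move=> hA hB A0 B0 hP.
apply: le_trans (_ : \sum_t (- B + (A + B) * (t \in P)%:R) <= _); last first.
  apply: ler_sum => t _; case: (boolP (t \in P)) => tP; last by rewrite mulr0 addr0.
  by rewrite mulr1 addrC addrK hA.
rewrite big_split /= sumr_const -mulr_sumr -natr_sum.
rewrite (_ : (\sum_t (t \in P : nat))%N = #|P|); last first.
  by rewrite -sum1_card [RHS]big_mkcond; apply: eq_bigr => t _; case: (t \in P).
have : (A + B) * ((1 - c) * #|T|%:R) <= (A + B) * #|P|%:R by rewrite ler_wpM2l ?addr_ge0.
by rewrite -mulr_natr; lra.
Qed.

(** If one phase holds a fraction [1 - c] of the blocks, these contribute at least [1 / 4 - e] of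
    their volume and the others take away at most [1 / 2] of theirs; the total exceeds
    [1 / 4 - e - c] of the volume. So a balanced configuration is undominated. *)
Lemma hardcore_balanced c : 0 < c -> c <= 1 -> 128 * d.+1%:R / c <= bad_rate ->
  #|[set x in hardcore_configs |
     `|\sum_v bw (@chi R m) v * (x v)%:R| <= (1 / 4 - e - c) * (2 * m%:R) ^+ d.+1]|%:R <=
  #|hardcore_configs|%:R * expR loss * expR (- (c / (4 * d.+1%:R) * m%:R ^+ d * rate m bad_rate)).
Proof.
move=> c0 c1 cE.
have K0 : 0 <= #|hardcore_configs|%:R * expR loss by rewrite mulr_ge0 // expR_ge0.
apply: le_trans (percolation d_gt1 K0 m_gt1 bads_consistent bads_count c0 c1 cE).
rewrite ler_nat -(card_imset (undominated bads phase c) (val_inj : injective (val : Om -> _))).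
apply: subset_leq_card; apply/subsetP => x; rewrite inE => /andP[xh small].
apply/imsetP; exists (exist _ x xh) => //; set o : Om := exist _ x xh.
rewrite inE; apply/forallP => b; rewrite ltNge; apply/negP => dom.
pose A : R := (1 / 4 - e) * 2 ^+ d.+1; pose B : R := 2 ^+ d.+1 / 2.
have A0 : 0 <= A by rewrite mulr_ge0 ?exprn_ge0 //; move: e_le; lra.
have B0 : 0 <= B by rewrite divr_ge0 ?exprn_ge0.
have Bb T : `|block_imb R (cell_of o T)| <= B by apply: block_imb_le.
have gridE : #|{: grid d m}|%:R = m%:R ^+ d.+1 :> R by rewrite card_grid natrX.
have tot : \sum_T block_imb R (cell_of o T) = \sum_v bw (@chi R m) v * (x v)%:R.
  rewrite -sum_block_imb; have [q qK Kq] := tobox_bij 'I_m d.+1.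
  by rewrite (reindex (@tobox 'I_m d.+1)) //; exists q => T _.
have big : ((1 - c) * A - c * B) * m%:R ^+ d.+1 <= `|\sum_T block_imb R (cell_of o T)|.
  rewrite -gridE; rewrite -gridE in dom; case: b dom => dom.
    apply: le_trans (ler_norm _); apply: (majority_sum _ _ A0 B0 dom) => T.
      by rewrite inE => /andP[/good + /eqP pT]; rewrite pT => -[].
    by have := Bb T; rewrite ler_norml => /andP[].
  rewrite -normrN -sumrN; apply: le_trans (ler_norm _).
  apply: (majority_sum _ _ A0 B0 dom) => T.
    by rewrite inE => /andP[/good + /eqP pT]; rewrite pT lerNr => -[].
  by have := Bb T; rewrite ler_norml lerN2 => /andP[].
have N0 : 0 < 2 ^+ d.+1 * m%:R ^+ d.+1 :> R by rewrite mulr_gt0 ?exprn_gt0 // ltr0n ltnW.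
have := le_trans big _; rewrite tot => /(_ _ small); rewrite exprMn leNgt => /negP; apply.
have -> : ((1 - c) * A - c * B) * m%:R ^+ d.+1 =
   ((1 / 4 - e - c) + c * (1 / 4 + e)) * (2 ^+ d.+1 * m%:R ^+ d.+1).
  by rewrite /A /B; field.
by rewrite ltr_pM2r // ltrDl mulr_gt0 // addr_gt0 // divr_gt0.
Qed.

End Balanced.

(** * Numerical estimates *)

Section Estimate.
Variable R : realType.
Local Notation ln2 := (ln 2%:R : R).

Lemma bad_rate_ge d : (1 < d)%N -> 576 * d.+1%:R ^+ 2 <= 2 ^+ d :> R ->
  2 ^+ d / (64 * d.+1%:R) <= bad_rate R d.
Proof.
move=> d1 h; rewrite /bad_rate natrM; set D := d.+1%:R in h *; set N := 2 ^+ d in h *.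
have D0 : 0 < D by rewrite ltr0n.
have l9 : ln (9 * D) <= 9 * D by rewrite ltW // ln_sublinear // mulr_gt0.
have l2 := ln2_ge R.
have hD : 9 * D <= N / (64 * D).
  by rewrite ler_pdivlMr ?mulr_gt0 //; move: h; rewrite expr2; clear; lra.
have : 1 / 2 * (N / (16 * D)) <= ln2 * (N / (16 * D)).
  by rewrite ler_wpM2r // divr_ge0 ?exprn_ge0 // mulr_ge0 // ltW.
have e1 : ln2 / (32 * D) * 2 ^+ d.+1 = ln2 * (N / (16 * D)).
  by rewrite exprS -/N; clearbody D N; move: (gt_eqF D0); clear => Dn; field; rewrite Dn.
have e2 : 1 / 2 * (N / (16 * D)) = 2 * (N / (64 * D)).
  by clearbody D N; move: (gt_eqF D0); clear => Dn; field; rewrite Dn.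
rewrite e1 e2; move: l9 hD; move: (ln (9 * D)) (9 * D) (N / (64 * D)) (ln2 * _) => l x y z.
by clear; lra.
Qed.

Lemma ln_sqr_le (x : R) : 1 <= x -> ln x ^+ 2 <= 4 * x.
Proof.
move=> x1; have x0 : 0 < x by apply: lt_le_trans x1.
have l0 := ln_ge0 x1.
rewrite -{2}(lnK (_ : x \is Num.pos)) ?posrE //.
have -> : expR (ln x) = expR (ln x / 2) ^+ 2.
  by rewrite -expRM_natl; congr expR; clear; field.
have -> : 4 * expR (ln x / 2) ^+ 2 = (2 * expR (ln x / 2)) ^+ 2 by clear; ring.
rewrite lerXn2r ?nnegrE ?mulr_ge0 ?expR_ge0 //.
by have := expR_ge1Dx (ln x / 2); clear; lra.
Qed.

(** Exponents are measured in units of [m ^ d * Y] with [Y = 2 ^ d / d.+1 ^ 4]. The gain is at least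
    [c * d.+1 ^ 2 / 256] for short lines and a multiple of [c * 2 ^ d * d.+1 / ln m ^ 2] for long
    ones; there the loss, of order [1 / m], is absorbed by [ln m ^ 2 <= 4 * m]. *)
Lemma final_estimate d m (c : R) : 0 < c -> c <= 1 -> (1 < d)%N -> (1 < m)%N ->
  2 ^+ 23 * d.+1%:R ^+ 2 <= c * 2 ^+ d -> 146 * 256 <= c * d.+1%:R ^+ 2 ->
  loss d m (ln2 * 2 ^+ d / d%:R ^+ 5) + 2 * (2 * m%:R) ^+ d / (d.+1%:R ^+ 4 * ln (2 * m%:R) ^+ 2) <=
    c / (4 * d.+1%:R) * m%:R ^+ d * rate m (bad_rate R d) /\
  128 * d.+1%:R / c <= bad_rate R d.
Proof.
move=> c0 c1 d1 m1 hN hD; rewrite /loss.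
set D := d.+1%:R in hN hD *; set N := 2 ^+ d in hN *.
have D3 : 3 <= D by rewrite (ler_nat R 3).
have D0 : 0 < D by rewrite ltr0n.
have m2 : 2 <= m%:R :> R by rewrite (ler_nat R 2).
have m0 : 0 < m%:R :> R by rewrite ltr0n ltnW.
have N0 : 0 < N by rewrite exprn_gt0.
have N1 : 2 ^+ 23 * D ^+ 2 <= N by apply: le_trans hN _; rewrite ler_piMl // ltW.
have D2 : 0 <= D ^+ 2 by rewrite exprn_ge0 // ltW.
have E1 : N / (64 * D) <= bad_rate R d.
  by apply: bad_rate_ge => //; rewrite -/D -/N; move: N1 D2; clear; lra.
set E := bad_rate R d in E1 *.
have E0 : 0 < E by apply: lt_le_trans E1; rewrite divr_gt0 // mulr_gt0.
split; last first.
  apply: le_trans E1; rewrite ler_pdivrMr // mulrAC ler_pdivlMr ?mulr_gt0 //.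
  by move: hN D2; rewrite expr2; clear; lra.
set P := m%:R ^+ d; have P0 : 0 < P by rewrite exprn_gt0.
have d0 : 0 < d%:R :> R by rewrite ltr0n ltnW.
have dD : D / 2 <= d%:R by rewrite ler_pdivrMr // -natrM ler_nat; move: d1; clear; lia.
have D4 : 0 < D ^+ 4 by rewrite exprn_gt0.
pose Y := N / D ^+ 4; have Y0 : 0 < Y by rewrite divr_gt0.
(* [288 = 9 * 2 ^ 5], from the fifth power of [d >= d.+1 / 2]. *)
have los : 9 * D * (ln2 * N / d%:R ^+ 5) * m%:R ^+ d.+1 / m%:R ^+ 2 <= P * (288 * Y / m%:R).
  have -> : 9 * D * (ln2 * N / d%:R ^+ 5) * m%:R ^+ d.+1 / m%:R ^+ 2 =
      P * (9 * D * (ln2 * N) / m%:R) / d%:R ^+ 5.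
    rewrite [m%:R ^+ d.+1]exprS -/P; move: (gt_eqF d0) (gt_eqF m0); clearbody D N P; clear => h1 h2.
    by field; rewrite h1 h2.
  rewrite ler_pdivrMr ?exprn_gt0 //.
  apply: le_trans (_ : P * (288 * Y / m%:R) * (D / 2) ^+ 5 <= _); last first.
    rewrite ler_wpM2l ?lerXn2r ?nnegrE ?divr_ge0 ?(ltW D0) ?(ltW d0) //.
    by rewrite mulr_ge0 ?(ltW P0) // divr_ge0 ?(ltW m0) // mulr_ge0 // ltW.
  have -> : P * (288 * Y / m%:R) * (D / 2) ^+ 5 = P * (9 * D * (1 * N) / m%:R).
    rewrite /Y; move: (gt_eqF D0) (gt_eqF m0); clearbody D N P; clear => h1 h2.
    by field; rewrite h1 h2.
  rewrite ler_pM2l // ler_pM2r ?invr_gt0 // ler_pM2l ?mulr_gt0 // ler_pM2r //.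
  exact: ln2_le1.
apply: le_trans (lerD los (lexx _)) _.
have lL : ln m%:R <= ln (2 * m%:R) :> R.
  by rewrite ler_ln ?posrE ?mulr_gt0 //; apply: ler_peMl; [exact: ltW|rewrite ler1n].
have lL1 : 1 <= ln (2 * m%:R) :> R.
  apply: le_trans (_ : ln (2 * 2%:R) <= _).
    by rewrite lnM ?posrE ?ltr0n //; have := ln2_ge R; clear; lra.
  by rewrite ler_ln ?posrE ?mulr_gt0 // ler_pM2l.
rewrite exprMn -/N -/P.
have -> : 2 * (N * P) / (D ^+ 4 * ln (2 * m%:R) ^+ 2) = P * (2 * Y / ln (2 * m%:R) ^+ 2).
  have lx : ln (2 * m%:R) != 0 :> R by rewrite gt_eqF // (lt_le_trans _ lL1).
  rewrite /Y; move: (ln (2 * m%:R)) lx (gt_eqF D0); clearbody D N P; clear => l h1 h2.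
  by field; rewrite h1 h2.
rewrite -mulrDr -[leRHS]mulrA [leRHS]mulrCA ler_pM2l //.
rewrite /rate; case: (leP (ln m%:R) (E / 2)) => lm.
  (* [146 = 288 / 2 + 2], by [2 <= m] and [1 <= ln (2 * m)]. *)
  apply: le_trans (_ : 146 * Y <= _).
    have : 288 * Y / m%:R <= 144 * Y.
      rewrite ler_pdivrMr // (_ : 288 * Y = 144 * Y * 2); last by clear; ring.
      by rewrite ler_wpM2l // mulr_ge0 // ltW.
    have : 2 * Y / ln (2 * m%:R) ^+ 2 <= 2 * Y.
      rewrite ler_pdivrMr ?exprn_gt0 ?(lt_le_trans _ lL1) //.
      by apply: ler_peMr; [rewrite mulr_ge0 // ltW|apply: exprn_ege1].
    by clear; lra.
  apply: le_trans (_ : c / (4 * D) * (N / (64 * D)) <= _); last first.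
    by rewrite ler_wpM2l // divr_ge0 ?(ltW c0) // mulr_ge0 // ltW.
  have -> : c / (4 * D) * (N / (64 * D)) = c * D ^+ 2 / 256 * Y.
    rewrite /Y; move: (gt_eqF D0); clearbody D N; clear => h1.
    by field; rewrite h1.
  by rewrite ler_pM2r //; move: hD; clear; lra.
have l0 : 0 < ln m%:R :> R by move: E0 lm; clear; lra.
have l20 : 0 < ln m%:R ^+ 2 :> R by rewrite exprn_gt0.
(* [1154 = 4 * 288 + 2], by [ln_sqr_le]. *)
apply: le_trans (_ : 1154 * Y / ln m%:R ^+ 2 <= _).
  have : 288 * Y / m%:R <= 1152 * Y / ln m%:R ^+ 2.
    rewrite ler_pdivrMr // mulrAC ler_pdivlMr //.
    apply: le_trans (_ : 288 * Y * (4 * m%:R) <= _).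
      apply: ler_wpM2l; first by rewrite mulr_ge0 ?ler0n // ltW.
      by apply: ln_sqr_le; rewrite ler1n ltnW.
    by rewrite le_eqVlt; apply/orP; left; apply/eqP; clear; ring.
  have : 2 * Y / ln (2 * m%:R) ^+ 2 <= 2 * Y / ln m%:R ^+ 2.
    apply: ler_wpM2l; first by rewrite mulr_ge0 // ltW.
    rewrite lef_pV2 ?posrE ?exprn_gt0 ?(lt_le_trans l0 lL) //.
    by rewrite lerXn2r ?nnegrE ?(ltW l0) ?(ltW (lt_le_trans l0 lL)).
  by clear; lra.
rewrite [leRHS]mulrA; apply: ler_wpM2r; first by rewrite invr_ge0 ltW.
apply: le_trans (_ : c / (4 * D) * (N / (64 * D)) ^+ 2 <= _); last first.
  rewrite ler_wpM2l ?divr_ge0 ?mulr_ge0 ?(ltW c0) ?(ltW D0) //.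
  by rewrite lerXn2r ?nnegrE ?(ltW E0) // divr_ge0 ?mulr_ge0 ?(ltW N0) ?(ltW D0).
have -> : c / (4 * D) * (N / (64 * D)) ^+ 2 = c * N * D / (16 * 1024) * Y.
  rewrite /Y; move: (gt_eqF D0); clearbody D N; clear => h1.
  by field; rewrite h1.
rewrite ler_pM2r // ler_pdivlMr; last by rewrite mulr_gt0 // ltr0n.
apply: le_trans (_ : 2 ^+ 23 * D ^+ 2 * D <= _); last by rewrite ler_pM2r.
apply: le_trans (_ : 2 ^+ 23 * 3 ^+ 2 * 3 <= _); first by clear; lra.
apply: (ler_pM _ _ _ D3); rewrite ?mulr_ge0 ?exprn_ge0 ?ler0n //.
apply: ler_wpM2l; first by rewrite exprn_ge0.
by rewrite !expr2; apply: ler_pM; rewrite ?ler0n.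
Qed.

End Estimate.

(** * The torus *)

Lemma box_adj_tobox (C : finType) (e : rel C) d (f f' : {ffun 'I_d -> C}) :
  reflect (exists2 i, e (f i) (f' i) & forall j, j != i -> f j = f' j)
    (box_adj e (tobox f) (tobox f')).
Proof.
apply: (iffP idP) => [|[i ei ej]]; last first.
  case: d f f' i ei ej => [|d] f f' i ei ej; first by case: (i).
  rewrite !(tobox_ins i) box_adj_ins ei; apply/orP; left.
  apply/eqP; congr tobox; apply/ffunP => j; rewrite !ffunE; apply: ej.
  by rewrite eq_sym neq_lift.
elim: d f f' => [|d IH] f f' //= /orP[/andP[e0 /eqP/tobox_inj/ffunP ff]|/andP[/eqP e0 /IH[i ei ej]]].
  exists ord0 => // j; case: (unliftP ord0 j) => [j' -> _|->]; last by rewrite eqxx.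
  by have := ff j'; rewrite !ffunE.
exists (lift ord0 i); first by move: ei; rewrite !ffunE.
move=> j; case: (unliftP ord0 j) => [j' ->|-> _ //].
by rewrite (inj_eq lift_inj) => /ej; rewrite !ffunE.
Qed.

Section Torus.
Variable m : nat.
Hypothesis m_gt1 : (1 < m)%N.

Lemma half_lt (a : 'I_(2 * m)) : (a./2 < m)%N.
Proof. by have := ltn_ord a; rewrite -{1}(odd_double_half a); lia. Qed.

Definition unpos (a : 'I_(2 * m)) : csite m := (Ordinal (half_lt a), odd a).
Definition pos (c : csite m) : nat := (c.1.*2 + c.2)%N.

Lemma unposK a : pos (unpos a) = a.
Proof. by rewrite /pos /= addnC odd_double_half. Qed.

Lemma unpos_inj : injective unpos.
Proof. by move=> a b e; apply/val_inj; rewrite /= -unposK e unposK. Qed.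

Lemma pos_inj : injective pos.
Proof.
move=> [k b] [k' b'] e; have [e1 e2] : k = k' :> nat /\ b = b'.
  by move: e; rewrite /pos /=; case: b; case: b'; lia.
by congr (_, _) => //; apply/val_inj.
Qed.

Lemma cyc_surj (c : csite m) : exists k a, cyc k a = c.
Proof. by case: c => k []; [exists k, o1|exists k, o0]. Qed.

Lemma pos_cyc2 (k : 'I_m) : pos (cyc k o2) = ((k.*2).+2 %% (2 * m))%N.
Proof. by rewrite /pos /= addn0 -[LHS]mul2n muln_modr; congr (_ %% _)%N; lia. Qed.

Lemma st_adj_unpos a b : st_adj (@cyc m) (unpos a) (unpos b) =
  ((a.+1 == b %[mod 2 * m])%N || (b.+1 == a %[mod 2 * m])%N).
Proof.
have step (x y : 'I_(2 * m)) : (x.+1 == y %[mod 2 * m])%N -> st_adj (@cyc m) (unpos x) (unpos y).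
  rewrite (modn_small (ltn_ord y)) => /eqP xy; apply/st_adjP.
  exists (unpos x).1; case ox: (odd x).
    exists o1, o2; split=> //; first by rewrite /unpos ox.
    apply: pos_inj; rewrite unposK pos_cyc2 -xy; congr (_ %% _)%N.
    by have := odd_double_half x; rewrite ox /=; lia.
  exists o0, o1; split=> //; first by rewrite /unpos ox.
  apply: pos_inj; rewrite unposK -xy /pos /=.
  have := odd_double_half x; have := ltn_ord x; rewrite ox => lx xE.
  rewrite modn_small; first by lia.
  by have := half_lt x; lia.
apply/idP/orP => [/st_adjP[k [c [c' [cc e e']]]]|[/step //|/step]]; last by rewrite st_adj_sym.
rewrite -(unposK a) -(unposK b) -e -e' {e e'}.
have h01 : ((pos (cyc k o0)).+1 == pos (cyc k o1) %[mod 2 * m])%N.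
  by rewrite /pos /= addn0 addn1.
have h12 : ((pos (cyc k o1)).+1 == pos (cyc k o2) %[mod 2 * m])%N.
  by rewrite pos_cyc2 modn_mod /pos /= addn1.
have ce x : x = o0 \/ x = o1 \/ x = o2.
  by case: x => -[|[|[|]]] // lt; [left|right; left|right; right]; apply/val_inj.
move: cc; case: (ce c) => [->|[->|->]]; case: (ce c') => [->|[->|->]] // _;
  by [left|right].
Qed.

Variable d : nat.

Definition to_box (u : torus (2 * m) d) : box (csite m) d := tobox [ffun j => unpos (u j)].

Lemma to_box_bij : bijective to_box.
Proof.
apply: inj_card_bij => [u v /tobox_inj/ffunP e|].
  by apply/ffunP => j; have := e j; rewrite !ffunE => /unpos_inj.
by rewrite card_box card_ffun !card_ord card_prod card_ord card_bool mulnC.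
Qed.

Lemma torus_adj_box u v : torus_adj u v = box_adj (st_adj (@cyc m)) (to_box u) (to_box v).
Proof.
apply/existsP/box_adj_tobox => [[i /andP[/forallP ne]]|[i]].
  rewrite -st_adj_unpos => adj; exists i; first by rewrite !ffunE.
  by move=> j ji; have := ne j; rewrite !ffunE (negbTE ji) => /eqP/negbFE/eqP ->.
rewrite !ffunE => adj ne; exists i; rewrite -st_adj_unpos adj andbT; apply/forallP => j.
case: (eqVneq j i) => [->|ji]; last first.
  by have := ne j ji; rewrite !ffunE => /unpos_inj ->; rewrite eqxx.
rewrite eqb_id; apply/eqP => uv; move: adj; rewrite uv st_adj_unpos orbb.
rewrite -[(v i).+1]addn1 -[X in _ == X %[mod _]]addn0 eqn_modDl mod0n modn_small //.
by move: m_gt1; clear; lia.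
Qed.

Lemma chi_to_box (R : comPzRingType) (u : torus (2 * m) d) :
  bw (@chi R m) (to_box u) = (-1) ^+ odd (\sum_(i < d) u i)%N.
Proof.
rewrite /to_box; elim: (d) u => [|n IH] u /=; first by rewrite big_ord0.
rewrite big_ord_recl oddD signr_addb ffunE; congr (_ * _).
transitivity (bw (@chi R m) (tobox [ffun j => unpos ([ffun j => u (lift ord0 j)] j)])).
  by congr bw; congr tobox; apply/ffunP => j; rewrite !ffunE.
by rewrite IH; congr (_ ^+ odd _); apply: eq_bigr => j _; rewrite ffunE.
Qed.

Definition occupied (x : {ffun box (csite m) d -> bool}) : {set torus (2 * m) d} :=
  [set u | x (to_box u)].

Lemma occupied_inj : injective occupied.
Proof.
move=> x x' /setP e; have [q qK Kq] := to_box_bij; apply/ffunP => v.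
by have := e (q v); rewrite !inE Kq.
Qed.

Lemma independent_occupied x : independent (@torus_adj (2 * m) d) (occupied x) = hardcore (@cyc m) x.
Proof.
rewrite /hardcore /blk (all_block_hom _ _ cyc_surj); have [q qK Kq] := to_box_bij.
apply/forall_inP/hom_onP => [H|[_ H] u].
  split=> // v v' vv'; apply/negP => /andP[xv xv'].
  have qv : q v \in occupied x by rewrite inE Kq.
  have /forall_inP/(_ (q v')) := H _ qv.
  by rewrite inE Kq torus_adj_box !Kq vv' => /(_ xv').
rewrite inE => xu; apply/forall_inP => w; rewrite inE => xw; apply/negP.
by rewrite torus_adj_box => /H; rewrite /hc xu xw.
Qed.

Lemma indep_sets_torus : indep_sets (@torus_adj (2 * m) d) =
  occupied @: [set x | hardcore (@cyc m) x].
Proof.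
apply/setP => I; rewrite inE; apply/idP/imsetP => [hI|[x + ->]]; last first.
  by rewrite inE independent_occupied.
have [q qK Kq] := to_box_bij.
have e : I = occupied [ffun v => q v \in I] by apply/setP => u; rewrite inE ffunE qK.
by exists [ffun v => q v \in I] => //; rewrite inE -independent_occupied -e.
Qed.

Lemma occupied_imbalance (R : comPzRingType) x :
  #|occupied x :&: torus_even (2 * m) d|%:R - #|occupied x :&: torus_odd (2 * m) d|%:R =
  \sum_v bw (@chi R m) v * (x v)%:R.
Proof.
have [q qK Kq] := to_box_bij.
rewrite [RHS](reindex to_box) /=; last by exists q => v _.
rewrite -!sum1_card !natr_sum [X in X - _]big_mkcond [X in _ - X]big_mkcond -sumrB /=.
apply: eq_bigr => u _; rewrite chi_to_box !inE.
by case: (odd _); case: (x _); rewrite /= ?expr0 ?expr1 ?mulr1 ?mulr0 ?subr0 ?sub0r.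
Qed.

End Torus.

(** * Choice of the constants *)

Theorem corollary1p6 (R : realType) (eps : R) (eps_gt0 : 0 < eps) :
  exists2 d0 : nat, (0 < d0)%N &
    forall L d : nat, ~~ odd L -> (4 <= L)%N -> (d0 <= d)%N ->
      unif_prob R (indep_sets (@torus_adj L d))
        (fun I : {set torus L d} =>
           `| #|I :&: torus_even L d|%:R - #|I :&: torus_odd L d|%:R |
             <= (25%:R / 100%:R - eps) * L%:R ^+ d :> R)
      <= expR (- (2 * L%:R ^+ (d - 1)%N / (d%:R ^+ 4 * (ln L%:R) ^+ 2))).
Proof.
pose eps' := Num.min eps (1 / 4).
have eps'0 : 0 < eps' by rewrite lt_min eps_gt0 divr_gt0.
have eps'4 : eps' <= 1 / 4 by rewrite ge_min lexx orbT.
have eps'e : eps' <= eps by rewrite ge_min lexx.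
(* [e] is lost in the threshold for good blocks and [c] in the fraction of blocks outside the
   dominating phase; [e + c <= eps]. *)
pose e := eps' / 4; pose c := eps' / 2.
have e0 : 0 < e by rewrite divr_gt0.
have e12 : e <= 1 / 12 by rewrite /e; move: eps'4; clear; lra.
have e4 : e <= 1 / 4 by move: e12; clear; lra.
have c0 : 0 < c by rewrite divr_gt0.
have c1 : c <= 1 by rewrite /c; move: eps'4; clear; lra.
have [d1 t4] := t4_bound e0 e4; have [d2 cube] := cube_homs_bound R.
pose a := (Num.truncn c^-1).+1.
have ac : 1 <= c * a%:R.
  by rewrite mulrC -ler_pdivrMr // div1r ltW // truncnS_gt.
have [d3 expo] := poly_le_exp2 (a * 2 ^ 25) 2.
exists (d1 + d2 + d3 + 146 * 256 * a + 4)%N => [|L d oL L4 dd]; first by rewrite addnS.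
have [m Lm] : exists m, L = (2 * m)%N by exists L./2; rewrite mul2n even_halfK.
have [n dn] : exists n, d = n.+1 by exists d.-1; rewrite prednK //; move: dd; clear; lia.
rewrite {}dn {}Lm in oL L4 dd *; move: L4 dd => {oL} m4 dd.
have m1 : (1 < m)%N by move: m4; clear; lia.
have nb : [/\ (d1 <= n)%N, (d2 <= n)%N, (d3 <= n)%N, (146 * 256 * a <= n)%N & (2 < n)%N].
  by move: dd; move: (146 * 256 * a)%N; clear => k; split; lia.
have [n1 n2 n3 na n4] := nb.
have n0 : (1 < n)%N by apply: ltnW.
(* The excess of the exponent in [cube_homs_bound] over its ground state value
   [ln 2 / 2 * 2 ^ n.+1]. *)
pose mu : R := ln 2%:R * 2 ^+ n / n%:R ^+ 5.
have mu0 : 0 <= mu by rewrite divr_ge0 ?exprn_ge0 // mulr_ge0 ?exprn_ge0 // ltW // ln2_gt0.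
have cub : (cube_homs xpredT hc n.+1)%:R <= expR (ln 2%:R / 2 * 2 ^+ n.+1 + mu) :> R.
  rewrite cube_homs_ind; apply: le_trans (cube n n2) _; rewrite ler_expR le_eqVlt.
  apply/orP; left; apply/eqP; rewrite /mu natrX [2 ^+ n.+1]exprS; field.
  by rewrite pnatr_eq0; move: n0; clear; lia.
have hN : 2 ^+ 23 * n.+1%:R ^+ 2 <= c * 2 ^+ n :> R.
  have h1 : (a * 2 ^ 25)%:R * n%:R ^+ 2 <= 2 ^+ n :> R by rewrite -!natrX -natrM ler_nat expo.
  apply: le_trans (_ : c * ((a * 2 ^ 25)%:R * n%:R ^+ 2) <= _); last by rewrite ler_pM2l.
  rewrite natrM natrX.
  have h2 : n.+1%:R ^+ 2 <= 4 * n%:R ^+ 2 :> R.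
    by rewrite -!natrX -natrM ler_nat; move: n0; clear; nia.
  apply: le_trans (_ : 1 * (2 ^+ 25 * n%:R ^+ 2) <= _).
    rewrite mul1r (_ : 2 ^+ 25 = 2 ^+ 23 * 4); last first.
      by transitivity (2 ^+ 23 * 2 ^+ 2 : R); [rewrite -exprD|congr (_ * _); ring].
    by rewrite -mulrA ler_wpM2l ?exprn_ge0.
  rewrite -[a%:R * _ * _]mulrA [leRHS]mulrA; apply: ler_wpM2r ac.
  by rewrite mulr_ge0 ?exprn_ge0.
have hD : 146 * 256 <= c * n.+1%:R ^+ 2 :> R.
  have h1 : (146 * 256 * a)%:R <= n%:R :> R by rewrite ler_nat.
  apply: le_trans (_ : 146 * 256 * (c * a%:R) <= _); first by rewrite ler_peMr ?mulr_ge0.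
  rewrite mulrCA ler_pM2l // -!natrM -natrX ler_nat.
  by apply: leq_trans na _; rewrite -mulnn; apply: leq_trans (leqnSn n) _; rewrite leq_pmulr.
have [est rate_big] := final_estimate c0 c1 n0 m1 hN hD.
have main := hardcore_balanced m1 (t4 n n1) mu0 cub n0 e0 e12 c0 c1 rate_big.
rewrite /unif_prob; set Z := indep_sets _.
have ZE : #|Z| = #|hardcore_configs n m|.
  by rewrite /Z (indep_sets_torus m1) (card_imset _ (@occupied_inj m m1 n.+1)).
have Z0 : 0 < #|Z|%:R :> R.
  rewrite ltr0n card_gt0; apply/set0Pn; exists set0; rewrite inE.
  by apply/forall_inP => u; rewrite inE.
rewrite ler_pdivrMr // ZE.
apply: le_trans (_ : #|[set x in hardcore_configs n m |
     `|\sum_v bw (@chi R m) v * (x v)%:R| <= (1 / 4 - e - c) * (2 * m%:R) ^+ n.+1]|%:R <= _).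
  rewrite ler_nat -(card_imset _ (@occupied_inj m m1 n.+1)); apply: subset_leq_card.
  apply/subsetP => I; rewrite inE /Z (indep_sets_torus m1) => /andP[/imsetP[x xh ->] small].
  apply/imsetP; exists x => //; rewrite inE xh /= -(occupied_imbalance m1 R x).
  apply: le_trans small _; rewrite natrM ler_wpM2r ?exprn_ge0 ?mulr_ge0 //.
  rewrite (_ : 25%:R / 100%:R = 1 / 4); last by clear; field.
  by rewrite /e /c; move: eps'e eps'0; clear; lra.
apply: le_trans main _; rewrite -[leLHS]mulrA [leRHS]mulrC ler_wpM2l // -expRD ler_expR subn1 /= natrM.
by rewrite lerBlDr addrC lerBrDr.
Qed.
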